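(* Let $E\to M$ be a smooth vector bundle. A linear generalised complex structure $\mathcal J$ on $E$ is equivalent to the following data: (1) a vector bundle morphism $j\colon TM\oplus E^*\to TM\oplus E^*$ with $j^2=-\mathrm{id}_{TM\oplus E^*}$, i.e. a complex structure in the fibres of $TM\oplus E^*$, and (2) a choice of $j$-equivalence class of (skew-symmetric) Dorfman $TM\oplus E^*$-connections $\Delta$ on $E\oplus T^*M$ such that $TM\oplus E^*\to M$ (with fibrewise complex structure $j$), equipped with the bracket $$\mathbb A(\nu_1,\nu_2)=\tfrac12\bigl([\![\nu_1,\nu_2]\!]_\Delta-[\![j\nu_1,j\nu_2]\!]_\Delta\bigr)$$ defined by the corresponding dull brackets and the anchor $$\rho\colon TM\oplus E^*\to T_{\mathbb C}M,\qquad \rho(\nu)=\mathrm{pr}_{T_{\mathbb C}M}\bigl(\tfrac12(\nu\otimes1-(j\nu)\otimes i)\bigr),$$ is a complex Lie algebroid. The equivalence is the bijection sending $\mathcal J$ to its side morphism $j$ and the $j$-equivalence class of skew-symmetric Dorfman connections adapted to $\mathcal J$.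
   Context: Manifolds and vector bundles are smooth and real. Double vector bundle. For $q_E\colon E\to M$, $TE$ is a vector bundle over $E$ and over $TM$ (projection $Tq_E$), and $T^*E$ is a vector bundle over $E$ and over $E^*$ (projection $\langle r_E(\theta_{e_m}),e'_m\rangle=\theta_{e_m}(\frac{d}{dt}|_{0}(e_m+te'_m))$). So $TE\oplus T^*E$ (sum over $E$) is a double vector bundle with sides $E$, $TM\oplus E^*$ and core $E\oplus T^*M$. Core sections: $(e,\theta)^\uparrow(e'_m)=(\frac{d}{dt}|_{0}(e'_m+te(m)),(T_{e'_m}q_E)^t\theta(m))$. Core-linear sections: for $\varphi\in\Gamma(\mathrm{Hom}(E,E\oplus T^*M))$, $\widetilde\varphi(e(m))=(\varphi(e))^\uparrow(e(m))$. Duality: $\langle(X,\epsilon),(e,\theta)\rangle=\epsilon(e)+\theta(X)$. $TE\oplus T^*E\to E$ is the standard Courant algebroid over $E$ (pairing $\langle(v,\theta),(w,\omega)\rangle=\theta(w)+\omega(v)$, bracket $[\![(X,\theta),(Y,\omega)]\!]=([X,Y],\mathcal L_X\omega-\iota_Yd\theta)$). A generalised complex structure on $E$ is a vector bundle morphism $\mathcal J$ of $TE\oplus T^*E$ over $\mathrm{id}_E$ with $\mathcal J^2=-1$, orthogonal, with $[\![e_1,e_2]\!]-[\![\mathcal Je_1,\mathcal Je_2]\!]+\mathcal J([\![\mathcal Je_1,e_2]\!]+[\![e_1,\mathcal Je_2]\!])=0$. It is linear if it is also a vector bundle morphism of $TE\oplus T^*E\to TM\oplus E^*$ over a map $j$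 of $TM\oplus E^*$, its side morphism. A Dorfman $TM\oplus E^*$-connection on $E\oplus T^*M$ is an $\mathbb R$-bilinear $\Delta\colon\Gamma(TM\oplus E^* )\times\Gamma(E\oplus T^*M)\to\Gamma(E\oplus T^*M)$ with $\Delta_\nu(f\tau)=f\Delta_\nu\tau+\mathrm{pr}_{TM}(\nu)(f)\tau$, $\Delta_{f\nu}\tau=f\Delta_\nu\tau+\langle\nu,\tau\rangle(0,df)$, $\Delta_\nu(0,df)=(0,d(\mathrm{pr}_{TM}(\nu)(f)))$. Its dual dull bracket $[\![\cdot,\cdot]\!]_\Delta$ on $\Gamma(TM\oplus E^* )$ is defined by $\mathrm{pr}_{TM}(\nu_1)\langle\nu_2,\tau\rangle=\langle[\![\nu_1,\nu_2]\!]_\Delta,\tau\rangle+\langle\nu_2,\Delta_{\nu_1}\tau\rangle$; $\Delta$ is skew-symmetric if $[\![\cdot,\cdot]\!]_\Delta$ is. The horizontal lift $\sigma^\Delta\colon\Gamma(TM\oplus E^* )\to\Gamma_E(TE\oplus T^*E)$ is $\sigma^\Delta(X,\epsilon)(e(m))=(T_me\,X(m),d\ell_\epsilon(e(m)))-(\Delta_{(X,\epsilon)}(e,0))^\uparrow(e(m))$, $\ell_\epsilon$ being the linear function on $E$ defined by $\epsilon$. $\Delta$ is adapted to $\mathcal J$ if $\mathcal J(\sigma^\Delta(\nu))=\sigma^\Delta(j\nu)$ for all $\nu$. Two skew-symmetric Dorfman connections $\Delta_1,\Delta_2$ are $j$-equivalent if the change of splitting $\Psi_{12}\in\Omega^2(TM\oplus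 E^*,E^* )$, defined by $[\![\nu_1,\nu_2]\!]_{\Delta_2}=[\![\nu_1,\nu_2]\!]_{\Delta_1}+(0,\Psi_{12}(\nu_1,\nu_2))$, satisfies $\Psi_{12}(\nu_1,\nu_2)=\Psi_{12}(j\nu_1,j\nu_2)$ for all $\nu_1,\nu_2$. A complex Lie algebroid structure on a complex vector bundle $(Q,j)$ ($j$ being multiplication by $i$) is a $\mathbb C$-bilinear Lie bracket on $\Gamma(Q)$ and a complex vector bundle morphism $\lambda\colon Q\to T_{\mathbb C}M$ with $[q_1,fq_2]=\lambda(q_1)(f)q_2+f[q_1,q_2]$ for $f\in C^\infty(M,\mathbb C)$. *)

(* Defs.v *)
From HB Require Import structures.
From mathcomp Require Import all_boot all_order all_algebra.
From mathcomp Require Import all_classical all_reals all_analysis.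
From mathcomp Require Import complex ring.
Set Implicit Arguments.
Unset Strict Implicit.
Unset Printing Implicit Defensive.
Import Order.TTheory GRing.Theory Num.Theory.
Import numFieldNormedType.Exports.
Local Open Scope classical_set_scope.
Local Open Scope ring_scope.

Section SmoothCalculus.
Context {R : realType}.
Implicit Types V : normedModType R.

(* Meaningful for U open: f is C^(k+1) iff it is differentiable with C^k
   directional derivatives 'd f x v for every fixed direction v. *)
Fixpoint Ck_on V (k : nat) (U : set V) (f : V -> R) : Prop :=
  if k is k'.+1 then
    (forall x, U x -> differentiable f x) /\
    (forall v, Ck_on k' U (fun x => 'd f x v))
  else forall x, U x -> {for x, continuous f}.

Definition smooth_on V (U : set V) (f : V -> R) := forall k, Ck_on k U f.

Lemma near_differentiable V (f g : V -> R) (x : V) :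
  (\near x, f x = g x) -> differentiable f x ->
  differentiable g x /\ 'd g x = 'd f x :> (V -> R).
Proof.
move=> fg df.
have fgx : f x = g x by exact: nbhs_singleton fg.
have [cdf /eqaddoP fo] := (diff_locallyP x f).1 df.
have H : g \o shift x = cst (g x) + 'd f x +o_ 0 id.
  apply/eqaddoP => e e0; move: (fo e e0) => {}fo.
  have fg' : \forall y \near 0, f (y + x) = g (y + x).
    move: fg; rewrite (near_shift 0) /=.
    by apply: filterS => y /=; rewrite subr0.
  apply: filterS2 fg' fo => y; rewrite /= !fctE /= => -> /=.
  by rewrite fgx.
have E := diff_unique cdf H.
split; last exact: E.
apply/diff_locallyP; split; first by move=> y; rewrite E; exact: cdf.
by rewrite E; exact: H.
Qed.

Lemma Ck_on_sub V k (U U' : set V) (f : V -> R) :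
  U' `<=` U -> Ck_on k U f -> Ck_on k U' f.
Proof.
move=> sU; elim: k f => [|k IH] f /=; first by move=> h x /sU; apply: h.
by case=> h1 h2; split=> [x /sU|v]; [apply: h1|apply: IH].
Qed.

Lemma Ck_on_point V k (U : set V) (f : V -> R) :
  Ck_on k U f <-> forall x, U x -> Ck_on k [set x] f.
Proof.
elim: k f => [|k IH] f /=.
  by split=> h x Ux; [move=> _ ->; apply: h|apply: (h x)].
split=> [[h1 h2] x Ux|h].
  split=> [_ -> |v]; first exact: h1.
  by have /IH := h2 v; apply.
split=> [x Ux|v]; first by have [+ _] := h x Ux; apply.
by apply/IH => x Ux; have [_ ] := h x Ux.
Qed.

Lemma Ck_on_eq V k (U : set V) (f g : V -> R) :
  open U -> (forall x, U x -> f x = g x) -> Ck_on k U f -> Ck_on k U g.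
Proof.
move=> oU; elim: k f g => [|k IH] f g fg /=.
  move=> h x Ux; have fgx := fg x Ux.
  have nfg : \near x, f x = g x.
    by apply: filterS (open_nbhs_nbhs (conj oU Ux)) => y /fg.
  have := h x Ux; rewrite /prop_for /continuous_at fgx => hc.
  by apply: cvg_trans hc; apply: near_eq_cvg; apply: filterS nfg => y ->.
have nfg x : U x -> \near x, f x = g x.
  by move=> Ux; apply: filterS (open_nbhs_nbhs (conj oU Ux)) => y /fg.
case=> h1 h2; split=> [x Ux|v].
  by have [] := near_differentiable (nfg x Ux) (h1 x Ux).
apply: IH (h2 v) => x Ux.
by have [_ ->] := near_differentiable (nfg x Ux) (h1 x Ux).
Qed.

Lemma Ck_onS V k (U : set V) (f : V -> R) :
  Ck_on k.+1 U f -> Ck_on k U f.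
Proof.
elim: k f => [|k IH] f [h1 h2] /=.
  by move=> x /h1 /differentiable_continuous.
by split => // v; apply: IH.
Qed.

Lemma Ck_on_cst V k (U : set V) (a : R) : Ck_on k U (fun=> a).
Proof.
elim: k a => [|k IH] a /=; first by move=> x _; apply: cvg_cst.
split=> [x _|v]; first exact: differentiable_cst.
rewrite (_ : (fun x : V => _) = fun=> 0); first exact: IH.
by apply/funext => x; rewrite diff_cst.
Qed.

Lemma Ck_onD V k (U : set V) (f g : V -> R) : open U ->
  Ck_on k U f -> Ck_on k U g -> Ck_on k U (fun x => f x + g x).
Proof.
move=> oU; elim: k f g => [|k IH] f g /=.
  by move=> h h' x Ux; apply: continuousD; [apply: h|apply: h'].
case=> h1 h2 [h1' h2']; split=> [x Ux|v].
  by apply: differentiableD; [apply: h1|apply: h1'].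
apply: Ck_on_eq (IH _ _ (h2 v) (h2' v)) => // x Ux.
by rewrite diffD //; [apply: h1|apply: h1'].
Qed.

Lemma Ck_on_sum V k (U : set V) n (f : 'I_n -> V -> R) : open U ->
  (forall i, Ck_on k U (f i)) -> Ck_on k U (fun x => \sum_i f i x).
Proof.
move=> oU; elim: n f => [|n IH] f h.
  rewrite (_ : (fun _ => _) = fun=> 0); first exact: Ck_on_cst.
  by apply/funext => x; rewrite big_ord0.
rewrite (_ : (fun _ => _) = fun x => f ord0 x + \sum_i f (lift ord0 i) x).
  by apply: Ck_onD => //; apply: IH.
by apply/funext => x; rewrite big_ord_recl.
Qed.


Lemma Ck_onM V k (U : set V) (f g : V -> R) : open U ->
  Ck_on k U f -> Ck_on k U g -> Ck_on k U (fun x => f x * g x).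
Proof.
move=> oU; elim: k f g => [|k IH] f g.
  by move=> h h' x Ux; apply: continuousM; [apply: h|apply: h'].
move=> Hf Hg; have Hf' := Ck_onS Hf; have Hg' := Ck_onS Hg.
case: Hf Hg => h1 h2 [h1' h2'].
split=> [x Ux|v]; first by apply: differentiableM; [apply: h1|apply: h1'].
apply: (@Ck_on_eq _ _ _ (fun x => f x * 'd g x v + g x * 'd f x v)) => //.
  by move=> x Ux; rewrite -[RHS]/('d (f * g) x v) diffM; [|exact: h1|exact: h1'].
exact: Ck_onD oU (IH _ _ Hf' (h2' v)) (IH _ _ Hg' (h2 v)).
Qed.

Lemma row_differentiable V m (G : V -> 'rV[R]_m) (x : V) :
  (forall i, differentiable (fun y => G y 0 i) x) ->
  differentiable G x /\
  forall v, 'd G x v = \row_i 'd (fun y => G y 0 i) x v.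
Proof.
move=> dG.
have E : G = \sum_(i < m) (fun y => G y 0 i *: delta_mx 0 i).
  by apply/funext => y; rewrite fct_sumE [LHS]row_sum_delta.
have d : differentiable G x.
  by rewrite E; apply: differentiable_sum => i; apply: differentiableZl.
split=> // v; apply/rowP => i; rewrite mxE.
pose p (w : 'rV[R]_m) : R := w 0 i.
have pl : linear p by move=> a u w; rewrite /p !mxE.
pose pM := GRing.isLinear.Build _ _ _ _ _ pl.
pose pL : {linear _ -> _} := HB.pack p pM.
have pc : continuous pL by apply: coord_continuous.
rewrite (_ : (fun y => G y 0 i) = pL \o G) //.
rewrite (@diff_comp _ _ _ _ G pL) //; last exact: linear_differentiable.
by rewrite /= (diff_lin _ pc).
Qed.


Lemma smooth_on_comp n m (U : set 'rV[R]_n) (B : set 'rV[R]_m)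
    (G : 'rV[R]_n -> 'rV[R]_m) (F : 'rV[R]_m -> R) : open U ->
  (forall x, U x -> B (G x)) ->
  (forall i, smooth_on U (fun x => G x 0 i)) -> smooth_on B F ->
  smooth_on U (F \o G).
Proof.
move=> oU GB hG hF k.
have dG x : U x -> differentiable G x /\
    forall v, 'd G x v = \row_i 'd (fun y => G y 0 i) x v.
  by move=> Ux; apply: row_differentiable => i; have [+ _] := hG i 1%N; apply.
elim: k F {hF}(hF k) => [|k IH] F.
  move=> hF x Ux; apply: continuous_comp; last exact/hF/GB.
  by apply: differentiable_continuous; have [] := dG x Ux.
case=> h1 h2; split=> [x Ux|v].
  by apply: differentiable_comp; [have [] := dG x Ux|apply/h1/GB].
apply: (@Ck_on_eq _ _ _ (fun x => \sum_(i < m)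
    'd (fun y => G y 0 i) x v * 'd F (G x) (delta_mx 0 i))) => //.
  move=> x Ux; have [d E] := dG x Ux.
  have -> : 'd (F \o G) x v = 'd F (G x) ('d G x v).
    by rewrite diff_comp //; apply/h1/GB.
  rewrite E [X in 'd F _ X]row_sum_delta linear_sum.
  by apply: eq_bigr => i _; rewrite linearZ /= mxE.
apply: Ck_on_sum => // i; apply: Ck_onM => //.
  by have [_ ] := hG i k.+1; apply.
exact: IH (fun y => 'd F y (delta_mx 0 i)) (h2 _).
Qed.

Lemma smooth_on_coord n (U : set 'rV[R]_n) i :
  smooth_on U (fun x : 'rV[R]_n => x 0 i).
Proof.
pose p (w : 'rV[R]_n) : R := w 0 i.
have pl : linear p by move=> a u w; rewrite /p !mxE.
pose pM := GRing.isLinear.Build _ _ _ _ _ pl.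
pose pL : {linear _ -> _} := HB.pack p pM.
have pc : continuous pL by apply: coord_continuous.
rewrite (_ : (fun x => _) = pL) //.
move=> [|k]; first by move=> x _; apply: pc.
split=> [x _|v]; first exact: linear_differentiable.
have -> : (fun x => 'd pL x v) = fun=> p v.
  by apply/funext => x; rewrite diff_lin.
exact: Ck_on_cst.
Qed.

Lemma smooth_on_point V (U : set V) (f : V -> R) :
  smooth_on U f <-> forall x, U x -> smooth_on [set x] f.
Proof.
split=> [h x Ux k|h k]; last by apply/Ck_on_point => x Ux; apply: h.
by have /Ck_on_point := h k; apply.
Qed.

Lemma smooth_on_sub V (U U' : set V) (f : V -> R) :
  U' `<=` U -> smooth_on U f -> smooth_on U' f.
Proof. by move=> s h k; apply: Ck_on_sub (h k). Qed.

Lemma smooth_on_eq V (U : set V) (f g : V -> R) :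
  open U -> (forall x, U x -> f x = g x) -> smooth_on U f -> smooth_on U g.
Proof. by move=> o e h k; apply: Ck_on_eq (h k). Qed.

End SmoothCalculus.

Section Manifolds.
Context {R : realType}.

Record chart (n : nat) (T : Type) := Chart {
  chart_dom : set T;
  chart_map :> T -> 'rV[R]_n;
  chart_inv : 'rV[R]_n -> T;
  chartK : forall x, chart_dom x -> chart_inv (chart_map x) = x;
  chart_open : open (chart_map @` chart_dom) }.

Definition compatible n T (c d : chart n T) :=
  let U := c @` (chart_dom c `&` chart_dom d) in
  open U /\ forall i, smooth_on U (fun y => d (chart_inv c y) 0 i).

(* The topology induced by an atlas; points carry no topology of their own. *)
Definition atlas_open n T (A : set (chart n T)) (B : set T) :=
  forall c, A c -> open (c @` (B `&` chart_dom c)).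

(* A smooth structure is a maximal atlas whose topology is Hausdorff and
   second countable. Values of chart_map outside chart_dom are irrelevant. *)
Record smooth_structure (n : nat) (T : Type) := SmoothStructure {
  atlas : set (chart n T);
  atlas_cover : forall x, exists2 c, atlas c & chart_dom c x;
  atlas_compatible : forall c d, atlas c -> atlas d -> compatible c d;
  atlas_maximal : forall c,
    (forall d, atlas d -> compatible c d /\ compatible d c) -> atlas c;
  atlas_hausdorff : forall x y, x <> y -> exists A B : set T,
    [/\ atlas_open atlas A, atlas_open atlas B, A x, B y & A `&` B = set0];
  atlas_second_countable : exists2 B : nat -> set T,
    (forall i, atlas_open atlas (B i)) &
    (forall A x, atlas_open atlas A -> A x ->
       exists2 i, B i x & B i `<=` A) }.

Record manifold (n : nat) := Manifold {
  points :> Type;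
  msmooth : smooth_structure n points }.

End Manifolds.
Arguments chart R n T : clear implicits.
Arguments smooth_structure R n T : clear implicits.
Arguments manifold R n : clear implicits.

Section SmoothFunctions.
Context {R : realType} {n : nat} {M : manifold R n}.
Local Notation charts := (atlas (msmooth M)).

Definition smooth_fun (f : M -> R) := forall c, charts c ->
  smooth_on (c @` chart_dom c) (f \o chart_inv c).

Lemma smooth_fun_local (f : M -> R) :
  (forall x, exists2 c, charts c & chart_dom c x /\
     smooth_on (c @` chart_dom c) (f \o chart_inv c)) -> smooth_fun f.
Proof.
move=> h d Ad; apply/smooth_on_point => _ [x dx <-].
have [c Ac [cx sf]] := h x.
have [oU sU] := atlas_compatible Ad Ac.
set U := d @` _ in oU sU.
apply: (@smooth_on_sub _ _ U); first by move=> _ ->; exists x.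
apply: (@smooth_on_eq _ _ _ ((f \o chart_inv c) \o (c \o chart_inv d))) => //.
  by move=> _ [y [dy cy] <-]; rewrite /= (chartK dy) (chartK cy).
apply: smooth_on_comp sf => // _ [y [dy cy] <-].
by exists y => //=; rewrite (chartK dy).
Qed.

Lemma smooth_funD f g : smooth_fun f -> smooth_fun g ->
  smooth_fun (fun x => f x + g x).
Proof.
by move=> hf hg c Ac k; apply: Ck_onD; [exact: chart_open|exact: hf|exact: hg].
Qed.

Lemma smooth_funM f g : smooth_fun f -> smooth_fun g ->
  smooth_fun (fun x => f x * g x).
Proof.
by move=> hf hg c Ac k; apply: Ck_onM; [exact: chart_open|exact: hf|exact: hg].
Qed.

Lemma smooth_fun_cst (a : R) : smooth_fun (fun=> a).
Proof. by move=> c Ac k; apply: Ck_on_cst. Qed.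

Lemma smooth_funN f : smooth_fun f -> smooth_fun (fun x => - f x).
Proof.
move=> hf; rewrite (_ : (fun x => _) = fun x => (-1) * f x).
  by apply: smooth_funM => //; apply: smooth_fun_cst.
by apply/funext => x; rewrite mulN1r.
Qed.

Record Cinf := MkCinf { Cfun :> M -> R; CinfP : smooth_fun Cfun }.

Lemma Cinf_ext (f g : Cinf) : (forall x, f x = g x) -> f = g.
Proof.
case: f g => [f hf] [g hg] /= /funext e; subst g.
by congr MkCinf; apply: Prop_irrelevance.
Qed.

HB.instance Definition _ := gen_eqMixin Cinf.
HB.instance Definition _ := gen_choiceMixin Cinf.

Definition Ccst a : Cinf := MkCinf (smooth_fun_cst a).
Definition Cadd (f g : Cinf) := MkCinf (smooth_funD (CinfP f) (CinfP g)).
Definition Copp (f : Cinf) := MkCinf (smooth_funN (CinfP f)).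
Definition Cmul (f g : Cinf) := MkCinf (smooth_funM (CinfP f) (CinfP g)).

Fact CaddA : associative Cadd.
Proof. by move=> f g h; apply: Cinf_ext => x /=; rewrite addrA. Qed.
Fact CaddC : commutative Cadd.
Proof. by move=> f g; apply: Cinf_ext => x /=; rewrite addrC. Qed.
Fact Cadd0 : left_id (Ccst 0) Cadd.
Proof. by move=> f; apply: Cinf_ext => x /=; rewrite add0r. Qed.
Fact CaddN : left_inverse (Ccst 0) Copp Cadd.
Proof. by move=> f; apply: Cinf_ext => x /=; rewrite addNr. Qed.
HB.instance Definition _ :=
  GRing.isZmodule.Build Cinf CaddA CaddC Cadd0 CaddN.
Fact CmulA : associative Cmul.
Proof. by move=> f g h; apply: Cinf_ext => x /=; rewrite mulrA. Qed.
Fact CmulC : commutative Cmul.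
Proof. by move=> f g; apply: Cinf_ext => x /=; rewrite mulrC. Qed.
Fact Cmul1 : left_id (Ccst 1) Cmul.
Proof. by move=> f; apply: Cinf_ext => x /=; rewrite mul1r. Qed.
Fact CmulD : left_distributive Cmul Cadd.
Proof. by move=> f g h; apply: Cinf_ext => x /=; rewrite mulrDl. Qed.
HB.instance Definition _ :=
  GRing.Zmodule_isComPzRing.Build Cinf CmulA CmulC Cmul1 CmulD.

(* Tangent vectors are derivations of C^oo(M) at p. *)
Record tangent (p : M) := Tangent {
  tfun :> Cinf -> R;
  tangent_linear : forall a (f g : Cinf), tfun (Ccst a * f + g) = a * tfun f + tfun g;
  tangent_leibniz : forall f g : Cinf, tfun (f * g) = f p * tfun g + tfun f * g p }.

End SmoothFunctions.
Arguments Cinf {R n} M.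

Section TangentSpace.
Context {R : realType} {n : nat} {M : manifold R n} {p : M}.
Local Notation T := (tangent p).

Lemma tangent_ext (v w : T) : (forall f, v f = w f) -> v = w.
Proof.
case: v w => [v v1 v2] [w w1 w2] /= /funext e; subst w.
by congr Tangent; apply: Prop_irrelevance.
Qed.

HB.instance Definition _ := gen_eqMixin T.
HB.instance Definition _ := gen_choiceMixin T.

Program Definition tan0 : T := @Tangent _ _ _ _ (fun=> 0) _ _.
Next Obligation. by move=> a f g /=; rewrite mulr0 addr0. Qed.
Next Obligation. by move=> f g /=; rewrite mulr0 mul0r addr0. Qed.
Program Definition tan_add (v w : T) : T :=
  @Tangent _ _ _ _ (fun f => v f + w f) _ _.
Next Obligation. by move=> v w a f g /=; rewrite !tangent_linear; ring. Qed.
Next Obligation. by move=> v w f g /=; rewrite !tangent_leibniz; ring. Qed.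
Program Definition tan_scale (a : R) (v : T) : T :=
  @Tangent _ _ _ _ (fun f => a * v f) _ _.
Next Obligation. by move=> a v b f g /=; rewrite !tangent_linear; ring. Qed.
Next Obligation. by move=> a v f g /=; rewrite !tangent_leibniz; ring. Qed.

Fact tan_addA : associative tan_add.
Proof. by move=> u v w; apply: tangent_ext => f /=; rewrite addrA. Qed.
Fact tan_addC : commutative tan_add.
Proof. by move=> u v; apply: tangent_ext => f /=; rewrite addrC. Qed.
Fact tan_add0 : left_id tan0 tan_add.
Proof. by move=> u; apply: tangent_ext => f /=; rewrite add0r. Qed.
Fact tan_addN : left_inverse tan0 (tan_scale (-1)) tan_add.
Proof. by move=> u; apply: tangent_ext => f /=; rewrite mulN1r addNr. Qed.
HB.instance Definition _ :=
  GRing.isZmodule.Build T tan_addA tan_addC tan_add0 tan_addN.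
Fact tan_scaleA a b v : tan_scale a (tan_scale b v) = tan_scale (a * b) v.
Proof. by apply: tangent_ext => f /=; rewrite mulrA. Qed.
Fact tan_scale1 : left_id 1 tan_scale.
Proof. by move=> v; apply: tangent_ext => f /=; rewrite mul1r. Qed.
Fact tan_scaleDr : right_distributive tan_scale tan_add.
Proof. by move=> a v w; apply: tangent_ext => f /=; rewrite mulrDr. Qed.
Fact tan_scaleDl v a b :
  tan_scale (a + b) v = tan_add (tan_scale a v) (tan_scale b v).
Proof. by apply: tangent_ext => f /=; rewrite mulrDl. Qed.
HB.instance Definition _ := GRing.Zmodule_isLmodule.Build R T
  tan_scaleA tan_scale1 tan_scaleDr tan_scaleDl.

End TangentSpace.

Section DualSpace.
Context {R : realType} {V : lmodType R}.

Record dual := Dual {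
  dfun :> V -> R;
  dual_linear : forall a x y, dfun (a *: x + y) = a * dfun x + dfun y }.

Lemma dual_ext (f g : dual) : (forall x, f x = g x) -> f = g.
Proof.
case: f g => [f hf] [g hg] /= /funext e; subst g.
by congr Dual; apply: Prop_irrelevance.
Qed.

HB.instance Definition _ := gen_eqMixin dual.
HB.instance Definition _ := gen_choiceMixin dual.

Program Definition dual0 : dual := @Dual (fun=> 0) _.
Next Obligation. by move=> a x y /=; rewrite mulr0 addr0. Qed.
Program Definition dual_add (f g : dual) : dual := @Dual (fun x => f x + g x) _.
Next Obligation. by move=> f g a x y /=; rewrite !dual_linear; ring. Qed.
Program Definition dual_scale (a : R) (f : dual) : dual :=
  @Dual (fun x => a * f x) _.
Next Obligation. by move=> a f b x y /=; rewrite !dual_linear; ring. Qed.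

Fact dual_addA : associative dual_add.
Proof. by move=> u v w; apply: dual_ext => f /=; rewrite addrA. Qed.
Fact dual_addC : commutative dual_add.
Proof. by move=> u v; apply: dual_ext => f /=; rewrite addrC. Qed.
Fact dual_add0 : left_id dual0 dual_add.
Proof. by move=> u; apply: dual_ext => f /=; rewrite add0r. Qed.
Fact dual_addN : left_inverse dual0 (dual_scale (-1)) dual_add.
Proof. by move=> u; apply: dual_ext => f /=; rewrite mulN1r addNr. Qed.
HB.instance Definition _ :=
  GRing.isZmodule.Build dual dual_addA dual_addC dual_add0 dual_addN.
Fact dual_scaleA a b v : dual_scale a (dual_scale b v) = dual_scale (a * b) v.
Proof. by apply: dual_ext => f /=; rewrite mulrA. Qed.
Fact dual_scale1 : left_id 1 dual_scale.
Proof. by move=> v; apply: dual_ext => f /=; rewrite mul1r. Qed.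
Fact dual_scaleDr : right_distributive dual_scale dual_add.
Proof. by move=> a v w; apply: dual_ext => f /=; rewrite mulrDr. Qed.
Fact dual_scaleDl v a b :
  dual_scale (a + b) v = dual_add (dual_scale a v) (dual_scale b v).
Proof. by apply: dual_ext => f /=; rewrite mulrDl. Qed.
HB.instance Definition _ := GRing.Zmodule_isLmodule.Build R dual
  dual_scaleA dual_scale1 dual_scaleDr dual_scaleDl.

End DualSpace.
Arguments dual {R} V.

Section Bundles.
Context {R : realType} {n : nat}.

(* A vector bundle presented by its fibres and its module of smooth sections.
   Genuine (locally trivial) vector bundles are the vbundle below; this
   presentation is used to treat E, E^*, TM, T^*M and their direct sums, as
   well as TE and T^*E over the manifold E, uniformly. *)
Record bundle (M : manifold R n) := Bundle {
  fibre :> M -> lmodType R;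
  smooth_sec : (forall m, fibre m) -> Prop;
  smooth_sec0 : smooth_sec (fun=> 0);
  smooth_sec_comb : forall (f : Cinf M) s t, smooth_sec s -> smooth_sec t ->
    smooth_sec (fun m => f m *: s m + t m) }.

Context {M : manifold R n}.
Implicit Types V W : bundle M.

Record section V := MkSection {
  secf :> forall m, V m;
  secP : smooth_sec secf }.

Section SectionModule.
Context {V : bundle M}.
Local Notation S := (section V).

Lemma section_ext (s t : S) : (forall m, s m = t m) -> s = t.
Proof.
case: s t => [s hs] [t ht] /= e.
have {}e : s = t by apply: functional_extensionality_dep.
subst t.
by congr MkSection; apply: Prop_irrelevance.
Qed.

HB.instance Definition _ := gen_eqMixin S.
HB.instance Definition _ := gen_choiceMixin S.

Definition sec0 : S := MkSection (smooth_sec0 V).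
Program Definition sec_add (s t : S) : S := @MkSection V (fun m => s m + t m) _.
Next Obligation.
move=> s t; have := smooth_sec_comb 1 (secP s) (secP t).
by congr smooth_sec; apply: functional_extensionality_dep => m; rewrite scale1r.
Qed.
Program Definition sec_scale (f : Cinf M) (s : S) : S :=
  @MkSection V (fun m => f m *: s m) _.
Next Obligation.
move=> f s; have := smooth_sec_comb f (secP s) (smooth_sec0 V).
by congr smooth_sec; apply: functional_extensionality_dep => m; rewrite addr0.
Qed.

Fact sec_addA : associative sec_add.
Proof. by move=> u v w; apply: section_ext => f /=; rewrite addrA. Qed.
Fact sec_addC : commutative sec_add.
Proof. by move=> u v; apply: section_ext => f /=; rewrite addrC. Qed.
Fact sec_add0 : left_id sec0 sec_add.
Proof. by move=> u; apply: section_ext => f /=; rewrite add0r. Qed.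
Fact sec_addN : left_inverse sec0 (sec_scale (-1)) sec_add.
Proof. by move=> u; apply: section_ext => f /=; rewrite scaleN1r addNr. Qed.
HB.instance Definition _ :=
  GRing.isZmodule.Build S sec_addA sec_addC sec_add0 sec_addN.
Fact sec_scaleA a b v : sec_scale a (sec_scale b v) = sec_scale (a * b) v.
Proof. by apply: section_ext => f /=; rewrite scalerA. Qed.
Fact sec_scale1 : left_id 1 sec_scale.
Proof. by move=> v; apply: section_ext => f /=; rewrite scale1r. Qed.
Fact sec_scaleDr : right_distributive sec_scale sec_add.
Proof. by move=> a v w; apply: section_ext => f /=; rewrite scalerDr. Qed.
Fact sec_scaleDl v a b :
  sec_scale (a + b) v = sec_add (sec_scale a v) (sec_scale b v).
Proof. by apply: section_ext => f /=; rewrite scalerDl. Qed.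
HB.instance Definition _ := GRing.Zmodule_isLmodule.Build (Cinf M) S
  sec_scaleA sec_scale1 sec_scaleDr sec_scaleDl.

End SectionModule.

Program Definition bsum V W : bundle M := {|
  fibre := fun m => (V m * W m)%type : lmodType R;
  smooth_sec := fun s => smooth_sec (fun m => (s m).1) /\
                         smooth_sec (fun m => (s m).2) |}.
Next Obligation. by move=> V W; split; apply: smooth_sec0. Qed.
Next Obligation.
by move=> V W f s t [s1 s2] [t1 t2]; split; apply: smooth_sec_comb.
Qed.

Definition spair V W (s : section V) (t : section W) : section (bsum V W) :=
  @MkSection (bsum V W) (fun m => (s m, t m)) (conj (secP s) (secP t)).
Definition sfst V W (s : section (bsum V W)) : section V :=
  MkSection (proj1 (secP s)).
Definition ssnd V W (s : section (bsum V W)) : section W :=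
  MkSection (proj2 (secP s)).

(* Vector bundle morphisms over the identity; a fibrewise linear map is smooth
   iff it maps smooth sections to smooth sections. *)
Record vbmor V W := VBMor {
  vbfun :> forall m, V m -> W m;
  vb_linear : forall m (a : R) x y,
    vbfun (a *: x + y : V m) = a *: vbfun x + vbfun y;
  vb_smooth : forall s : section V, smooth_sec (fun m => vbfun (s m)) }.

Definition vbsec V W (phi : vbmor V W) (s : section V) : section W :=
  MkSection (vb_smooth phi s).

HB.instance Definition _ V W := gen_eqMixin (vbmor V W).
HB.instance Definition _ V W := gen_choiceMixin (vbmor V W).

Program Definition vbid V : vbmor V V := @VBMor V V (fun m x => x) _ _.
Next Obligation. by []. Qed.
Next Obligation. by move=> V s; apply: secP. Qed.

End Bundles.

Section CotangentBundle.
Context {R : realType} {n : nat} (M : manifold R n).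

Program Definition tangent_bundle : bundle M := {|
  fibre := fun m => tangent m : lmodType R;
  smooth_sec := fun X => forall f : Cinf M, smooth_fun (fun m => X m f) |}.
Next Obligation. by move=> f; apply: smooth_fun_cst. Qed.
Next Obligation.
move=> f s t hs ht g; apply: smooth_funD => //.
by apply: smooth_funM => //; apply: CinfP.
Qed.

Definition vact (X : section tangent_bundle) (f : Cinf M) : Cinf M :=
  MkCinf (secP X f).

Program Definition cotangent_bundle : bundle M := {|
  fibre := fun m => dual (tangent m) : lmodType R;
  smooth_sec := fun w => forall X : section tangent_bundle,
    smooth_fun (fun m => w m (X m)) |}.
Next Obligation. by move=> X; apply: smooth_fun_cst. Qed.
Next Obligation.
move=> f s t hs ht X; apply: smooth_funD => //.
by apply: smooth_funM => //; apply: CinfP.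
Qed.

Definition feval (w : section cotangent_bundle) (X : section tangent_bundle) :
  Cinf M := MkCinf (secP w X).

Program Definition covec (f : Cinf M) (m : M) : dual (tangent m) :=
  @Dual _ _ (fun v => v f) _.
Next Obligation. by []. Qed.

Program Definition dform (f : Cinf M) : section cotangent_bundle :=
  @MkSection _ _ _ cotangent_bundle (covec f) _.
Next Obligation. by move=> f X; exact: (secP X f). Qed.

Program Definition lie_vect (X Y : section tangent_bundle) (m : M) :
    tangent m :=
  @Tangent _ _ _ _ (fun f => X m (vact Y f) - Y m (vact X f)) _ _.
Next Obligation.
move=> X Y m a f g.
have E (Z : section tangent_bundle) :
    vact Z (Ccst a * f + g) = Ccst a * vact Z f + vact Z g.
  by apply: Cinf_ext => x; rewrite /= tangent_linear.
by rewrite !E !tangent_linear; ring.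
Qed.
Next Obligation.
move=> X Y m f g.
have E (Z : section tangent_bundle) :
    vact Z (f * g) = Ccst 1 * (f * vact Z g) + vact Z f * g.
  by apply: Cinf_ext => x; rewrite /= tangent_leibniz mul1r.
by rewrite !E !tangent_linear !tangent_leibniz /=; ring.
Qed.

Program Definition lie (X Y : section tangent_bundle) :
    section tangent_bundle :=
  @MkSection _ _ _ tangent_bundle (lie_vect X Y) _.
Next Obligation.
move=> X Y f; apply: smooth_funD; first exact: CinfP (vact X (vact Y f)).
by apply: smooth_funN; exact: CinfP (vact Y (vact X f)).
Qed.

End CotangentBundle.

Section CourantAlgebroid.
Context {R : realType} {n : nat} {M : manifold R n}.
Local Notation TM := (tangent_bundle M).
Local Notation TsM := (cotangent_bundle M).

(* L_X w and iota_Y dth are the one-forms characterised by their values on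
   vector fields; xget only picks that unique form (default 0). *)
Definition lie_derivative (X : section TM) (w : section TsM) : section TsM :=
  xget 0 [set eta | forall Z : section TM,
    feval eta Z = vact X (feval w Z) - feval w (lie X Z)].

Definition contract_d (Y : section TM) (th : section TsM) : section TsM :=
  xget 0 [set eta | forall Z : section TM,
    feval eta Z =
      vact Y (feval th Z) - vact Z (feval th Y) - feval th (lie Y Z)].

Definition courant (s t : section (bsum TM TsM)) : section (bsum TM TsM) :=
  spair (lie (sfst s) (sfst t))
        (lie_derivative (sfst s) (ssnd t) - contract_d (sfst t) (ssnd s)).

Definition std_pairing (m : M) (x y : bsum TM TsM m) : R := x.2 y.1 + y.2 x.1.

Record gcs (J : vbmor (bsum TM TsM) (bsum TM TsM)) : Prop := {
  gcs_square : forall m x, J m (J m x) = - x;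
  gcs_orthogonal : forall m x y,
    std_pairing (J m x) (J m y) = std_pairing x y;
  gcs_integrable : forall s t,
    courant s t - courant (vbsec J s) (vbsec J t)
    + vbsec J (courant (vbsec J s) t + courant s (vbsec J t)) = 0 }.

End CourantAlgebroid.

Section VectorBundles.
Context {R : realType} {n : nat} {M : manifold R n}.

(* The fibrewise linear isomorphisms t trivialise F over the domain of the
   chart c of M: (c, t) is a chart of the total space. *)
Definition trivialization (k : nat) (F : M -> lmodType R)
    (A : smooth_structure R (n + k) {m : M & F m})
    (c : chart R n M) (t : forall m, F m -> 'rV[R]_k) : Prop :=
  (forall m, chart_dom c m -> linear (t m) /\ bijective (t m)) /\
  (exists d : chart R (n + k) {m : M & F m},
     [/\ atlas A d, chart_dom d = [set e | chart_dom c (projT1 e)] &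
         forall e, chart_dom d e ->
           d e = row_mx (c (projT1 e)) (t (projT1 e) (projT2 e))]).

Record vbundle (k : nat) := VBundle {
  vfib :> M -> lmodType R;
  vstruct : smooth_structure R (n + k) {m : M & vfib m};
  vlocal_triv : forall m, exists c t,
    [/\ atlas (msmooth M) c, chart_dom c m & trivialization vstruct c t] }.

Context {k : nat} (E : vbundle k).

Definition total : manifold R (n + k) := Manifold (vstruct E).

Definition pt (m : M) (x : E m) : total := existT (fun m => vfib E m) m x.

Fact smooth_proj (f : Cinf M) :
  smooth_fun (fun e : total => f (projT1 e)).
Proof.
apply: smooth_fun_local => -[m x].
have [c [t [Ac cm [tl [d [Ad dd dE]]]]]] := vlocal_triv E m.
exists d => //; split; first by rewrite dd.
apply: (@smooth_on_eq _ _ _ ((f \o chart_inv c) \o lsubmx)) => //.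
- exact: chart_open.
- move=> _ [e de <-]; rewrite /= (chartK de) dE // row_mxKl chartK //.
  by move: de; rewrite dd.
apply: smooth_on_comp (CinfP f Ac) => //.
- exact: chart_open.
- move=> _ [e de <-]; rewrite dE // row_mxKl; exists (projT1 e) => //.
  by move: de; rewrite dd.
move=> i; apply: (@smooth_on_eq _ _ _ (fun y : 'rV[R]_(n + k) =>
  y 0 (lshift k i))); first exact: chart_open.
  by move=> y _; rewrite mxE.
exact: smooth_on_coord.
Qed.

Definition pull_proj (f : Cinf M) : Cinf total := MkCinf (smooth_proj f).

Program Definition vec_bundle : bundle M := {|
  fibre := vfib E;
  smooth_sec := fun s => forall c t,
    atlas (msmooth M) c -> trivialization (vstruct E) c t -> forall i,
    smooth_on (c @` chart_dom c)
      (fun y => t (chart_inv c y) (s (chart_inv c y)) 0 i) |}.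
Next Obligation.
move=> c t Ac [tl _] i.
apply: (@smooth_on_eq _ _ _ (fun=> 0)); first exact: chart_open.
  move=> _ [m cm <-]; rewrite chartK //.
  have [l _] := tl m cm.
  have := l (-1) 0 0; rewrite scaleN1r addNr => ->.
  by rewrite scaleN1r addNr mxE.
by move=> j; apply: Ck_on_cst.
Qed.
Next Obligation.
move=> f s u hs hu c t Ac ht i; have [tl _] := ht.
apply: (@smooth_on_eq _ _ _ (fun y => f (chart_inv c y) *
  t (chart_inv c y) (s (chart_inv c y)) 0 i +
  t (chart_inv c y) (u (chart_inv c y)) 0 i)); first exact: chart_open.
  move=> _ [m cm <-]; rewrite chartK //.
  by have [l _] := tl m cm; rewrite l !mxE.
move=> j; apply: Ck_onD; first exact: chart_open.
  apply: Ck_onM; first exact: chart_open.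
    exact: (CinfP f Ac).
  exact: hs.
exact: hu.
Qed.

Definition lin_fun (eps : forall m, dual (E m)) (e : total) : R :=
  eps (projT1 e) (projT2 e).

(* eps is smooth iff the fibrewise linear function l_eps it defines on the total
   space of E is smooth. *)
Program Definition dual_bundle : bundle M := {|
  fibre := fun m => dual (E m) : lmodType R;
  smooth_sec := fun eps => smooth_fun (lin_fun eps) |}.
Next Obligation. exact: smooth_fun_cst. Qed.
Next Obligation.
move=> f s t hs ht; apply: smooth_funD => //; apply: smooth_funM => //.
exact: smooth_proj.
Qed.

Fact smooth_along (s : section vec_bundle) (f : Cinf total) :
  smooth_fun (fun m => f (pt (s m))).
Proof.
apply: smooth_fun_local => m.
have [c [t [Ac cm ht]]] := vlocal_triv E m.
have [tl [d [Ad dd dE]]] := ht.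
exists c => //; split => //.
pose G (y : 'rV[R]_n) : 'rV[R]_(n + k) :=
  row_mx y (t (chart_inv c y) (s (chart_inv c y))).
have dG y : (c @` chart_dom c) y ->
    chart_dom d (pt (s (chart_inv c y))) /\ d (pt (s (chart_inv c y))) = G y.
  move=> [p cp <-]; rewrite chartK //.
  have dp : chart_dom d (pt (s p)) by rewrite dd.
  by split => //; rewrite dE //= /G chartK.
apply: (@smooth_on_eq _ _ _ ((f \o chart_inv d) \o G)).
- exact: chart_open.
- by move=> y /dG [dy E']; rewrite /= -E' chartK.
apply: smooth_on_comp (CinfP f Ad).
- exact: chart_open.
- by move=> y /dG [dy <-]; exists (pt (s (chart_inv c y))).
move=> i; case: (split_ordP i) => j ->.
  apply: (@smooth_on_eq _ _ _ (fun y : 'rV[R]_n => y 0 j)).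
  - exact: chart_open.
  - by move=> y _; rewrite row_mxEl.
  - exact: smooth_on_coord.
apply: (@smooth_on_eq _ _ _ (fun y =>
  t (chart_inv c y) (s (chart_inv c y)) 0 j)).
- exact: chart_open.
- by move=> y _; rewrite row_mxEr.
- exact: (secP s c t Ac ht j).
Qed.

Definition pull_sec (s : section vec_bundle) (f : Cinf total) : Cinf M :=
  MkCinf (smooth_along s f).

(* T_m s *)
Program Definition dsec (s : section vec_bundle) (m : M) (v : tangent m) :
    tangent (pt (s m)) :=
  @Tangent _ _ _ _ (fun f => v (pull_sec s f)) _ _.
Next Obligation.
move=> s m v a f g; rewrite -tangent_linear; congr (v _).
by apply: Cinf_ext.
Qed.
Next Obligation.
move=> s m v f g.
rewrite -[f _]/(pull_sec s f m) -[g (pt _)]/(pull_sec s g m) -tangent_leibniz.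
by congr (v _); apply: Cinf_ext.
Qed.

(* T_e q_E *)
Program Definition dproj (e : total) (v : tangent e) : tangent (projT1 e) :=
  @Tangent _ _ _ _ (fun f => v (pull_proj f)) _ _.
Next Obligation.
move=> e v a f g; rewrite -tangent_linear; congr (v _).
by apply: Cinf_ext.
Qed.
Next Obligation.
move=> e v f g.
rewrite -[f _]/(pull_proj f e) -[g (projT1 _)]/(pull_proj g e).
rewrite -tangent_leibniz.
by congr (v _); apply: Cinf_ext.
Qed.

Fact line_derivative (m : M) (x : E m) :
  exists (N : nat) (F : Cinf total -> 'rV[R]_N -> R) (p : 'rV[R]_N)
    (L : {linear E m -> 'rV[R]_N}),
  forall f, differentiable (F f) p /\
    forall y s, f (pt (x + s *: y)) = F f (p + s *: L y).
Proof.
have [c [t [Ac cm [tl [d [Ad dd dE]]]]]] := vlocal_triv E m.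
have [lt _] := tl m cm.
pose L (y : E m) : 'rV[R]_(n + k) := row_mx 0 (t m y).
have lL : linear L.
  by move=> a y z; rewrite /L lt scale_row_mx scaler0 add_row_mx addr0.
pose LM := GRing.isLinear.Build _ _ _ _ _ lL.
pose LL : {linear _ -> _} := HB.pack L LM.
exists (n + k)%N, (fun f => f \o chart_inv d), (row_mx (c m) (t m x)), LL => f.
have dx y : chart_dom d (pt (y : E m)) by rewrite dd.
split; first by have [+ _] := CinfP f Ad 1%N; apply; exists (pt x) => //; rewrite dE.
move=> y s; rewrite /= /L scale_row_mx scaler0 add_row_mx addr0.
have -> : t m x + s *: t m y = t m (x + s *: y) by rewrite addrC -lt addrC.
rewrite -[row_mx _ _]/(row_mx (c (projT1 (pt (x + s *: y))))
  (t (projT1 (pt (x + s *: y))) (projT2 (pt (x + s *: y))))).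
by rewrite -dE // chartK.
Qed.

End VectorBundles.
Arguments vbundle {R n} M k.

Section DoubleVectorBundle.
Context {R : realType} {n k : nat} {M : manifold R n} (E : vbundle M k).
Local Notation TM := (tangent_bundle M).
Local Notation TsM := (cotangent_bundle M).
Local Notation "'TE'" := (tangent_bundle (total E)).
Local Notation "'TsE'" := (cotangent_bundle (total E)).

Definition side : bundle M := bsum TM (dual_bundle E).
Definition core : bundle M := bsum (vec_bundle E) TsM.
Definition TTs : bundle (total E) := bsum TE TsE.

Fact line_is_derive (m : M) (x : E m) :
  exists (N : nat) (F : Cinf (total E) -> 'rV[R]_N -> R) (p : 'rV[R]_N)
    (L : {linear E m -> 'rV[R]_N}),
  forall (f : Cinf (total E)) y, is_derive (0 : R) 1 (fun s : R => f (pt (x + s *: y)))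
    ('d (F f) p (L y)).
Proof.
have [N [F [p [L H]]]] := line_derivative x.
exists N, F, p, L => f y.
have [dF HF] := H f.
pose l (s : R) : 'rV[R]_N := p + s *: L y.
have -> : (fun s : R => f (pt (x + s *: y))) = F f \o l.
  by apply/funext => s; rewrite HF.
have l0 : l 0 = p by rewrite /l scale0r addr0.
have [dl ll] : is_diff (0 : R) l (fun s => s *: L y).
  by apply: is_diff_eq; apply/funext => s; rewrite fctE add0r.
have dF' : differentiable (F f) (l 0) by rewrite l0.
have dc : differentiable (F f \o l) (0 : R) by exact: differentiable_comp.
apply: DeriveDef; first exact: diff_derivable.
have -> : 'D_1 (F f \o l) 0 = 'd (F f \o l) (0 : R) (1 : R) by exact: deriveE.
have -> : 'd (F f \o l) (0 : R) (1 : R) =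
    'd (F f) (l 0) ('d l (0 : R) (1 : R)).
  by have /(congr1 (fun h => h (1 : R))) := diff_comp dl dF'.
by rewrite ll scale1r l0.
Qed.

(* d/dt|_0 (x + t y) *)
Program Definition vlift (m : M) (x y : E m) : tangent (pt x : total E) :=
  @Tangent _ _ _ _ (fun f => derive1 (fun s : R => f (pt (x + s *: y))) 0) _ _.
Next Obligation.
move=> m x y a f g; have [N [F [p [L H]]]] := line_is_derive x.
rewrite !derive1E; have Hf := H f y; have Hg := H g y.
rewrite (@derive_val _ _ _ _ _ _ _ Hf) (@derive_val _ _ _ _ _ _ _ Hg).
exact: (@derive_val _ _ _ _ _ _ _ (is_deriveD (is_deriveZ a Hf) Hg)).
Qed.
Next Obligation.
move=> m x y f g; have [N [F [p [L H]]]] := line_is_derive x.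
rewrite !derive1E; have Hf := H f y; have Hg := H g y.
rewrite (@derive_val _ _ _ _ _ _ _ Hf) (@derive_val _ _ _ _ _ _ _ Hg).
have := @derive_val _ _ _ _ _ _ _ (is_deriveM Hf Hg).
by rewrite scale0r addr0 [_ * g _]mulrC.
Qed.

Fact vlift_linear (m : M) (x : E m) (a : R) y z :
  vlift x (a *: y + z) = a *: vlift x y + vlift x z.
Proof.
apply: tangent_ext => f; have [N [F [p [L H]]]] := line_is_derive x.
rewrite -[RHS]/(a * vlift x y f + vlift x z f) /vlift /= !derive1E.
rewrite !(@derive_val _ _ _ _ _ _ _ (H f _)).
by rewrite linearP linearP.
Qed.

Section AtPoint.
Context {m : M} (x : E m).

(* r_E : T^*E -> E^* *)
Program Definition dual_proj (th : dual (tangent (pt x : total E))) :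
    dual (E m) := @Dual _ _ (fun y => th (vlift x y)) _.
Next Obligation. by move=> th a y z /=; rewrite vlift_linear dual_linear. Qed.

Definition side_proj (xi : TTs (pt x)) : side m :=
  ((dproj xi.1 : tangent m), dual_proj xi.2).

(* (T_x q_E)^t *)
Program Definition dproj_t (th : dual (tangent m)) :
    dual (tangent (pt x : total E)) :=
  @Dual _ _ (fun v => th (dproj v)) _.
Next Obligation.
move=> th a v w /=; rewrite -dual_linear; congr (th _).
exact: tangent_ext.
Qed.

Definition core_lift (b : core m) : TTs (pt x) := (vlift x b.1, dproj_t b.2).

End AtPoint.

Definition velocity (g : R -> total E) (e : total E) (v : tangent e) : Prop :=
  [/\ forall f : Cinf (total E), smooth_on setT (fun t : R => f (g t)),
      g 0 = e &
      forall f : Cinf (total E),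
        is_derive (0 : R) 1 (fun t : R => f (g t)) (v f)].

(* Addition and scalar multiplication of the vector bundle
   T q_E : TE -> TM, i.e. the tangent maps of those of E. The argument u is
   the sum of v and v', resp. the multiple of v by r. *)
Definition tangent_sum (m : M) (x x' : E m) (v : tangent (pt x : total E))
    (v' : tangent (pt x' : total E)) (u : tangent (pt (x + x') : total E)) :=
  exists (g : R -> M) (a b : forall t, E (g t)),
    [/\ velocity (fun t => pt (a t)) v, velocity (fun t => pt (b t)) v' &
        velocity (fun t => pt (a t + b t)) u].

Definition tangent_scale (m : M) (x : E m) (r : R)
    (v : tangent (pt x : total E)) (u : tangent (pt (r *: x) : total E)) :=
  exists (g : R -> M) (a : forall t, E (g t)),
    velocity (fun t => pt (a t)) v /\ velocity (fun t => pt (r *: a t)) u.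

(* Addition and scalar multiplication in the fibres of
   TE (+) T^*E -> TM (+) E^*. In T^*E -> E^* they are dual to those of TE -> TM:
   <th + th', v + v'> = <th, v> + <th', v'> and <r.th, r.v> = r <th, v>. *)
Definition side_sum (m : M) (x x' : E m)
    (xi : TTs (pt x)) (xi' : TTs (pt x')) (eta : TTs (pt (x + x'))) :=
  [/\ side_proj xi = side_proj xi', side_proj eta = side_proj xi,
      tangent_sum xi.1 xi'.1 eta.1 &
      forall v v' u, tangent_sum v v' u -> eta.2 u = xi.2 v + xi'.2 v'].

Definition side_scale (m : M) (x : E m) (r : R)
    (xi : TTs (pt x)) (eta : TTs (pt (r *: x))) :=
  [/\ side_proj eta = side_proj xi, tangent_scale xi.1 eta.1 &
      forall v u, tangent_scale v u -> eta.2 u = r * xi.2 v].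

(* J is a vector bundle morphism TE (+) T^*E -> TM (+) E^* over j. *)
Record linear_over (J : vbmor TTs TTs) (j : forall m, side m -> side m) :
    Prop := {
  linear_over_proj : forall m (x : E m) (xi : TTs (pt x)),
    side_proj (J (pt x) xi) = j m (side_proj xi);
  linear_over_sum : forall m (x x' : E m) xi xi' eta,
    @side_sum m x x' xi xi' eta ->
    side_sum (J (pt x) xi) (J (pt x') xi') (J (pt (x + x')) eta);
  linear_over_scale : forall m (x : E m) r xi eta,
    @side_scale m x r xi eta ->
    side_scale (J (pt x) xi) (J (pt (r *: x)) eta) }.

Definition linear_gcs (J : vbmor TTs TTs) : Prop :=
  gcs J /\ exists j, linear_over J j.

(* The j with linear_over J j is unique; vbid is a default value only. *)
Definition side_morphism (J : vbmor TTs TTs) : vbmor side side :=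
  xget (vbid side) [set j : vbmor side side | linear_over J j].

Definition lin_Cinf (eps : section (dual_bundle E)) : Cinf (total E) :=
  MkCinf (secP eps).

Definition pairing (nu : section side) (tau : section core) : Cinf M :=
  pull_sec (sfst tau) (lin_Cinf (ssnd nu)) + feval (ssnd tau) (sfst nu).

Definition pr_act (nu : section side) (f : Cinf M) : Cinf M :=
  vact (sfst nu) f.

Definition core_d (f : Cinf M) : section core := spair 0 (dform f).

Record dorfman := Dorfman {
  dorf :> section side -> section core -> section core;
  dorf_linl : forall a nu nu' tau,
    dorf (Ccst a *: nu + nu') tau = Ccst a *: dorf nu tau + dorf nu' tau;
  dorf_linr : forall a nu tau tau',
    dorf nu (Ccst a *: tau + tau') = Ccst a *: dorf nu tau + dorf nu tau';
  dorf_leibniz : forall f nu tau,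
    dorf nu (f *: tau) = f *: dorf nu tau + pr_act nu f *: tau;
  dorf_scale : forall f nu tau,
    dorf (f *: nu) tau = f *: dorf nu tau + pairing nu tau *: core_d f;
  dorf_exact : forall f nu, dorf nu (core_d f) = core_d (pr_act nu f) }.

Implicit Types (D : dorfman) (j : vbmor side side).

(* The defining relation determines kappa; 0 is a default value only. *)
Definition dull D (nu1 nu2 : section side) : section side :=
  xget 0 [set kappa | forall tau, pr_act nu1 (pairing nu2 tau) =
    pairing kappa tau + pairing nu2 (D nu1 tau)].

Definition dorf_skew D := forall nu1 nu2, dull D nu1 nu2 = - dull D nu2 nu1.

(* sigma^D(nu) at the point e(m); the value only depends on e through e(m). *)
Definition hlift D (nu : section side) (e : section (vec_bundle E)) (m : M) :
    TTs (pt (e m)) :=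
  (dsec e (sfst nu m), covec (lin_Cinf (ssnd nu)) (pt (e m)))
  - core_lift (e m) (D nu (spair e 0) m).

Definition adapted (J : vbmor TTs TTs) j D := forall nu (e : section (vec_bundle E)) m,
  J (pt (e m)) (hlift D nu e m) = hlift D (vbsec j nu) e m.

(* Psi is uniquely determined by this equation and, for skew-symmetric D1 and
   D2, is automatically a 2-form on TM (+) E^* with values in E^*. *)
Definition change_of_splitting D1 D2
    (Psi : section side -> section side -> section (dual_bundle E)) :=
  forall nu1 nu2, dull D2 nu1 nu2 = dull D1 nu1 nu2 + spair 0 (Psi nu1 nu2).

Definition j_equivalent j D1 D2 := exists2 Psi, change_of_splitting D1 D2 Psi &
  forall nu1 nu2, Psi nu1 nu2 = Psi (vbsec j nu1) (vbsec j nu2).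

End DoubleVectorBundle.

Section ComplexLieAlgebroid.
Context {R : realType} {n : nat} {M : manifold R n}.

(* (x, y) stands for x (x) 1 + y (x) i in V (x) C; likewise an element of
   C^oo(M, C) is a pair of real and imaginary parts in C^oo(M). *)
Definition complexify (V : bundle M) : bundle M := bsum V V.

Definition cact (Z : section (complexify (tangent_bundle M)))
    (f : complex (Cinf M)) : complex (Cinf M) :=
  Complex (vact (sfst Z) (complex.Re f) - vact (ssnd Z) (complex.Im f))
          (vact (sfst Z) (complex.Im f) + vact (ssnd Z) (complex.Re f)).

Definition cscale (V : bundle M) (j : vbmor V V) (f : complex (Cinf M))
    (s : section V) : section V :=
  complex.Re f *: s + complex.Im f *: vbsec j s.

Record complex_lie_algebroid (V : bundle M) (j : vbmor V V)
    (br : section V -> section V -> section V)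
    (lam : vbmor V (complexify (tangent_bundle M))) : Prop := {
  cla_complex : forall m x, j m (j m x) = - x;
  cla_linl : forall a q q' r, br (Ccst a *: q + q') r =
    Ccst a *: br q r + br q' r;
  cla_linr : forall a q r r', br q (Ccst a *: r + r') =
    Ccst a *: br q r + br q r';
  cla_il : forall q r, br (vbsec j q) r = vbsec j (br q r);
  cla_ir : forall q r, br q (vbsec j r) = vbsec j (br q r);
  cla_skew : forall q r, br q r = - br r q;
  cla_jacobi : forall q r s,
    br q (br r s) + br r (br s q) + br s (br q r) = 0;
  cla_anchor : forall m x,
    lam m (j m x) = (- (lam m x).2, (lam m x).1);
  cla_leibniz : forall q r f, br q (cscale j f r) =
    cscale j (cact (vbsec lam q) f) r + cscale j f (br q r) }.

End ComplexLieAlgebroid.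

Section LinearData.
Context {R : realType} {n k : nat} {M : manifold R n} (E : vbundle M k).
Implicit Types (j : vbmor (side E) (side E)) (D : dorfman E).

Definition bracketA j D (nu1 nu2 : section (side E)) : section (side E) :=
  Ccst 2^-1 *: (dull D nu1 nu2 - dull D (vbsec j nu1) (vbsec j nu2)).

(* pr_{T_C M} of (nu (x) 1 - (j nu) (x) i) / 2 *)
Definition rho_vect j (m : M) (nu : side E m) :
    complexify (tangent_bundle M) m :=
  let w : complexify (side E) m := 2^-1 *: ((nu, 0) - (0, j m nu)) in
  (w.1.1, w.2.1).

Program Definition rho j : vbmor (side E) (complexify (tangent_bundle M)) :=
  VBMor (vbfun := rho_vect j) _ _.
Next Obligation.
move=> j m a x y; rewrite /rho_vect vb_linear; congr pair => /=.
  by rewrite !subr0 !scalerDr !scalerA mulrC.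
rewrite !sub0r opprD scalerDr -scalerN !scalerA.
by congr (_ *: _ + _); ring.
Qed.
Next Obligation.
move=> j s.
rewrite (_ : (fun m => _) =
  spair (sfst (Ccst 2^-1 *: s)) (sfst (Ccst (- 2^-1) *: vbsec j s))).
  exact: secP.
apply: functional_extensionality_dep => m.
by congr pair; rewrite /= ?subr0 // sub0r scalerN scaleNr.
Qed.

(* C is a j-equivalence class; all its members define the same bracketA. *)
Definition gcs_data j (C : set (dorfman E)) : Prop :=
  [/\ forall m nu, j m (j m nu) = - nu,
      exists2 D0, dorf_skew D0 &
        C = [set D | dorf_skew D /\ j_equivalent j D0 D] &
      forall D, C D -> complex_lie_algebroid j (bracketA j D) (rho j)].

Definition adapted_class (J : vbmor (TTs E) (TTs E)) : set (dorfman E) :=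
  [set D | dorf_skew D /\ adapted J (side_morphism J) D].

End LinearData.

(* Main.v *)
(** Fix a skew-symmetric Dorfman connection D with dull bracket [., .].
Horizontal lifts of sections of the side bundle TM + E^* and core sections
span TE + T^*E; horizontal lifts are isotropic, and pairing the Courant bracket
of two horizontal lifts with generators yields the dull bracket and its
jacobiator. A linear orthogonal J with J^2 = -1 acts on core sections by -j^t,
so J sigma(nu) differs from sigma(j nu) by a core section, which is measured by
the linear functions c(nu, mu) = <J sigma(nu), sigma(mu)>. Changing the dull
bracket by Psi(nu, mu) = -c(nu, j mu)/2 gives a connection adapted to J, and
comparing two connections in the same way shows that the adapted ones form a
j-equivalence class. If D is adapted to J, then the Nijenhuis tensor of J is
totally skew and tensorial, hence determined by generators: it vanishes iff
- [nu, mu] - [j nu, j mu] + j ([j nu, mu] + [nu, j mu]) = 0, which says that the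
  bracket A is complex bilinear, and
- a combination of jacobiators vanishes, which is the Jacobi identity of A; its
  TM-component vanishes automatically.
Conversely j and D determine J on horizontal lifts and on the core.

Smoothness is localised algebraically: f is smooth iff for every point p there
is a smooth psi with psi(p) <> 0 and psi f smooth. *)

From HB Require Import structures.
Require Import Defs.
From mathcomp Require Import all_boot all_order all_algebra.
From mathcomp Require Import all_classical all_reals all_analysis.
From mathcomp Require Import complex ring.
Set Implicit Arguments.
Unset Strict Implicit.
Unset Printing Implicit Defensive.
Import Order.TTheory GRing.Theory Num.Theory.
Import numFieldNormedType.Exports.
Local Open Scope classical_set_scope.
Local Open Scope ring_scope.

(** * Smooth calculus on normed spaces *)

Section Smooth.
Context {R : realType}.
Implicit Types V : normedModType R.

Lemma smooth_comp V m (U : set V) (B : set 'rV[R]_m)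
    (G : V -> 'rV[R]_m) (F : 'rV[R]_m -> R) : open U ->
  (forall x, U x -> B (G x)) ->
  (forall i, smooth_on U (fun x => G x 0 i)) -> smooth_on B F ->
  smooth_on U (F \o G).
Proof.
move=> oU GB hG hF k.
have dG x : U x -> differentiable G x /\
    forall v, 'd G x v = \row_i 'd (fun y => G y 0 i) x v.
  by move=> Ux; apply: row_differentiable => i; have [+ _] := hG i 1%N; apply.
elim: k F {hF}(hF k) => [|k IH] F.
  move=> hF x Ux; apply: continuous_comp; last exact/hF/GB.
  by apply: differentiable_continuous; have [] := dG x Ux.
case=> h1 h2; split=> [x Ux|v].
  by apply: differentiable_comp; [have [] := dG x Ux|apply/h1/GB].
apply: (@Ck_on_eq _ _ _ _ (fun x => \sum_(i < m)
    'd (fun y => G y 0 i) x v * 'd F (G x) (delta_mx 0 i))) => //.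
  move=> x Ux; have [d E] := dG x Ux.
  have -> : 'd (F \o G) x v = 'd F (G x) ('d G x v).
    by rewrite diff_comp //; apply/h1/GB.
  rewrite E [X in 'd F _ X]row_sum_delta linear_sum.
  by apply: eq_bigr => i _; rewrite linearZ /= mxE.
apply: Ck_on_sum => // i; apply: Ck_onM => //.
  by have [_ ] := hG i k.+1; apply.
exact: IH (fun y => 'd F y (delta_mx 0 i)) (h2 _).
Qed.

Lemma smooth_comp1 V (U : set V) (B : set R) (g : V -> R) (F : R -> R) :
  open U -> (forall x, U x -> B (g x)) ->
  smooth_on U g -> smooth_on (B : set R^o) F -> smooth_on U (F \o g).
Proof.
move=> oU GB hG hF k.
elim: k F {hF}(hF k) => [|k IH] F.
  move=> hF x Ux; apply: continuous_comp; last exact/hF/GB.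
  by have [+ _] := hG 1%N; move=> /(_ x Ux) /differentiable_continuous.
case=> h1 h2; split=> [x Ux|v].
  apply: differentiable_comp; last exact/h1/GB.
  by have [+ _] := hG 1%N; apply.
apply: (@Ck_on_eq _ _ _ _ (fun x => 'd g x v * 'd F (g x) (1 : R^o))) => //.
  move=> x Ux.
  have -> : 'd (F \o g) x v = 'd F (g x) ('d g x v).
    rewrite diff_comp //; last exact/h1/GB.
    by have [+ _] := hG 1%N; apply.
  have {2}-> : 'd g x v = 'd g x v *: (1 : R^o) by rewrite [RHS]mulr1.
  by rewrite linearZ.
apply: Ck_onM => //; first by have [_ ] := hG k.+1; apply.
exact: IH (fun y => 'd F y (1 : R^o)) (h2 _).
Qed.

Lemma smooth_on_cst V (U : set V) (a : R) : smooth_on U (fun=> a).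
Proof. by move=> k; apply: Ck_on_cst. Qed.

Lemma smooth_onD V (U : set V) (f g : V -> R) : open U ->
  smooth_on U f -> smooth_on U g -> smooth_on U (fun x => f x + g x).
Proof. by move=> oU hf hg k; apply: Ck_onD. Qed.

Lemma smooth_onM V (U : set V) (f g : V -> R) : open U ->
  smooth_on U f -> smooth_on U g -> smooth_on U (fun x => f x * g x).
Proof. by move=> oU hf hg k; apply: Ck_onM. Qed.

Lemma smooth_onN V (U : set V) (f : V -> R) : open U ->
  smooth_on U f -> smooth_on U (fun x => - f x).
Proof.
move=> oU hf; apply: (@smooth_on_eq _ _ _ (fun x => -1 * f x)) => //.
  by move=> x _; rewrite mulN1r.
by apply: smooth_onM => //; apply: smooth_on_cst.
Qed.

Lemma smooth_on_sum V (U : set V) n (f : 'I_n -> V -> R) : open U ->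
  (forall i, smooth_on U (f i)) -> smooth_on U (fun x => \sum_i f i x).
Proof. by move=> oU hf k; apply: Ck_on_sum => // i; apply: hf. Qed.

Lemma smooth_on_prod V (U : set V) n (f : 'I_n -> V -> R) : open U ->
  (forall i, smooth_on U (f i)) -> smooth_on U (fun x => \prod_i f i x).
Proof.
move=> oU; elim: n f => [|n IH] f h.
  rewrite (_ : (fun _ => _) = fun=> 1); first exact: smooth_on_cst.
  by apply/funext => x; rewrite big_ord0.
rewrite (_ : (fun _ => _) = fun x => f ord0 x * \prod_i f (lift ord0 i) x).
  by apply: smooth_onM => //; apply: IH.
by apply/funext => x; rewrite big_ord_recl.
Qed.

Lemma smooth_on_diff V (U : set V) (f : V -> R) v :
  smooth_on U f -> smooth_on U (fun x => 'd f x v).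
Proof. by move=> h k; have [_ ] := h k.+1; apply. Qed.

Lemma smooth_on_differentiable V (U : set V) (f : V -> R) x :
  smooth_on U f -> U x -> differentiable f x.
Proof. by move=> h Ux; have [+ _] := h 1%N; apply. Qed.

Lemma smooth_on_inv V (U : set V) (f : V -> R) : open U ->
  (forall x, U x -> f x != 0) ->
  smooth_on U f -> smooth_on U (fun x => (f x)^-1).
Proof.
move=> oU nf hf k; elim: k => [|k IH].
  move=> x Ux; apply: continuousV; first exact: nf.
  exact: (hf 0%N).
split=> [x Ux|v].
  by apply: differentiableV; [exact: smooth_on_differentiable Ux|exact: nf].
apply: (@Ck_on_eq _ _ _ _
   (fun x => (-1 * ((f x)^-1 * (f x)^-1)) * 'd f x v)) => //.
  move=> x Ux; have df := smooth_on_differentiable hf Ux.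
  by rewrite diffV ?nf //= mulN1r expr2 invfM.
apply: Ck_onM => //; last exact: smooth_on_diff.
by apply: Ck_onM; [|exact: Ck_on_cst|exact: Ck_onM].
Qed.

End Smooth.

Section Flat.
Context {R : realType}.

Definition flat (m : nat) (s : R) : R :=
  if 0 < s then s^-1 ^+ m * expR (- s^-1) else 0.

Lemma flat_bound m (s : R) : `|flat m s| <= (m.+2)`!%:R * s ^+ 2.
Proof.
rewrite /flat; case: ifPn => [s0|_]; last by rewrite normr0 mulr_ge0 ?sqr_ge0.
have t0 : 0 < s^-1 by rewrite invr_gt0.
rewrite ger0_norm; last by rewrite mulr_ge0 ?expR_ge0 // exprn_ge0 // ltW.
have := expR_ge1Dxn m.+1 (ltW t0) => h.
have h2 : s^-1 ^+ m.+2 <= (m.+2)`!%:R * expR s^-1.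
  rewrite mulrC -ler_pdivrMr ?ltr0n ?fact_gt0 //.
  by apply: le_trans h; rewrite lerDr.
rewrite expRN ler_pdivrMr ?expR_gt0 //.
have -> : s^-1 ^+ m = s^-1 ^+ m.+2 * s ^+ 2.
  rewrite -[m.+2]addn2 exprD -mulrA -exprMn mulVf ?gt_eqF //.
  by rewrite expr1n mulr1.
by rewrite [leRHS]mulrAC ler_pM2r // exprn_gt0.
Qed.

Lemma flat_is_derive m (x : R) :
  is_derive x 1 (flat m) (- m%:R * flat m.+1 x + flat m.+2 x).
Proof.
have [x0|x0|x0] := ltgtP x 0.
- rewrite {2 3}/flat !ltNge (ltW x0) /= mulr0 addr0.
  apply: (@near_eq_is_derive _ _ _ (cst 0)) => //.
    near=> y; rewrite /flat ltNge ltW //.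
    by near: y; apply: lt_nbhsl.
- have -> : - m%:R * flat m.+1 x + flat m.+2 x =
    (- m%:R * x^-1 ^+ m.+1 + x^-1 ^+ m.+2) * expR (- x^-1).
    by rewrite /flat x0; ring.
  apply: (@near_eq_is_derive _ _ _ (fun y : R => y^-1 ^+ m * expR (- y^-1))) => //.
    near=> y; rewrite /flat ifT //.
    by near: y; apply: lt_nbhsr.
  have dV : is_derive x (1 : R) (fun y : R => y^-1) (- x ^- 2 *: (1 : R)).
    by apply: is_deriveV; rewrite ?gt_eqF.
  have dE := @is_derive1_comp _ expR _ x _ _ (is_derive_expR _) (is_deriveN dV).
  have dX := is_deriveX m dV.
  have dM := is_deriveM dX dE.
  rewrite (_ : (fun y => _) =
     ((fun y : R => y^-1) ^+ m : R -> R) * (expR \o - (fun y : R => y^-1))); last first.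
    by apply/funext => y; rewrite /= !fctE.
  apply: (is_derive_eq dM).
  rewrite /= !fctE /GRing.scale /= -!exprVn.
  pose e := expR (- x^-1); pose t := x^-1.
  case: m {dX dM} => [|m].
    change (1 * (e * - (- t ^+ 2 * 1)) + e * (0 * 1 * (- t ^+ 2 * 1)) =
      (- 0 * t ^+ 1 + t ^+ 2) * e).
    by ring.
  change (t ^+ m.+1 * (e * - (- t ^+ 2 * 1)) +
    e * (m.+1%:R * t ^+ m * (- t ^+ 2 * 1)) =
    (- m.+1%:R * t ^+ m.+2 + t ^+ m.+3) * e).
  by rewrite !exprS; ring.
- rewrite x0; rewrite {2 3}/flat ltxx mulr0 addr0.
  apply/is_derive1_caratheodory; exists (fun z => flat m z / z).
  have f0 : flat m 0 = 0 by rewrite /flat ltxx.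
  split; last by rewrite f0 mul0r.
    move=> z; rewrite f0 !subr0; have [->|z0] := eqVneq z 0.
      by rewrite f0 mulr0.
    by rewrite divfK.
  rewrite /prop_for /continuous_at f0 mul0r.
  have C : ((m.+2)`!%:R * `|z| : R) @[z --> (0 : R)] --> (0 : R).
    have : ((m.+2)`!%:R * `|z| : R) @[z --> (0 : R)] --> (m.+2)`!%:R * `|0 : R|.
      by apply: cvgM; [exact: cvg_cst|exact: (@norm_continuous R R^o 0)].
    by rewrite normr0 mulr0.
  apply: (@squeeze_cvgr _ _ _ _ (fun z : R => - ((m.+2)`!%:R * `|z|))
      (fun z => (m.+2)`!%:R * `|z|)).
  + near=> z; rewrite -ler_norml normrM normfV.
    have [->|z0] := eqVneq z 0; first by rewrite normr0 invr0 !mulr0.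
    rewrite ler_pdivrMr ?normr_gt0 //; apply: le_trans (flat_bound m z) _.
    by rewrite -mulrA -expr2 -normrX ger0_norm ?sqr_ge0.
  + by rewrite -[X in _ --> X]oppr0; apply: cvgN.
  + exact: C.
Unshelve. all: by end_near. Qed.

Lemma smooth_flat m : smooth_on (setT : set R^o) (flat m).
Proof.
move=> k; elim: k m => [|k IH] m.
  move=> x _; apply: differentiable_continuous; apply/derivable1_diffP.
  by have [] := flat_is_derive m x.
have df x : differentiable (flat m) x.
  by apply/derivable1_diffP; have [] := flat_is_derive m x.
split=> // v.
apply: (@Ck_on_eq _ _ _ _
    (fun x => v * (- m%:R * flat m.+1 x + flat m.+2 x))).
- exact: openT.
- move=> x _; have [_ e] := flat_is_derive m x.
  have {2}-> : v = v *: (1 : R^o) by rewrite [RHS]mulr1.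
  by rewrite linearZ /= -deriveE // e.
apply: Ck_onM; [exact: openT|exact: Ck_on_cst|].
apply: Ck_onD => //; first exact: openT.
by apply: Ck_onM => //; [exact: openT|exact: Ck_on_cst].
Qed.

Lemma flat_gt0 m (s : R) : 0 < s -> 0 < flat m s.
Proof. by move=> s0; rewrite /flat s0 mulr_gt0 ?expR_gt0 // exprn_gt0 ?invr_gt0. Qed.

Lemma flat_le0 m (s : R) : s <= 0 -> flat m s = 0.
Proof. by move=> s0; rewrite /flat ltNge s0. Qed.

Lemma flat_ge0 m (s : R) : 0 <= flat m s.
Proof.
by have [/flat_le0->//|/flat_gt0 h] := leP s 0; rewrite ltW.
Qed.

End Flat.

Section RadialMean.
Context {R : realType} {n : nat} (p : 'rV[R]_n) (r : R).
Local Notation U := (ball p r).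
Local Notation mu := (@lebesgue_measure R).

Definition radial (x : 'rV[R]_n) (t : R) : 'rV[R]_n := p + t *: (x - p).

Lemma radialD x h t : radial (x + h) t = radial x t + t *: h.
Proof. by rewrite /radial [x + h - p]addrAC scalerDr addrA. Qed.

Lemma ball_radial x t : U x -> 0 <= t <= 1 -> U (radial x t).
Proof.
rewrite -ball_normE /= => Ux /andP[t0 t1].
rewrite /radial opprD addrA subrr add0r normrN normrZ ger0_norm //.
apply: le_lt_trans Ux; rewrite -normrN opprB.
by rewrite ler_piMl.
Qed.

Lemma linear_rV_continuous (L : {linear 'rV[R]_n -> R^o}) : continuous L.
Proof.
have -> : (L : 'rV[R]_n -> R^o) =
    (fun v : 'rV[R]_n => \sum_i v 0 i * L (delta_mx 0 i) : R).
  apply/funext => v; rewrite {1}[v]row_sum_delta linear_sum.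
  by apply: eq_bigr => i _; rewrite linearZ.
have oT := @openT 'rV[R]_n.
have sL : smooth_on setT (fun v : 'rV[R]_n => \sum_i v 0 i * L (delta_mx 0 i)).
  apply: smooth_on_sum => // i.
  by apply: smooth_onM; [|exact: smooth_on_coord|exact: smooth_on_cst].
by move=> v; exact: (sL 0%N v I).
Qed.

Definition mean (m : nat) (F : 'rV[R]_n -> R) (x : 'rV[R]_n) : R :=
  \int[mu]_(t in `[0, 1]) (t ^+ m * F (radial x t)).

Lemma radial_continuous x : continuous (radial x).
Proof.
move=> t; apply: cvgD; first exact: cvg_cst.
by apply: cvgZr_tmp; exact: cvg_id.
Qed.

Lemma radial_within m F x : smooth_on U F -> U x ->
  {within `[(0:R), 1], continuous (fun t : R => t ^+ m * F (radial x t) : R^o)}.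
Proof.
move=> sF Ux; apply: continuous_in_subspaceT => t; rewrite inE /= in_itv /= => t01.
apply: (@cvgM R R _ _ (fun t => t ^+ m) (fun t => F (radial x t))).
  exact: exprn_continuous.
apply: continuous_comp; first exact: radial_continuous.
by apply: (sF 0%N); exact: ball_radial.
Qed.

Lemma radial_integrable m F x : smooth_on U F -> U x ->
  mu.-integrable `[0, 1] (EFin \o (fun t => t ^+ m * F (radial x t))).
Proof.
move=> sF Ux; apply: continuous_compact_integrable; first exact: segment_compact.
exact: radial_within.
Qed.

Lemma mean_linear m F x : smooth_on U F -> U x ->
  linear (fun v => mean m (fun y => 'd F y v) x : R^o).
Proof.
move=> sF Ux a v w.
rewrite -[RHS]/(a * mean m (fun y => 'd F y v) x + mean m (fun y => 'd F y w) x).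
rewrite /mean.
have mI : measurable (`[0%R, 1%R] : set (measurableTypeR R)) by exact: measurable_itv.
have iv u := radial_integrable m (smooth_on_diff u sF) Ux.
rewrite -RintegralZl // -RintegralD //; last first.
  have := radial_integrable m
    (smooth_onM (ball_open _ _) (smooth_on_cst U a) (smooth_on_diff v sF)) Ux.
  by congr (integrable _ _ (EFin \o _)); apply/funext => t; exact: mulrCA.
apply: eq_Rintegral => t _.
by rewrite linearP /= mulrDr; congr (_ + _); exact: mulrCA.
Qed.

Lemma radial_uniform F x (e : R) : smooth_on U F -> U x -> 0 < e ->
  \forall h \near (0 : 'rV[R]_n), forall t, 0 <= t <= 1 ->
    `|F (radial x t + h) - F (radial x t)| < e.
Proof.
move=> sF Ux e0.
have K : compact (`[0%R, 1%R] : set R) by exact: segment_compact.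
move/compact_near_coveringP in K.
pose P (h : 'rV[R]_n) t := `|F (radial x t + h) - F (radial x t)| < e.
suff H : \forall h \near (0 : 'rV[R]_n), `[0%R, 1%R]%classic `<=` P h.
  by apply: filterS H => h H t t01; apply: H; rewrite /= in_itv.
apply: (K _ (nbhs (0 : 'rV[R]_n)) P) => t0 /=; rewrite in_itv /= => t01.
have cF := sF 0%N _ (ball_radial Ux t01).
have e20 : 0 < e / 2 by rewrite divr_gt0.
have /cvgrPdist_lt /(_ _ e20) N1 := cF.
pose G (th : R * 'rV[R]_n) := radial x th.1 + th.2.
have cG : G @ (t0, 0 : 'rV[R]_n) --> radial x t0.
  rewrite -[X in _ --> X]addr0; apply: cvgD.
    by apply: continuous_cvg; [exact: radial_continuous|exact: cvg_fst].
  exact: cvg_snd.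
have cG1 : (fun th : R * 'rV[R]_n => radial x th.1) @ (t0, 0 : 'rV[R]_n) --> radial x t0.
  by apply: continuous_cvg; [exact: radial_continuous|exact: cvg_fst].
have A : \forall th \near (t0, 0 : 'rV[R]_n),
  `|F (radial x t0) - F (radial x th.1 + th.2)| < e / 2 := cG _ N1.
have B : \forall th \near (t0, 0 : 'rV[R]_n),
  `|F (radial x t0) - F (radial x th.1)| < e / 2 := cG1 _ N1.
suff S (th : R * 'rV[R]_n) : `|F (radial x t0) - F (radial x th.1 + th.2)| < e / 2 ->
    `|F (radial x t0) - F (radial x th.1)| < e / 2 -> P th.2 th.1.
  exact: (filterS2 _ S A B).
case: th => t h /= {}A {}B.
rewrite /P [e]splitr; apply: le_lt_trans (ltrD A B).
rewrite [X in _ <= X + _]distrC.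
exact: ler_distD.
Qed.

End RadialMean.

Section Hadamard.
Context {R : realType} {n : nat}.
Local Notation mu := (@lebesgue_measure R).

Lemma coord_norm (v : 'rV[R]_n) i : `|v 0 i| <= `|v|.
Proof.
rewrite [leRHS]/Num.norm /= mx_normrE.
exact: (le_bigmax _ (fun ij : 'I_1 * 'I_n => `|v ij.1 ij.2|) (0, i)).
Qed.

Lemma is_derive_line (V : normedModType R) (F : V -> R) (a w : V) (s0 : R) :
  differentiable F (a + s0 *: w) ->
  is_derive s0 (1 : R) (fun s : R => F (a + s *: w)) ('d F (a + s0 *: w) w).
Proof.
move=> dF; pose l (s : R) : V := a + s *: w.
have [dl ll] : is_diff s0 l (fun s => s *: w).
  by apply: is_diff_eq; apply/funext => s; rewrite fctE add0r.
have dF' : differentiable F (l s0) by [].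
have dc : differentiable (F \o l) s0 by exact: differentiable_comp.
apply: DeriveDef; first exact: diff_derivable.
have -> : 'D_1 (F \o l) s0 = 'd (F \o l) s0 (1 : R) by exact: deriveE.
have -> : 'd (F \o l) s0 (1 : R) = 'd F (l s0) ('d l s0 (1 : R)).
  by have /(congr1 (fun h => h (1 : R))) := diff_comp dl dF'.
by rewrite ll scale1r.
Qed.

Lemma diff_coord (F : 'rV[R]_n -> R) x v : differentiable F x ->
  'd F x v = \sum_i v 0 i * 'd F x (delta_mx 0 i).
Proof.
move=> dF; rewrite {1}[v]row_sum_delta linear_sum.
by apply: eq_bigr => i _; rewrite linearZ.
Qed.

Context (p : 'rV[R]_n) (r : R).
Local Notation U := (ball p r).

Lemma radial_taylor F x (e : R) : smooth_on U F -> U x -> 0 < e ->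
  \forall h \near (0 : 'rV[R]_n), U (x + h) /\ forall t, 0 <= t <= 1 ->
    `|F (radial p (x + h) t) - F (radial p x t) - t * 'd F (radial p x t) h|
      <= e * `|h|.
Proof.
move=> sF Ux e0.
pose e' := e / (n.+1)%:R.
have e'0 : 0 < e' by rewrite divr_gt0.
have N1 : \forall h \near (0 : 'rV[R]_n), forall i t, 0 <= t <= 1 ->
    `|'d F (radial p x t + h) (delta_mx 0 i) - 'd F (radial p x t) (delta_mx 0 i)| < e'.
  have Q i := radial_uniform (smooth_on_diff (delta_mx 0 i) sF) Ux e'0.
  exact: (filter_forall _ Q).
have N2 : \forall h \near (0 : 'rV[R]_n), U (x + h).
  have : \forall y \near x, U y by apply: open_nbhs_nbhs; split => //; exact: ball_open.
  by rewrite (near_shift 0) /=; apply: filterS => y /=; rewrite subr0 addrC.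
have N12 := @filterI _ _ (nbhs_filter _) _ _ N1 N2.
have [d /= d0 D] := (nbhs_ballP _ _).1 N12.
apply: (nbhs_ballP _ _).2; exists d => //= h dh.
have [_ Uh] := D h dh; split => // t t01.
have dsh s : 0 <= s <= 1 -> ball 0 d (s *: h).
  move: dh; rewrite -ball_normE /= !sub0r !normrN => dh /andP[s0 s1].
  by rewrite normrZ ger0_norm //; apply: le_lt_trans dh; rewrite ler_piMl.
have Ush s : 0 <= s <= 1 -> U (radial p (x + s *: h) t).
  by move=> s01; apply: ball_radial => //; have [] := D _ (dsh s s01).
have E s : radial p (x + s *: h) t = radial p x t + s *: (t *: h).
  by rewrite radialD !scalerA mulrC.
have dphi (s : R) : 0 <= s <= 1 -> is_derive s (1 : R)
    (fun s => F (radial p x t + s *: (t *: h)))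
    ('d F (radial p x t + s *: (t *: h)) (t *: h)).
  move=> s01; apply: is_derive_line; rewrite -E.
  by apply: (smooth_on_differentiable sF); exact: Ush.
have [||c] := @MVT_segment R (fun s => F (radial p x t + s *: (t *: h)))
  (fun s => 'd F (radial p x t + s *: (t *: h)) (t *: h)) 0 1 ler01.
- by move=> s; rewrite in_itv /= => /andP[s0 s1]; apply: dphi; rewrite !ltW.
- apply: continuous_in_subspaceT => s; rewrite inE /= in_itv /= => s01.
  apply: differentiable_continuous; apply/derivable1_diffP.
  by have [] := dphi s s01.
rewrite in_itv /= => c01.
rewrite scale0r addr0 scale1r subr0 mulr1 -radialD => ->.
have -> : t * 'd F (radial p x t) h = 'd F (radial p x t) (t *: h).
  by rewrite linearZ.
have Uc := Ush _ c01; rewrite E in Uc.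
have d1 := smooth_on_differentiable sF Uc.
have d2 := smooth_on_differentiable sF (ball_radial Ux t01).
have E1 := diff_coord (t *: h) d1; have E2 := diff_coord (t *: h) d2.
have E3 := congr2 (fun a b : R => a - b) E1 E2.
apply: (eq_ind_r (fun z : R => `|z| <= e * `|h|) _ E3).
rewrite -sumrB.
apply: le_trans (ler_norm_sum _ _ _) _.
have B i : `|(t *: h) 0 i * 'd F (radial p x t + c *: (t *: h)) (delta_mx 0 i) -
      (t *: h) 0 i * 'd F (radial p x t) (delta_mx 0 i)| <= `|h| * e'.
  rewrite -mulrBr normrM; apply: ler_pM => //.
    apply: le_trans (coord_norm _ _) _; case/andP: t01 => t0 t1.
    by rewrite normrZ ger0_norm // ler_piMl.
  case/andP: (t01) => t0 t1; case/andP: (c01) => c0 c1.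
  have ct01 : 0 <= c * t <= 1 by rewrite mulr_ge0 //= mulr_ile1.
  have [N _] := D _ (dsh _ ct01).
  by rewrite -scalerA in N; apply/ltW/N.
apply: le_trans (ler_sum _ (fun i _ => B i)) _.
rewrite sumr_const card_ord -mulr_natr [leRHS]mulrC -mulrA ler_wpM2l //.
rewrite /e' mulrAC ler_pdivrMr // ler_wpM2l ?ltW //.
by rewrite ltr_nat.
Qed.

Lemma Rintegral01_cst (a : R) : \int[mu]_(t in `[0, 1]) a = a.
Proof.
rewrite Rintegral_cst; last exact: measurable_itv.
by rewrite /= lebesgue_measure_itv /= lte01 oppr0 addr0 mulr1.
Qed.

Lemma mean_diff m F x : smooth_on U F -> U x ->
  differentiable (mean p m F) x /\
  forall v, 'd (mean p m F) x v = mean p m.+1 (fun y => 'd F y v) x.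
Proof.
move=> sF Ux.
pose L (v : 'rV[R]_n) : R^o := mean p m.+1 (fun y => 'd F y v) x.
have lL : linear L := mean_linear m.+1 sF Ux.
pose LM := GRing.isLinear.Build _ _ _ _ _ lL.
pose LL : {linear 'rV[R]_n -> R^o} := HB.pack L LM.
have cL := @linear_rV_continuous _ _ LL.
have mI : measurable (`[0%R, 1%R] : set (measurableTypeR R)) by exact: measurable_itv.
have H : (mean p m F : _ -> R^o) \o shift x =
    cst (mean p m F x : R^o) + (LL : _ -> _) +o_ (0 : 'rV[R]_n) id.
  apply/eqaddoP => e e0.
  apply: filterS (radial_taylor sF Ux e0) => h [Uh B].
  rewrite /= !fctE /= opprD addrA [h + x]addrC.
  pose I1 := radial_integrable m sF Uh; pose I2 := radial_integrable m sF Ux.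
  pose I3 := radial_integrable m.+1 (smooth_on_diff h sF) Ux.
  have I12 : mu.-integrable `[0, 1] (EFin \o (fun t =>
      t ^+ m * F (radial p (x + h) t) - t ^+ m * F (radial p x t))).
    exact: (integrableB mI I1 I2).
  have I123 : mu.-integrable `[0, 1] (EFin \o (fun t =>
      t ^+ m * F (radial p (x + h) t) - t ^+ m * F (radial p x t) -
      t ^+ m.+1 * 'd F (radial p x t) h)).
    exact: (integrableB mI I12 I3).
  have -> : mean p m F (x + h) - mean p m F x - LL h =
      \int[mu]_(t in `[0, 1]) (t ^+ m * F (radial p (x + h) t) -
        t ^+ m * F (radial p x t) - t ^+ m.+1 * 'd F (radial p x t) h).
    by rewrite RintegralB // RintegralB.
  apply: le_trans (le_normr_Rintegral mI I123) _.
  rewrite -[leRHS]Rintegral01_cst; apply: le_Rintegral => //.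
  - exact: (integrable_norm I123).
  - apply: continuous_compact_integrable; first exact: segment_compact.
    by apply: continuous_in_subspaceT => t _; exact: cvg_cst.
  - move=> t /=; rewrite in_itv /= => t01.
    rewrite exprSr -mulrA -!mulrBr normrM.
    apply: le_trans (B t t01); case/andP: t01 => t0 t1.
    rewrite ler_piMl // ger0_norm ?exprn_ge0 //.
    exact: exprn_ile1.
have E : 'd (mean p m F) x = LL :> (_ -> _) by exact: diff_unique cL H.
split; last by move=> v; exact: (congr1 (fun g => g v) E).
by apply/diff_locallyP; rewrite E; split.
Qed.

Lemma smooth_mean m F : smooth_on U F -> smooth_on U (mean p m F).
Proof.
move=> sF k; elim: k m F sF => [|k IH] m F sF.
  move=> x Ux; apply: differentiable_continuous.
  exact: (mean_diff m sF Ux).1.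
split=> [x Ux|v]; first exact: (mean_diff m sF Ux).1.
apply: (@Ck_on_eq _ _ _ _ (mean p m.+1 (fun y => 'd F y v))).
- exact: ball_open.
- by move=> x Ux; exact: esym ((mean_diff m sF Ux).2 v).
- exact/IH/smooth_on_diff.
Qed.

Lemma hadamard F : 0 < r -> smooth_on U F ->
  exists g : 'I_n -> 'rV[R]_n -> R,
  [/\ forall i, smooth_on U (g i),
      forall x, U x -> F x = F p + \sum_i (x - p) 0 i * g i x &
      forall i, g i p = 'd F p (delta_mx 0 i)].
Proof.
move=> r0 sF; exists (fun i => mean p 0 (fun y => 'd F y (delta_mx 0 i))); split.
- by move=> i; apply/smooth_mean/smooth_on_diff.
- move=> x Ux.
  pose L (v : 'rV[R]_n) : R^o := mean p 0 (fun y => 'd F y v) x.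
  have lL : linear L := mean_linear 0 sF Ux.
  pose LM := GRing.isLinear.Build _ _ _ _ _ lL.
  pose LL : {linear 'rV[R]_n -> R^o} := HB.pack L LM.
  rewrite (_ : \sum_i _ = LL (x - p)); last first.
    rewrite {2}[x - p]row_sum_delta linear_sum.
    by apply: eq_bigr => i _; rewrite linearZ.
  have dphi (t : R) : 0 <= t <= 1 -> is_derive t (1 : R)
      (fun s => F (p + s *: (x - p))) ('d F (p + t *: (x - p)) (x - p)).
    move=> t01; apply: is_derive_line.
    exact: (smooth_on_differentiable sF (ball_radial Ux t01)).
  have cphi (t : R) : 0 <= t <= 1 -> {for t, continuous (fun s : R => F (p + s *: (x - p)) : R)}.
    move=> t01; apply: differentiable_continuous; apply/derivable1_diffP.
    by have [] := dphi t t01.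
  have := @continuous_FTC2 R (fun t => t ^+ 0 * 'd F (radial p x t) (x - p))
    (fun s => F (p + s *: (x - p))) 0 1 ltr01
    (@radial_within _ _ p r 0 _ _ (smooth_on_diff _ sF) Ux).
  move=> FTC.
  suff -> : LL (x - p) = F x - F p by rewrite addrC subrK.
  transitivity (fine ((F (p + 1 *: (x - p)))%:E - (F (p + 0 *: (x - p)))%:E)%E).
    rewrite -FTC //; clear FTC.
    + split.
    * move=> t; rewrite in_itv /= => /andP[t0 t1].
      by have [] := dphi t; rewrite ?ltW.
    * by apply: cvg_at_right_filter; apply: cphi; rewrite lexx ler01.
    * by apply: cvg_at_left_filter; apply: cphi; rewrite lexx ler01.
    + move=> t; rewrite in_itv /= => /andP[t0 t1].
      rewrite derive1E expr0 mul1r.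
      by have [] := dphi t; rewrite ?ltW.
  by rewrite /= scale1r scale0r addr0 [p + (x - p)]addrC subrK.
- move=> i; rewrite /mean -[RHS]Rintegral01_cst; apply: eq_Rintegral => t _.
  by rewrite expr0 mul1r /radial subrr scaler0 addr0.
Qed.

End Hadamard.

(** * Smooth functions and derivations on a manifold *)

Section ManifoldLocal.
Context {R : realType} {n : nat} {M : manifold R n}.
Local Notation charts := (atlas (msmooth M)).
Local Notation mopen := (atlas_open charts).

Lemma open_preimage_on (V W : normedModType R) (U : set V) (B : set W) (g : V -> W) :
  open U -> open B -> (forall x, U x -> {for x, continuous g}) ->
  open (U `&` g @^-1` B).
Proof.
move=> oU oB cg; rewrite openE => x [Ux Bx]; rewrite /interior.
apply: (@filterI _ _ (nbhs_filter x)); first exact: open_nbhs_nbhs.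
apply: (cg x Ux); exact: open_nbhs_nbhs.
Qed.

Lemma transition_continuous (c d : chart R n M) x : charts c -> charts d ->
  (c @` (chart_dom c `&` chart_dom d)) x ->
  {for x, continuous (fun y => d (chart_inv c y))}.
Proof.
move=> Ac Ad Ux; apply: differentiable_continuous.
have [_ sU] := atlas_compatible Ac Ad.
apply: (row_differentiable _).1 => i.
exact: (smooth_on_differentiable (sU i)).
Qed.

Lemma mopen_chart (c : chart R n M) V : charts c -> open V ->
  mopen [set x | chart_dom c x /\ V (c x)].
Proof.
move=> Ac oV d Ad.
rewrite (_ : _ @` _ = d @` (chart_dom d `&` chart_dom c) `&`
    (fun y => c (chart_inv d y)) @^-1` V).
  have [oU _] := atlas_compatible Ad Ac.
  by apply: open_preimage_on => // x; exact: transition_continuous.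
apply/seteqP; split=> [_ [x [[cx Vx] dx] <-]|_ [[x [dx cx] <-]] /=].
  by split; [exists x|rewrite /= (chartK dx)].
by rewrite (chartK dx) => Vx; exists x.
Qed.

Lemma mopenI A B : mopen A -> mopen B -> mopen (A `&` B).
Proof.
move=> oA oB c Ac; have := openI (oA c Ac) (oB c Ac); congr open.
apply/seteqP; split=> [_ [[x [Ax cx] <-] [y [By cy]]]|_ [x [[Ax Bx] cx] <-]].
  move=> /(congr1 (chart_inv c)); rewrite !chartK // => yx; subst y.
  by exists x.
by split; exists x.
Qed.

Lemma mopenT : mopen setT.
Proof. by move=> c Ac; rewrite setTI; exact: chart_open. Qed.

Lemma mopen_image (c : chart R n M) A : charts c -> mopen A ->
  open (c @` (A `&` chart_dom c)).
Proof. by move=> Ac oA; exact: oA. Qed.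

Definition smooth_at (f : M -> R) (x : M) : Prop := exists (c : chart R n M) V,
  [/\ charts c, chart_dom c x, open V /\ V (c x), V `<=` c @` chart_dom c &
      smooth_on V (f \o chart_inv c)].

Lemma smooth_fun_at f : (forall x, smooth_at f x) -> smooth_fun f.
Proof.
move=> h d Ad; apply/smooth_on_point => _ [x dx <-].
have [c [V [Ac cx [oV Vx] sV sf]]] := h x.
pose W := d @` ([set x | chart_dom c x /\ V (c x)] `&` chart_dom d).
have oW : open W by apply: mopen_chart.
apply: (@smooth_on_sub _ _ W); first by move=> _ ->; exists x.
apply: (@smooth_on_eq _ _ _ ((f \o chart_inv c) \o (fun y => c (chart_inv d y)))) => //.
  by move=> _ [y [[cy Vy] dy] <-]; rewrite /= (chartK dy) (chartK cy).
apply: smooth_on_comp sf => //.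
  by move=> _ [y [[cy Vy] dy] <-]; rewrite (chartK dy).
move=> i; have [_ sU] := atlas_compatible Ad Ac.
by apply: smooth_on_sub (sU i) => _ [y [[cy Vy] dy] <-]; exists y.
Qed.

Lemma smooth_at_open f g A x : mopen A -> A x -> (forall y, A y -> f y = g y) ->
  smooth_fun g -> smooth_at f x.
Proof.
move=> oA Ax fg sg; have [c Ac cx] := atlas_cover (msmooth M) x.
exists c, (c @` (A `&` chart_dom c)); split=> //.
- by split; [exact: mopen_image|exists x].
- by move=> _ [y [_ cy] <-]; exists y.
- apply: (@smooth_on_eq _ _ _ (g \o chart_inv c)); first exact: mopen_image.
    by move=> _ [y [Ay cy] <-] /=; rewrite (chartK cy) fg.
  by apply: smooth_on_sub (sg c Ac) => _ [y [_ cy] <-]; exists y.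
Qed.

Lemma smooth_chart_continuous (f : Cinf M) (c : chart R n M) y : charts c ->
  (c @` chart_dom c) y -> {for y, continuous (f \o chart_inv c)}.
Proof. by move=> Ac cy; exact: (CinfP f Ac 0%N). Qed.

Lemma mopen_Cinf (f : Cinf M) (B : set R) : open B -> mopen [set x | B (f x)].
Proof.
move=> oB c Ac.
rewrite (_ : _ @` _ = c @` chart_dom c `&` (f \o chart_inv c) @^-1` B).
  apply: (@open_preimage_on _ R^o); [exact: chart_open|exact: oB|].
  by move=> y cy; exact: smooth_chart_continuous.
apply/seteqP; split=> [_ [x [Bx cx] <-]|_ [[x cx <-]] /=].
  by split; [exists x|rewrite /= (chartK cx)].
by rewrite (chartK cx) => Bx; exists x.
Qed.

Lemma open_neq0 : open [set x : R | x != 0].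
Proof.
have -> : [set x : R | x != 0] = ~` [set 0].
  by apply/seteqP; split=> x /=; [move/eqP|move=> h; apply/eqP].
by apply: closed_openC; apply: accessible_closed_set1; apply: hausdorff_accessible.
Qed.

Lemma smooth_fun_loc (f : M -> R) :
  (forall x, exists2 psi : Cinf M, psi x != 0 & smooth_fun (fun y => psi y * f y)) ->
  smooth_fun f.
Proof.
move=> h; apply: smooth_fun_at => x; have [psi px sf] := h x.
have [c Ac cx] := atlas_cover (msmooth M) x.
pose A := [set x | psi x != 0].
have oA : mopen A by apply: (@mopen_Cinf psi [set r | r != 0]); exact: open_neq0.
exists c, (c @` (A `&` chart_dom c)); split=> //.
- by split; [exact: mopen_image|exists x].
- by move=> _ [y [_ cy] <-]; exists y.
have oV := mopen_image Ac oA.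
apply: (@smooth_on_eq _ _ _ (fun y =>
   ((fun y => psi y * f y) \o chart_inv c) y * ((psi \o chart_inv c) y)^-1)) => //.
  by move=> _ [y [Ay cy] <-] /=; rewrite (chartK cy) mulrC mulKf.
have sV : c @` (A `&` chart_dom c) `<=` c @` chart_dom c.
  by move=> _ [y [_ cy] <-]; exists y.
apply: smooth_onM => //; first exact: smooth_on_sub (sf c Ac).
apply: smooth_on_inv => //; last exact: smooth_on_sub (CinfP psi Ac).
by move=> _ [y [Ay cy] <-] /=; rewrite (chartK cy).
Qed.

End ManifoldLocal.

Section Bump.
Context {R : realType} {n : nat} {M : manifold R n}.
Local Notation charts := (atlas (msmooth M)).
Local Notation mopen := (atlas_open charts).

Definition bump (p : 'rV[R]_n) (r : R) (y : 'rV[R]_n) : R :=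
  \prod_i flat 0 (r ^+ 2 - (y 0 i - p 0 i) ^+ 2).

Lemma smooth_bump p r : smooth_on setT (bump p r).
Proof.
have oT := @openT 'rV[R]_n.
apply: smooth_on_prod => // i.
apply: (@smooth_comp1 _ _ setT setT
  (fun y : 'rV[R]_n => r ^+ 2 - (y 0 i - p 0 i) ^+ 2)) => //; last exact: smooth_flat.
have s1 : smooth_on setT (fun y : 'rV[R]_n => y 0 i - p 0 i).
  by apply: smooth_onD => //; [exact: smooth_on_coord|exact: smooth_on_cst].
apply: smooth_onD => //; first exact: smooth_on_cst.
by apply: smooth_onN => //; apply: (@smooth_onM _ _ setT _ _ oT s1 s1).
Qed.

Lemma bump_ge0 p r y : 0 <= bump p r y.
Proof. by apply: prodr_ge0 => i _; exact: flat_ge0. Qed.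

Lemma bump_center p r : 0 < r -> bump p r p != 0.
Proof.
move=> r0; apply/prodf_neq0 => i _.
by rewrite subrr expr0n subr0 gt_eqF // flat_gt0 // exprn_gt0.
Qed.

Lemma bump_support p r y : 0 < r -> bump p r y != 0 -> `|p - y| <= r.
Proof.
move=> r0 /prodf_neq0 h; rewrite [leLHS]/Num.norm /= mx_normrE.
apply/bigmax_leP; split; first exact: ltW.
move=> -[i j] _ /=; rewrite !mxE ord1 distrC.
have [l|l] := leP (r ^+ 2) ((y 0 j - p 0 j) ^+ 2).
  by have := h j isT; rewrite flat_le0 ?eqxx // subr_le0.
rewrite -(@ler_pXn2r _ 2) ?nnegrE //; last exact: ltW.
by rewrite real_normK ?num_real // ltW.
Qed.

Lemma bump_exists (c : chart R n M) A p : charts c -> chart_dom c p ->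
  mopen A -> A p -> exists psi : Cinf M,
  [/\ psi p = 1, forall x, 0 <= psi x &
      forall x, (A x /\ chart_dom c x) \/
        exists B, [/\ mopen B, B x & forall y, B y -> psi y = 0]].
Proof.
move=> Ac cp oA Ap.
pose W := c @` (A `&` chart_dom c).
have oW : open W := mopen_image Ac oA.
have Wp : W (c p) by exists p.
have [e /= e0 eW] := (nbhs_ballP _ _).1 (open_nbhs_nbhs (conj oW Wp)).
pose r := e / 2; have r0 : 0 < r by rewrite divr_gt0.
pose K := [set y : 'rV[R]_n | `|c p - y| <= r].
have KW : K `<=` W.
  move=> y /= Ky; apply: eW; rewrite -ball_normE /=.
  by apply: le_lt_trans Ky _; rewrite /r gtr_pMr // invf_lt1 // ltr1n.
have cK : compact K.
  have -> : K = closed_ball_ Num.norm (c p) r by [].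
  apply: bounded_closed_compact; last exact: closed_closed_ball_.
  exists (`|c p| + r); split; first exact: num_real.
  move=> s Hs y /= Ky; apply: le_trans (ltW Hs).
  have -> : y = c p - (c p - y) by rewrite opprB addrC subrK.
  by apply: le_trans (ler_normB _ _) _; rewrite lerD2l.
pose psi0 (x : M) := if `[< chart_dom c x >] then bump (c p) r (c x) else 0.
have loc x : (A x /\ chart_dom c x) \/
    exists B, [/\ mopen B, B x & forall y, B y -> psi0 y = 0].
  have [h|nx] := pselect (A x /\ chart_dom c x); [by left|right].
  pose F : set_system M := [set D | exists B, [/\ mopen B, B x & B `<=` D]].
  have FF : Filter F.
    split.
    - by exists setT; split => //; exact: mopenT.
    - move=> D1 D2 [B1 [mB1 x1 s1]] [B2 [mB2 x2 s2]].
      exists (B1 `&` B2); split => //; first exact: mopenI.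
      by move=> z [] /s1 d1 /s2 d2.
    - by move=> D1 D2 s [B [mB xB sB]]; exists B; split => // z /sB; exact: s.
  move/compact_near_coveringP in cK.
  have := cK M F (fun z y => ~ (chart_dom c z /\ c z = y)) FF.
  case.
    move=> y Ky; have [q [Aq cq] qy] := KW y Ky.
    have xq : x <> q by move=> e1; apply: nx; rewrite e1.
    have [B1 [B2 [mB1 mB2 x1 q2 d12]]] := atlas_hausdorff (msmooth M) xq.
    exists (c @` (B2 `&` chart_dom c), B1); first split => /=.
    - apply: open_nbhs_nbhs; split; first exact: mopen_image.
      by exists q.
    - by exists B1; split.
    move=> [y' z] /= [[b [b2 cb] <-] z1] [cz ezb].
    have zb : z = b by rewrite -(chartK cz) ezb chartK.
    by have : (B1 `&` B2) z by [split => //; rewrite zb]; rewrite d12.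
  move=> B [oB Bx sB]; exists B; split => // y By.
  rewrite /psi0; case: asboolP => // cy; apply/eqP; apply: contraT => h.
  by have := sB y By (c y) (bump_support r0 h); case.
have s0 : smooth_fun psi0.
  apply: smooth_fun_at => x; case: (loc x) => [[Ax cx]|[B [oB Bx zB]]].
    exists c, (c @` chart_dom c); split => //.
      by split; [exact: chart_open|exists x].
    apply: (@smooth_on_eq _ _ _ (bump (c p) r)); first exact: chart_open.
      by move=> _ [z cz <-]; rewrite /= (chartK cz) /psi0 asboolT.
    by apply: smooth_on_sub (smooth_bump _ _).
  exact: (@smooth_at_open _ _ _ _ (fun=> 0) B x oB Bx zB (smooth_fun_cst 0)).
have p0 : psi0 p != 0 by rewrite /psi0 asboolT // bump_center.
have ps0 x : 0 <= psi0 x.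
  by rewrite /psi0; case: asboolP => // _; exact: bump_ge0.
exists (Ccst (psi0 p)^-1 * MkCinf s0); split => /=.
- by rewrite mulVf.
- by move=> x; rewrite mulr_ge0 // invr_ge0.
- move=> x; case: (loc x) => [|[B [oB Bx zB]]]; [by left|right].
  by exists B; split => // y /zB /= ->; rewrite mulr0.
Qed.

(* The support condition is phrased through multipliers [chi], so that closures
   of supports never have to be mentioned. *)
Definition bump_on (c : chart R n M) (A : set M) (psi : Cinf M) : Prop :=
  (forall x, 0 <= psi x) /\
  forall x, (A x /\ chart_dom c x) \/
    exists2 chi : Cinf M, chi x != 0 & forall y, chi y * psi y = 0.

Lemma bump_onP (c : chart R n M) A p : charts c -> chart_dom c p ->
  mopen A -> A p -> exists2 psi : Cinf M, psi p = 1 & bump_on c A psi.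
Proof.
move=> Ac cp oA Ap; have [psi [p1 ps ploc]] := bump_exists Ac cp oA Ap.
exists psi => //; split => // x; case: (ploc x) => [|[B [oB Bx zB]]]; [by left|right].
have [d Ad dx] := atlas_cover (msmooth M) x.
have [chi [c1 _ cloc]] := bump_exists Ad dx oB Bx.
exists chi => [|y]; first by rewrite c1 oner_neq0.
case: (cloc y) => [[By _]|[D [_ Dy zD]]]; first by rewrite zB ?mulr0.
by rewrite zD // mul0r.
Qed.

Lemma bump_on_out c A psi x : bump_on c A psi -> ~ (A x /\ chart_dom c x) ->
  psi x = 0.
Proof.
move=> [_ h] nx; case: (h x) => // -[chi cx /(_ x)/eqP].
by rewrite mulf_eq0 (negbTE cx) => /eqP.
Qed.

Lemma bump_mul c A psi (h : 'rV[R]_n -> R) : charts c -> mopen A ->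
  bump_on c A psi -> smooth_on (c @` (A `&` chart_dom c)) h ->
  smooth_fun (fun x => psi x * h (c x)).
Proof.
move=> Ac oA [_ bs] sh; apply: smooth_fun_at => x.
case: (bs x) => [[Ax cx]|[chi cx z]].
  have oV := mopen_image Ac oA.
  exists c, (c @` (A `&` chart_dom c)); split=> //.
  - by split => //; exists x.
  - by move=> _ [y [_ cy] <-]; exists y.
  apply: (@smooth_on_eq _ _ _ (fun y => (psi \o chart_inv c) y * h y)) => //.
    by move=> _ [y [Ay cy] <-] /=; rewrite (chartK cy).
  apply: smooth_onM => //; apply: smooth_on_sub (CinfP psi Ac).
  by move=> _ [y [_ cy] <-]; exists y.
apply: (@smooth_at_open _ _ _ _ (fun=> 0) [set x | chi x != 0] x) => //.
- by apply: (@mopen_Cinf _ _ _ chi [set r | r != 0]); exact: open_neq0.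
- move=> y /= cy; have /eqP := z y; rewrite mulf_eq0 (negbTE cy) /= => /eqP ->.
  by rewrite mul0r.
- exact: smooth_fun_cst.
Qed.

End Bump.

Section Evaluation.
Context {R : realType} {n : nat} {M : manifold R n} {V : bundle M}.
Implicit Types (s t : section V).

Lemma secDE s t x : (s + t) x = s x + t x. Proof. by []. Qed.

Lemma secZE (f : Cinf M) s x : (f *: s) x = f x *: s x. Proof. by []. Qed.

Lemma secNE s x : (- s) x = - s x.
Proof. by rewrite -[LHS]/((-1) *: s x) scaleN1r. Qed.

Lemma secBE s t x : (s - t) x = s x - t x.
Proof. by rewrite secDE secNE. Qed.

Lemma sec_sumE (I : Type) (r : seq I) (P : pred I) (F : I -> section V) x :
  (\sum_(i <- r | P i) F i) x = \sum_(i <- r | P i) F i x.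
Proof. exact: (big_morph (fun s : section V => s x)). Qed.

Context {x : M}.
Implicit Types v w : tangent x.

Lemma tanDE v w f : (v + w) f = v f + w f. Proof. by []. Qed.

Lemma tanZE a v f : (a *: v) f = a * v f. Proof. by []. Qed.

Lemma tanNE v f : (- v) f = - v f.
Proof. by rewrite -[LHS]/(-1 * v f) mulN1r. Qed.

Lemma tanBE v w f : (v - w) f = v f - w f.
Proof. by rewrite tanDE tanNE. Qed.

Lemma tan_sumE (I : Type) (r : seq I) (P : pred I) (F : I -> tangent x) f :
  (\sum_(i <- r | P i) F i) f = \sum_(i <- r | P i) F i f.
Proof. exact: (big_morph (fun v : tangent x => v f)). Qed.

End Evaluation.

Section BundleMorphisms.
Context {R : realType} {n : nat} {M : manifold R n} {V W : bundle M}.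
Implicit Types phi psi : vbmor V W.

Lemma vbmor_ext phi psi :
  (forall m x, phi m x = psi m x) -> phi = psi.
Proof.
case: phi psi => [f fl fs] [g gl gs] /= e.
have {}e : f = g.
  by apply: functional_extensionality_dep => m; apply/funext => x.
by subst g; congr VBMor; apply: Prop_irrelevance.
Qed.

Lemma vbmorD phi m (x y : V m) : phi m (x + y) = phi m x + phi m y.
Proof. by have := vb_linear phi 1 x y; rewrite !scale1r. Qed.

Lemma vbmor0 phi m : phi m 0 = 0.
Proof. by apply: (addrI (phi m 0)); rewrite -vbmorD !addr0. Qed.

Lemma vbsec_lin phi f s t : vbsec phi (f *: s + t) = f *: vbsec phi s + vbsec phi t.
Proof. by apply: section_ext => m; apply: vb_linear. Qed.

Lemma vbsecD phi s t : vbsec phi (s + t) = vbsec phi s + vbsec phi t.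
Proof. by have := vbsec_lin phi 1 s t; rewrite !scale1r. Qed.

Lemma vbsec0 phi : vbsec phi 0 = 0.
Proof. by apply: section_ext => m; apply: vbmor0. Qed.

Lemma vbsecZ phi f s : vbsec phi (f *: s) = f *: vbsec phi s.
Proof. by have := vbsec_lin phi f s 0; rewrite vbsec0 !addr0. Qed.

Lemma vbsecN phi s : vbsec phi (- s) = - vbsec phi s.
Proof. by rewrite -scaleN1r vbsecZ scaleN1r. Qed.

Lemma vbsecK (j : vbmor V V) s : (forall m x, j m (j m x) = - x) ->
  vbsec j (vbsec j s) = - s.
Proof. by move=> j2; apply: section_ext => m; rewrite secNE /= j2. Qed.

End BundleMorphisms.

Section Derivations.
Context {R : realType} {n : nat} {M : manifold R n}.
Local Notation charts := (atlas (msmooth M)).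
Local Notation mopen := (atlas_open charts).
Implicit Types (f g : Cinf M) (x : M).

Lemma Csum_eval (I : Type) (r : seq I) (P : pred I) (F : I -> Cinf M) x :
  (\sum_(i <- r | P i) F i) x = \sum_(i <- r | P i) F i x.
Proof. exact: (big_morph (fun f : Cinf M => f x)). Qed.

Lemma Cprod_eval (I : Type) (r : seq I) (P : pred I) (F : I -> Cinf M) x :
  (\prod_(i <- r | P i) F i) x = \prod_(i <- r | P i) F i x.
Proof. exact: (big_morph (fun f : Cinf M => f x)). Qed.

Lemma tangentD x (v : tangent x) f g : v (f + g) = v f + v g.
Proof.
have := tangent_linear v 1 f g; rewrite mul1r => <-; congr (v _).
by apply: Cinf_ext => y /=; rewrite mul1r.
Qed.

Lemma tangent_cst x (v : tangent x) a : v (Ccst a) = 0.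
Proof.
have H : v (Ccst 1) = 0.
  have := tangent_leibniz v (Ccst 1) (Ccst 1).
  rewrite (_ : Ccst 1 * Ccst 1 = Ccst 1); last by apply: Cinf_ext => y /=; rewrite mulr1.
  by rewrite /= mul1r mulr1 => h; apply: (addrI (v (Ccst 1))); rewrite addr0 -h.
have V0 : v 0 = 0.
  apply: (addrI (v 0)); rewrite -tangentD [RHS]addr0; congr (v _).
  exact: addr0.
transitivity (a * v (Ccst 1) + v 0); last by rewrite H V0 mulr0 addr0.
rewrite -tangent_linear; congr (v _).
by apply: Cinf_ext => y /=; rewrite mulr1 addr0.
Qed.

Lemma tangent0 x (v : tangent x) : v 0 = 0.
Proof. exact: (tangent_cst v 0). Qed.

Lemma tangentZ x (v : tangent x) a f : v (Ccst a * f) = a * v f.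
Proof. by rewrite tangent_leibniz tangent_cst mul0r addr0. Qed.

Lemma tangentN x (v : tangent x) f : v (- f) = - v f.
Proof.
rewrite -[RHS]mulN1r -tangentZ; congr (v _).
by apply: Cinf_ext => y /=; rewrite mulN1r.
Qed.

Lemma tangent_sumE x (v : tangent x) (I : Type) (r : seq I) (P : pred I)
    (F : I -> Cinf M) :
  v (\sum_(i <- r | P i) F i) = \sum_(i <- r | P i) v (F i).
Proof. exact: (big_morph v (tangentD v) (tangent0 v)). Qed.

Definition dchart (c : chart R n M) (i : 'I_n) f x : R :=
  'd (f \o chart_inv c) (c x) (delta_mx 0 i).

Lemma dchart_differentiable (c : chart R n M) f x : charts c -> chart_dom c x ->
  differentiable (f \o chart_inv c) (c x).
Proof. by move=> Ac cx; apply: (smooth_on_differentiable (CinfP f Ac)); exists x. Qed.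

Lemma dchart_linear (c : chart R n M) i a f g x : charts c -> chart_dom c x ->
  dchart c i (Ccst a * f + g) x = a * dchart c i f x + dchart c i g x.
Proof.
move=> Ac cx.
have df := dchart_differentiable f Ac cx; have dg := dchart_differentiable g Ac cx.
have := diffD (differentiableZ a df) dg; rewrite (diffZ a df).
by move/(congr1 (fun L => L (delta_mx 0 i))).
Qed.

Lemma dchart_leibniz (c : chart R n M) i f g x : charts c -> chart_dom c x ->
  dchart c i (f * g) x = f x * dchart c i g x + dchart c i f x * g x.
Proof.
move=> Ac cx.
have df := dchart_differentiable f Ac cx; have dg := dchart_differentiable g Ac cx.
have /(congr1 (fun L => L (delta_mx 0 i))) := diffM df dg.
rewrite [in X in _ = X -> _]/= !fctE /= (chartK cx) => E.
by rewrite [LHS]E [dchart c i f x * _]mulrC.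
Qed.

(* Every coordinate function is only available after multiplication by some
   [psi], hence the division-free form. *)
Lemma tangent_chart (c : chart R n M) x (v : tangent x) (psi : Cinf M)
    (y : 'I_n -> Cinf M) f : charts c -> chart_dom c x ->
  (forall i z, chart_dom c z -> y i z = psi z * c z 0 i) ->
  psi x * v f = \sum_i (v (y i) - c x 0 i * v psi) * dchart c i f x.
Proof.
move=> Ac cx yE.
pose F := f \o chart_inv c.
have oW : open (c @` chart_dom c) by exact: chart_open.
have Wx : (c @` chart_dom c) (c x) by exists x.
have [r /= r0 rW] := (nbhs_ballP _ _).1 (open_nbhs_nbhs (conj oW Wx)).
have sF : smooth_on (ball (c x) r) F by apply: smooth_on_sub (CinfP f Ac).
have [g [sg Fg gx]] := hadamard r0 sF.
pose A := [set z | chart_dom c z /\ ball (c x) r (c z)].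
have oA : mopen A by apply: mopen_chart => //; exact: ball_open.
have Ax : A x by split => //; exact: ballxx.
have [th th1 thA] := bump_onP Ac cx oA Ax.
have sAW : c @` (A `&` chart_dom c) `<=` ball (c x) r by move=> _ [z [[_ ?] _] <-].
have sX i : smooth_fun (fun z => th z * (c z - c x) 0 i).
  apply: (bump_mul (h := fun w => (w - c x) 0 i) Ac oA thA).
  apply: (@smooth_on_eq _ _ _ (fun w : 'rV[R]_n => w 0 i - c x 0 i)).
  - exact: mopen_image.
  - by move=> w _; rewrite !mxE.
  - by apply: smooth_onD; [exact: mopen_image|exact: smooth_on_coord|exact: smooth_on_cst].
have sG i : smooth_fun (fun z => th z * g i (c z)).
  by apply: (bump_mul Ac oA thA); apply: smooth_on_sub (sg i).
pose X i := MkCinf (sX i); pose G i := MkCinf (sG i).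
have E1 : th * th * f = Ccst (f x) * (th * th) + \sum_i X i * G i.
  apply: Cinf_ext => z; rewrite /= Csum_eval /=.
  have [[Az cz]|nz] := pselect (A z /\ chart_dom c z); last first.
    rewrite (bump_on_out thA nz) !mul0r mulr0 add0r big1 // => i _.
    by rewrite !mul0r.
  have := Fg _ (sAW _ (ex_intro2 _ _ z (conj Az cz) erefl)).
  rewrite /F /= !chartK // => ->.
  rewrite mulrDr [_ * f x]mulrC mulr_sumr; congr (_ + _).
  by apply: eq_bigr => i _; ring.
have E2 : v f = \sum_i v (X i) * 'd F (c x) (delta_mx 0 i).
  have := congr1 v E1; rewrite tangentD tangentZ tangent_sumE.
  rewrite tangent_leibniz [v (th * th)]tangent_leibniz /= th1.
  have -> : \sum_i v (X i * G i) = \sum_i v (X i) * 'd F (c x) (delta_mx 0 i).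
    apply: eq_bigr => i _.
    by rewrite tangent_leibniz /= th1 subrr mxE mulr0 mul0r add0r mul1r gx.
  by move=> h; apply: (addrI (f x * (1 * v th + v th * 1))); rewrite -h; ring.
have E3 i : v (y i) - c x 0 i * v psi = psi x * v (X i).
  have Ei : th * y i = psi * (X i + Ccst (c x 0 i) * th).
    apply: Cinf_ext => z /=.
    have [[Az cz]|nz] := pselect (A z /\ chart_dom c z); last first.
      by rewrite (bump_on_out thA nz) !mul0r mulr0 addr0 mulr0.
    by rewrite yE // !mxE; ring.
  have := congr1 v Ei; rewrite !tangent_leibniz tangentD tangentZ /=.
  rewrite th1 subrr mxE mulr0 add0r mulr1 mul1r (yE i x cx) => h.
  apply: (addIr (v th * (psi x * c x 0 i))).
  by rewrite addrAC h; ring.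
rewrite E2 mulr_sumr; apply: eq_bigr => i _.
by rewrite E3 mulrA.
Qed.

Lemma tangent_frame_of (c : chart R n M) p (psi : Cinf M)
    (y : 'I_n -> Cinf M) : charts c -> chart_dom c p -> psi p != 0 ->
  (forall i z, chart_dom c z -> y i z = psi z * c z 0 i) ->
  exists (chi : Cinf M) (X : 'I_n -> section (tangent_bundle M))
    (X0 : section (tangent_bundle M)), chi p != 0 /\
    forall x (v : tangent x) f,
      chi x * v f = \sum_i v (y i) * X i x f + v psi * X0 x f.
Proof.
move=> Ac cp psp yE.
have [th th1 thA] := bump_onP Ac cp mopenT I.
have oW : open (c @` (setT `&` chart_dom c)) by apply: mopen_image => //; exact: mopenT.
pose D i f x := th x * dchart c i f x.
have out x : ~ chart_dom c x -> th x = 0.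
  by move=> nx; apply: (bump_on_out thA) => -[].
have Dlin i x a f g : D i (Ccst a * f + g) x = a * D i f x + D i g x.
  rewrite /D; have [cx|/out ->] := pselect (chart_dom c x).
    rewrite dchart_linear //.
    by move: (dchart c i f x) (dchart c i g x) (th x) => A B t; ring.
  by move: (dchart c i f x) (dchart c i g x) (dchart c i _ x) => A B C; ring.
have Dlei i x f g : D i (f * g) x = f x * D i g x + D i f x * g x.
  rewrite /D; have [cx|/out ->] := pselect (chart_dom c x).
    rewrite dchart_leibniz //.
    move: (dchart c i f x) (dchart c i g x) (th x) (f x) (g x) => A B t a b.
    by ring.
  move: (dchart c i f x) (dchart c i g x) (dchart c i _ x) (f x) (g x) => A B C a b.
  by ring.
pose X i x : tangent x := Tangent (Dlin i x) (Dlei i x).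
have sD i f : smooth_fun (D i f).
  apply: (bump_mul (h := fun w => 'd (f \o chart_inv c) w (delta_mx 0 i)) Ac mopenT thA).
  apply: smooth_on_diff; apply: smooth_on_sub (CinfP f Ac).
  by move=> _ [z [_ cz] <-]; exists z.
pose SX i : section (tangent_bundle M) := MkSection (V := tangent_bundle M) (secf := X i) (sD i).
have sC i : smooth_fun (fun z => th z * c z 0 i).
  by apply: (bump_mul (h := fun w => w 0 i) Ac mopenT thA); exact: smooth_on_coord.
pose C i := MkCinf (sC i).
exists (th * th * psi), (fun i => th *: SX i), (\sum_i (- C i) *: SX i); split.
  by rewrite /= th1 !mul1r.
move=> x v f /=; rewrite sec_sumE tan_sumE.
have [cx|/out thx] := pselect (chart_dom c x); last first.
  rewrite thx !mul0r !big1 ?mulr0 ?addr0 // => i _.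
    by rewrite -[LHS]/(- (th x * c x 0 i) * (th x * dchart c i f x)) thx !mul0r mulr0.
  by rewrite mul0r mulr0.
rewrite -[_ * psi x * _]mulrA (tangent_chart v f Ac cx yE) !mulr_sumr -big_split /=.
apply: eq_bigr => i _.
rewrite /D.
move: (th x) (v (y i)) (v psi) (c x 0 i) (dchart c i f x) => t a b d A.
by ring.
Qed.

End Derivations.

Section Frames.
Context {R : realType} {n : nat} {M : manifold R n}.
Local Notation charts := (atlas (msmooth M)).
Local Notation mopen := (atlas_open charts).

Lemma tangent_frame_sum (c : chart R n M) p (psi : Cinf M)
    (y : 'I_n -> Cinf M) (P : Cinf M -> Prop) :
  charts c -> chart_dom c p -> psi p != 0 ->
  (forall i z, chart_dom c z -> y i z = psi z * c z 0 i) ->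
  P psi -> (forall i, P (y i)) ->
  exists (I : finType) (chi : Cinf M) (F : I -> Cinf M)
    (X : I -> section (tangent_bundle M)),
  [/\ chi p != 0, forall i, P (F i) & forall x (v : tangent x) f,
      chi x * v f = \sum_i v (F i) * X i x f].
Proof.
move=> Ac cp pp yE Pp Py.
have [chi [X [X0 [cp0 E]]]] := tangent_frame_of Ac cp pp yE.
exists ('I_n + unit)%type, chi,
  (fun i => match i with inl i => y i | inr _ => psi end),
  (fun i => match i with inl i => X i | inr _ => X0 end); split => //.
  by case.
move=> x v f; rewrite E big_sumType /=; congr (_ + _).
by rewrite (big_pred1 tt) //; case.
Qed.

Lemma tangent_frame (p : M) :
  exists (I : finType) (chi : Cinf M) (F : I -> Cinf M)
    (X : I -> section (tangent_bundle M)),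
  chi p != 0 /\ forall x (v : tangent x) f,
      chi x * v f = \sum_i v (F i) * X i x f.
Proof.
have [c Ac cp] := atlas_cover (msmooth M) p.
have [psi p1 pA] := bump_onP Ac cp mopenT I.
have sy i : smooth_fun (fun z => psi z * c z 0 i).
  by apply: (bump_mul (h := fun w => w 0 i) Ac mopenT pA); exact: smooth_on_coord.
have pn : psi p != 0 by rewrite p1 oner_neq0.
have [I0 [chi [F [X [c0 _ E]]]]] := @tangent_frame_sum c p psi
  (fun i => MkCinf (sy i)) (fun=> True) Ac cp pn (fun _ _ _ => erefl) I (fun=> I).
by exists I0, chi, F, X.
Qed.

Lemma smooth_flat_comp m (f : Cinf M) : smooth_fun (fun x => flat m (f x)).
Proof.
move=> c Ac; apply: (@smooth_comp1 _ _ _ setT (f \o chart_inv c)) => //.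
- exact: chart_open.
- exact: CinfP.
- exact: smooth_flat.
Qed.

Definition Cflat m (f : Cinf M) : Cinf M := MkCinf (smooth_flat_comp m f).

(* The i-th function is cut off where one of its predecessors exceeds 1/(i+1);
   this makes a countable cover locally finite without any compactness. *)
Lemma locally_finite_cover (chi : M -> Cinf M) (p0 : M) :
  (forall p x, 0 <= chi p x) -> (forall p, chi p p != 0) ->
  exists (q : nat -> M) (phi : nat -> Cinf M),
  [/\ forall i x, 0 <= phi i x,
      forall x, exists i, phi i x * chi (q i) x != 0 &
      forall x, exists2 g : Cinf M, g x != 0 &
        exists K, forall i y, (K <= i)%N -> g y * phi i y = 0].
Proof.
move=> chi0 chip.
have [B oB bB] := atlas_second_countable (msmooth M).
pose U p := [set x | chi p x != 0].
have oU p : mopen (U p).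
  by apply: (@mopen_Cinf _ _ _ (chi p) [set r | r != 0]); exact: open_neq0.
have /choice[q qP] : forall i, exists p, (exists p', B i `<=` U p') -> B i `<=` U p.
  by move=> i; have [[p' h]|h] := pselect (exists p', B i `<=` U p'); [exists p'|exists p0].
have cover x : exists i, chi (q i) x != 0.
  have [i Bx BU] := bB _ x (oU x) (chip x).
  by exists i; apply: (qP i _ x Bx); exists x.
pose phi i := \prod_(j < i) Cflat 0 (Ccst (i.+1)%:R^-1 - chi (q j)).
have phiE i x : phi i x = \prod_(j < i) flat 0 ((i.+1)%:R^-1 - chi (q j) x).
  by rewrite Cprod_eval.
exists q, phi; split.
- by move=> i x; rewrite phiE; apply: prodr_ge0 => j _; exact: flat_ge0.
- move=> x; have [i ci mi] := ex_minnP (cover x).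
  exists i; rewrite mulf_neq0 // phiE; apply/prodf_neq0 => j _.
  have -> : chi (q j) x = 0.
    by apply/eqP; apply: contraTT (ltn_ord j) => /mi; rewrite -leqNgt.
  by rewrite subr0 gt_eqF // flat_gt0 // invr_gt0 ltr0Sn.
- move=> x; have [a ca] := cover x.
  pose d := chi (q a) x / 2.
  have d0 : 0 < d by rewrite divr_gt0 // lt_def ca chi0.
  exists (Cflat 0 (chi (q a) - Ccst d)) => /=.
    rewrite gt_eqF // flat_gt0 // {1}(splitr (chi (q a) x)) -/d.
    by rewrite -addrA subrr addr0.
  have [K Kd] : exists K : nat, d^-1 < K%:R.
    by exists (Num.truncn d^-1).+1; rewrite truncnS_gt.
  exists (maxn a.+1 K) => i y; rewrite geq_max => /andP[ai Ki].
  have [ly|ly] := leP (chi (q a) y) d.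
    by rewrite flat_le0 ?mul0r // subr_le0.
  rewrite phiE (bigD1 (Ordinal ai)) //=.
  suff -> : flat 0 (i.+1%:R^-1 - chi (q a) y) = 0 by rewrite mul0r mulr0.
  apply: flat_le0; rewrite subr_le0; apply: le_trans (ltW ly).
  rewrite -[leRHS]invrK lef_pV2 ?posrE ?ltr0Sn ?invr_gt0 //.
  apply: le_trans (ltW Kd) _; rewrite ler_nat.
  exact: leq_trans Ki (leqnSn _).
Qed.

Lemma small_curve (e : R) : 0 < e -> exists eta : R -> R,
  [/\ eta 0 = 0, forall t, `|eta t| < e, smooth_on (setT : set R^o) eta &
      is_derive (0 : R) (1 : R) eta 1].
Proof.
move=> e0; pose r := e / 2; have r0 : 0 < r by rewrite divr_gt0.
pose b (t : R) := flat 0 (r ^+ 2 - t ^+ 2) / flat 0 (r ^+ 2).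
have f0 : 0 < flat 0 (r ^+ 2) by rewrite flat_gt0 // exprn_gt0.
have oT := @openT R^o.
have sid : smooth_on (setT : set R^o) (fun t : R^o => t : R).
  move=> [|k]; first by move=> x _; exact: cvg_id.
  have di (x : R^o) : is_diff x (fun t : R^o => t : R^o) id by exact: is_diff_id.
  split=> [x _|v]; first by have [] := di x.
  apply: (@Ck_on_eq _ _ _ _ (fun=> v)) => //; last exact: Ck_on_cst.
  by move=> x _; have [_ ->] := di x.
have sb : smooth_on (setT : set R^o) b.
  apply: smooth_onM => //; last exact: smooth_on_cst.
  apply: (@smooth_comp1 _ _ setT setT (fun t : R^o => r ^+ 2 - t ^+ 2)) => //;
    last exact: smooth_flat.
  apply: smooth_onD => //; first exact: smooth_on_cst.
  by apply: smooth_onN => //; apply: (@smooth_onM _ _ setT _ _ oT sid sid).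
exists (fun t => t * b t); split.
- by rewrite mul0r.
- move=> t.
  have b0 : 0 <= b t by rewrite divr_ge0 ?flat_ge0.
  have [tr|tr] := leP (r ^+ 2) (t ^+ 2).
    by rewrite /b flat_le0 ?subr_le0 // mul0r mulr0 normr0.
  have tr' : `|t| < r.
    rewrite -(@ltr_pXn2r _ 2) ?nnegrE //; last exact: ltW.
    by rewrite real_normK ?num_real.
  have b1 : b t <= 1.
    rewrite ler_pdivrMr // mul1r /flat subr_gt0 tr exprn_gt0 // !expr0 !mul1r.
    rewrite ler_expR lerN2 lef_pV2 ?posrE ?subr_gt0 ?exprn_gt0 //.
    by rewrite lerBlDr lerDl sqr_ge0.
  rewrite normrM (ger0_norm b0); apply: (@le_lt_trans _ _ r).
    by rewrite -[leRHS]mulr1; apply: ler_pM => //; rewrite ltW.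
  by rewrite /r gtr_pMr // invf_lt1 // ltr1n.
- exact: (@smooth_onM _ _ setT _ _ oT sid sb).
- have db : is_derive (0 : R) (1 : R) b ('D_1 b 0).
    apply/derivableP; apply: diff_derivable.
    exact: (smooth_on_differentiable sb).
  have := is_deriveM (is_derive_id (0 : R) (1 : R)) db.
  move=> h; apply: (is_derive_eq h).
  rewrite /= scale0r add0r /b expr0n subr0 divff ?gt_eqF //.
  by rewrite /GRing.scale /= mulr1.
Qed.

End Frames.

(** * Framed bundles *)

Section FramedBundles.
Context {R : realType} {n : nat} {M : manifold R n}.

Lemma dual_lin0 (V : lmodType R) (f : dual V) : f 0 = 0.
Proof. by have := dual_linear f (-1) 0 0; rewrite scaler0 addr0 mulN1r addNr. Qed.

Lemma dual_linD (V : lmodType R) (f : dual V) x y : f (x + y) = f x + f y.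
Proof. by have := dual_linear f 1 x y; rewrite scale1r mul1r. Qed.

Lemma dual_linZ (V : lmodType R) (f : dual V) a x : f (a *: x) = a * f x.
Proof. by have := dual_linear f a x 0; rewrite addr0 dual_lin0 addr0. Qed.

Lemma dual_linN (V : lmodType R) (f : dual V) x : f (- x) = - f x.
Proof. by rewrite -scaleN1r dual_linZ mulN1r. Qed.

Lemma dual_linB (V : lmodType R) (f : dual V) x y : f (x - y) = f x - f y.
Proof. by rewrite dual_linD dual_linN. Qed.

Lemma dual_lin_sum (V : lmodType R) (f : dual V) (I : Type) (r : seq I)
    (P : pred I) (F : I -> V) :
  f (\sum_(i <- r | P i) F i) = \sum_(i <- r | P i) f (F i).
Proof. exact: (big_morph f (dual_linD f) (dual_lin0 f)). Qed.

Lemma dual_sumE (V : lmodType R) (I : Type) (r : seq I)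
    (P : pred I) (F : I -> dual V) x :
  (\sum_(i <- r | P i) F i) x = \sum_(i <- r | P i) F i x.
Proof. exact: (big_morph (fun f : dual V => f x)). Qed.

Lemma dualNE (V : lmodType R) (f : dual V) x : (- f) x = - f x.
Proof. by rewrite -[LHS]/(-1 * f x) mulN1r. Qed.

Lemma dualDE (V : lmodType R) (f g : dual V) x : (f + g) x = f x + g x.
Proof. by []. Qed.

Lemma dualZE (V : lmodType R) a (f : dual V) x : (a *: f) x = a * f x.
Proof. by []. Qed.

Lemma dualBE (V : lmodType R) (f g : dual V) x : (f - g) x = f x - g x.
Proof. by rewrite dualDE dualNE. Qed.

(* Near p every section is a combination of the [s i] with smooth coefficients;
   the cut-off [chi] makes this meaningful for global sections. *)
Definition framed (V : bundle M) : Prop := forall p : M,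
  exists (I : finType) (chi : Cinf M) (a : I -> forall z, dual (V z))
    (s : I -> section V),
  [/\ chi p = 1, forall i (t : section V), smooth_fun (fun z => a i z (t z)) &
      forall z y, chi z *: y = \sum_i a i z y *: s i z].

Lemma framed_ext (V : bundle M) : framed V ->
  forall (p : M) (y : V p), exists s : section V, s p = y.
Proof.
move=> fV p y; have [I [chi [a [s [c1 _ E]]]]] := fV p.
exists (\sum_i Ccst (a i p y) *: s i).
by rewrite sec_sumE -[RHS]scale1r -c1 E.
Qed.

Lemma framed_rep (V : bundle M) (F : section V -> Cinf M) : framed V ->
  (forall (f : Cinf M) s t, F (f *: s + t) = f * F s + F t) ->
  exists eps : forall z, dual (V z), forall s z, F s z = eps z (s z).
Proof.
move=> fV Flin.
have F0 : F 0 = 0.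
  have h : F 0 + F 0 = F 0.
    by rewrite -[X in X + _]mul1r -Flin; congr F; rewrite scaler0 addr0.
  by apply: (addrI (F 0)); rewrite h addr0.
have FD s t : F (s + t) = F s + F t.
  by have := Flin 1 s t; rewrite scale1r mul1r.
have FZ f s : F (f *: s) = f * F s.
  by have := Flin f s 0; rewrite addr0 F0 addr0.
suff H z : exists eps : dual (V z), forall s, F s z = eps (s z).
  by exists (fun z => projT1 (cid (H z))) => t z; case: (cid (H z)).
have [I [chi [a [s [c1 sa E]]]]] := fV z.
exists (\sum_i F (s i) z *: a i z) => t.
have -> : F t z = (chi * F t) z by rewrite /= c1 mul1r.
rewrite -FZ.
have -> : chi *: t = \sum_i MkCinf (sa i t) *: s i.
  by apply: section_ext => w; rewrite sec_sumE /= E.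
rewrite (big_morph F FD F0) Csum_eval dual_sumE.
by apply: eq_bigr => i _; rewrite FZ /= mulrC.
Qed.

Lemma framed_bidual (V : bundle M) (p : M) (L : dual (dual (V p))) : framed V ->
  exists v : V p, forall eta, L eta = eta v.
Proof.
move=> fV; have [I [chi [a [s [c1 sa E]]]]] := fV p.
exists (\sum_i L (a i p) *: s i p) => eta.
have {1}-> : eta = \sum_i eta (s i p) *: a i p.
  apply: dual_ext => y; rewrite dual_sumE -[y in LHS]scale1r -c1 E.
  rewrite !dual_lin_sum; apply: eq_bigr => i _.
  by rewrite dual_linZ dualZE mulrC.
rewrite !dual_lin_sum; apply: eq_bigr => i _.
by rewrite !dual_linZ mulrC.
Qed.

End FramedBundles.

Section FramedInstances.
Context {R : realType} {n : nat} (M : manifold R n).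
Local Notation TM := (tangent_bundle M).
Local Notation TsM := (cotangent_bundle M).

Lemma tangent_frame1 (p : M) :
  exists (I : finType) (chi : Cinf M) (F : I -> Cinf M) (X : I -> section TM),
  chi p = 1 /\ forall x (v : tangent x),
      chi x *: v = \sum_i v (F i) *: (X i x : tangent x).
Proof.
have [I [chi [F [X [c0 E]]]]] := tangent_frame p.
exists I, (Ccst (chi p)^-1 * chi), F, (fun i => Ccst (chi p)^-1 *: X i).
split; first by rewrite /= mulVf.
move=> x v; apply: tangent_ext => f.
rewrite tan_sumE tanZE /= -mulrA E mulr_sumr.
by apply: eq_bigr => i _; rewrite mulrCA.
Qed.

Lemma framed_tangent : framed TM.
Proof.
move=> p; have [I [chi [F [X [c1 E]]]]] := tangent_frame1 p.
exists I, chi, (fun i z => covec (F i) z), X; split => // i t.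
exact: (secP t (F i)).
Qed.

Definition eval_dual (V : lmodType R) (v : V) : dual (dual V).
Proof.
exists (fun f : dual V => f v) => a f g.
by rewrite dualDE dualZE.
Defined.

Lemma framed_cotangent : framed TsM.
Proof.
move=> p; have [I [chi [F [X [c1 E]]]]] := tangent_frame1 p.
exists I, chi, (fun i z => eval_dual (X i z)), (fun i => dform (F i)).
split => // [i t|z th]; first exact: (secP t (X i)).
apply: dual_ext => v; rewrite dualZE dual_sumE -dual_linZ E dual_lin_sum.
by apply: eq_bigr => i _; rewrite dual_linZ dualZE /= mulrC.
Qed.

Definition dual_fst (V W : lmodType R) (f : dual V) : dual (V * W : lmodType R)%type.
Proof. by exists (fun x => f x.1) => a x y /=; rewrite dual_linear. Defined.

Definition dual_snd (V W : lmodType R) (f : dual W) : dual (V * W : lmodType R)%type.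
Proof. by exists (fun x => f x.2) => a x y /=; rewrite dual_linear. Defined.

Lemma framed_bsum (V W : bundle M) : framed V -> framed W -> framed (bsum V W).
Proof.
move=> fV fW p.
have [I [chi [a [s [c1 sa Ea]]]]] := fV p.
have [J [chi' [b [t [c1' sb Eb]]]]] := fW p.
exists (I + J)%type, (chi * chi'),
  (fun i z => match i with
     | inl i => dual_fst (W z) (chi' z *: a i z)
     | inr j => dual_snd (V z) (chi z *: b j z) end),
  (fun i => match i with inl i => spair (s i) 0 | inr j => spair 0 (t j) end).
split.
- by rewrite /= c1 c1' mulr1.
- move=> [i|j] u /=.
    exact: (smooth_funM (CinfP chi') (sa i (sfst u))).
  exact: (smooth_funM (CinfP chi) (sb j (ssnd u))).
- move=> z [y w] /=; rewrite big_sumType /=.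
  rewrite (_ : (chi z * chi' z) *: (y, w) = ((chi z * chi' z) *: y, (chi z * chi' z) *: w)) //.
  rewrite mulrC -scalerA Ea [_ * chi z]mulrC -scalerA Eb !scaler_sumr.
  pose l (x : V z) : (V z * W z)%type := (x, 0); pose r (x : W z) : (V z * W z)%type := (0, x).
  have lD x1 x2 : l (x1 + x2) = l x1 + l x2 by congr pair; rewrite addr0.
  have rD x1 x2 : r (x1 + x2) = r x1 + r x2 by congr pair; rewrite addr0.
  transitivity (l (\sum_i chi' z *: (a i z y *: s i z)) +
      r (\sum_i chi z *: (b i z w *: t i z))).
    by congr pair; rewrite ?addr0 ?add0r.
  rewrite (big_morph l lD erefl) (big_morph r rD erefl).
  by congr (_ + _); apply: eq_bigr => i _; congr pair; rewrite /= ?scalerA ?scaler0.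
Qed.

End FramedInstances.

(** * The total space of a vector bundle *)

Section VectorBundle.
Context {R : realType} {n k : nat} {M : manifold R n} (E : vbundle M k).
Local Notation charts := (atlas (msmooth M)).
Local Notation vb := (vec_bundle E).
Local Notation db := (dual_bundle E).
Local Notation trivial := (trivialization (vstruct E)).

Section Trivialization.
Context (c : chart R n M) (t : forall m, E m -> 'rV[R]_k).
Context (Ac : charts c) (ht : trivial c t).

Definition tinv (z : M) (w : 'rV[R]_k) : E z := xget 0 [set y | t y = w].

Lemma tinvK z w : chart_dom c z -> t (tinv z w) = w.
Proof.
move=> cz; have [_ [g _ tg]] := ht.1 z cz.
rewrite /tinv; case: xgetP => // /(_ (g w)) []; exact: tg.
Qed.

Lemma triv_lin z : chart_dom c z -> linear (t (m := z)).
Proof. by move=> cz; have [] := ht.1 z cz. Qed.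

Lemma triv0 z : chart_dom c z -> t (0 : E z) = 0.
Proof.
by move=> cz; have := triv_lin cz (-1) 0 0; rewrite scaler0 addr0 scaleN1r addNr.
Qed.

Lemma trivD z (x y : E z) : chart_dom c z -> t (x + y) = t x + t y.
Proof. by move=> cz; have := triv_lin cz 1 x y; rewrite !scale1r. Qed.

Lemma trivZ z a (x : E z) : chart_dom c z -> t (a *: x) = a *: t x.
Proof. by move=> cz; have := triv_lin cz a x 0; rewrite addr0 triv0 // addr0. Qed.

Lemma triv_sum z (I : Type) (r : seq I) (F : I -> E z) : chart_dom c z ->
  t (\sum_(i <- r) F i) = \sum_(i <- r) t (F i).
Proof.
move=> cz; apply: (big_morph (t (m := z))); last exact: triv0.
by move=> x y; exact: trivD.
Qed.

Context (psi : Cinf M) (hpsi : bump_on c setT psi).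

Lemma psi_out z : ~ chart_dom c z -> psi z = 0.
Proof. by move=> nz; apply: (bump_on_out hpsi) => -[]. Qed.

Definition cut_coord_fun (a : 'I_k) (z : M) : dual (E z).
Proof.
exists (fun y => psi z * t y 0 a) => r x y.
have [cz|nz] := pselect (chart_dom c z).
  by rewrite triv_lin // !mxE mulrDr [r * (_ * _)]mulrCA.
by rewrite psi_out // !mul0r mulr0 addr0.
Defined.

Lemma smooth_cut_coord a : smooth_fun (lin_fun (cut_coord_fun a)).
Proof.
have [d [Ad dd dE]] := ht.2.
apply: smooth_fun_at => -[z y].
case: (hpsi.2 z) => [[_ cz]|[chi cx h]].
  have dz : chart_dom d (pt y) by rewrite dd.
  exists d, (d @` chart_dom d); split => //.
    by split; [exact: chart_open|exists (pt y)].
  apply: (@smooth_on_eq _ _ _ (fun w =>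
    (pull_proj E psi \o chart_inv d) w * w 0 (rshift n a))).
  - exact: chart_open.
  - by move=> _ [e de <-] /=; rewrite (chartK de) dE // row_mxEr.
  - apply: smooth_onM; [exact: chart_open| |exact: smooth_on_coord].
    exact: (CinfP (pull_proj E psi) Ad).
apply: (@smooth_at_open R _ (Defs.total E) _ (fun=> 0)
  [set e : Defs.total E | pull_proj E chi e != 0] (pt y)) => //.
- by apply: (@mopen_Cinf _ _ _ (pull_proj E chi) [set r | r != 0]); exact: open_neq0.
- move=> e /= ce; have /eqP := h (projT1 e).
  by rewrite mulf_eq0 (negbTE ce) /lin_fun /= => /eqP ->; rewrite mul0r.
- exact: smooth_fun_cst.
Qed.

Definition cut_coord a : section db := MkSection (V := db) (smooth_cut_coord a).

End Trivialization.

Lemma vec_smoothP (s : forall z, E z) :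
  (forall eps : section db, smooth_fun (fun z => eps z (s z))) ->
  @smooth_sec _ _ _ vb s.
Proof.
move=> h c t Ac ht i; apply/smooth_on_point => _ [z cz <-].
have [psi p1 pA] := bump_onP Ac cz mopenT I.
pose f := MkCinf (h (cut_coord ht pA i)).
have oA : atlas_open charts [set x | psi x != 0].
  by apply: (@mopen_Cinf _ _ _ psi [set r | r != 0]); exact: open_neq0.
have oV := mopen_image Ac oA.
have sV : c @` ([set x | psi x != 0] `&` chart_dom c) `<=` c @` chart_dom c.
  by move=> _ [y [_ cy] <-]; exists y.
apply: (@smooth_on_sub _ _ (c @` ([set x | psi x != 0] `&` chart_dom c))).
  by move=> _ ->; exists z => //; split => //=; rewrite p1 oner_neq0.
apply: (@smooth_on_eq _ _ _ (fun y => (f \o chart_inv c) y * ((psi \o chart_inv c) y)^-1)) => //.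
  by move=> _ [y [Ay cy] <-] /=; rewrite (chartK cy) mulrAC mulfV // mul1r.
apply: smooth_onM => //; first exact: smooth_on_sub (CinfP f Ac).
apply: smooth_on_inv => //; last exact: smooth_on_sub (CinfP psi Ac).
by move=> _ [y [Ay cy] <-] /=; rewrite (chartK cy).
Qed.

Section FrameCutoff.
Context (c : chart R n M) (t : forall m, E m -> 'rV[R]_k).
Context (Ac : charts c) (ht : trivial c t) (psi : Cinf M) (hpsi : bump_on c setT psi).

Lemma smooth_cut_frame a :
  @smooth_sec _ _ _ vb (fun z => psi z *: tinv t z (delta_mx 0 a)).
Proof.
apply: vec_smoothP => eps.
have [d [Ad dd dE]] := ht.2.
pose h (w : 'rV[R]_n) := (lin_Cinf eps \o chart_inv d) (row_mx w (delta_mx 0 a)).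
have H z : chart_dom c z -> h (c z) = eps z (tinv t z (delta_mx 0 a)).
  move=> cz; rewrite /h /=.
  have dz : chart_dom d (pt (tinv t z (delta_mx 0 a))) by rewrite dd.
  rewrite (_ : row_mx _ _ = d (pt (tinv t z (delta_mx 0 a)))); last first.
    by rewrite dE //= (tinvK ht).
  by rewrite chartK.
have sh : smooth_on (c @` (setT `&` chart_dom c)) h.
  apply: (smooth_comp _ _ _ (CinfP (lin_Cinf eps) Ad)).
  - by apply: mopen_image => //; exact: mopenT.
  - move=> _ [z [_ cz] <-]; exists (pt (tinv t z (delta_mx 0 a))); first by rewrite dd.
    by rewrite dE ?dd //= (tinvK ht).
  - move=> i; case: (split_ordP i) => j ->.
      apply: (@smooth_on_eq _ _ _ (fun y : 'rV[R]_n => y 0 j)).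
      + by apply: mopen_image => //; exact: mopenT.
      + by move=> y _; rewrite row_mxEl.
      + exact: smooth_on_coord.
    apply: (@smooth_on_eq _ _ _ (fun=> delta_mx 0 a (0 : 'I_1) j)).
    + by apply: mopen_image => //; exact: mopenT.
    + by move=> y _; rewrite row_mxEr.
    + exact: smooth_on_cst.
have := bump_mul Ac mopenT hpsi sh.
congr smooth_fun; apply/funext => z.
rewrite dual_linZ; have [cz|nz] := pselect (chart_dom c z); first by rewrite H.
by rewrite (psi_out hpsi) // !mul0r.
Qed.

Definition cut_frame a : section vb := MkSection (smooth_cut_frame a).

Lemma cut_frameE z (y : E z) :
  psi z ^+ 2 *: y = \sum_a cut_coord ht hpsi a z y *: cut_frame a z.
Proof.
have [cz|nz] := pselect (chart_dom c z); last first.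
  rewrite (psi_out hpsi) // expr0n scale0r big1 // => a _ /=.
  by rewrite (psi_out hpsi) // mul0r scale0r.
have [_ /bij_inj] := ht.1 z cz; apply.
rewrite (trivZ ht) // (triv_sum ht) //; apply/rowP => j.
rewrite !mxE summxE (bigD1 j) //= big1 ?addr0.
  rewrite (trivZ ht) // (trivZ ht) // (tinvK ht) // !mxE !eqxx mulr1.
  by rewrite expr2 mulrAC.
move=> i ij; rewrite (trivZ ht) // (trivZ ht) // (tinvK ht) // !mxE.
by rewrite eq_sym (negbTE ij) andbF !mulr0.
Qed.

End FrameCutoff.

End VectorBundle.

Section TotalSpace.
Context {R : realType} {n k : nat} {M : manifold R n} (E : vbundle M k).
Local Notation charts := (atlas (msmooth M)).
Local Notation vb := (vec_bundle E).
Local Notation db := (dual_bundle E).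
Local Notation trivial := (trivialization (vstruct E)).
Local Notation tot := (Defs.total E).
Local Notation pull := (pull_proj E).

Lemma framed_vec : framed vb.
Proof.
move=> p; have [c [t [Ac cp ht]]] := vlocal_triv E p.
have [psi p1 pA] := bump_onP Ac cp mopenT I.
exists 'I_k, (psi * psi), (fun a z => cut_coord_fun ht pA a z), (cut_frame Ac ht pA).
split => [|a s|z y]; first by rewrite /= p1 mulr1.
  exact: (CinfP (pull_sec s (lin_Cinf (cut_coord ht pA a)))).
exact: (cut_frameE Ac ht pA y).
Qed.

Lemma framed_dual : framed db.
Proof.
move=> p; have [I [chi [a [s [c1 sa Ea]]]]] := framed_vec p.
have [c [t [Ac cp ht]]] := vlocal_triv E p.
have [psi p1 pA] := bump_onP Ac cp mopenT Logic.I.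
exists 'I_k, (psi * psi), (fun i z => eval_dual (cut_frame Ac ht pA i z)), (cut_coord ht pA).
split => [|i eps|z eta]; first by rewrite /= p1 mulr1.
  exact: (CinfP (pull_sec (cut_frame Ac ht pA i) (lin_Cinf eps))).
apply: dual_ext => y; rewrite dualZE dual_sumE -dual_linZ.
rewrite (_ : (psi * psi) z *: y = psi z ^+ 2 *: y) // (cut_frameE Ac ht pA) dual_lin_sum.
by apply: eq_bigr => i _; rewrite dual_linZ dualZE /= mulrC.
Qed.

Lemma dual_smoothP (eps : forall z, dual (E z)) :
  (forall s : section vb, smooth_fun (fun z => eps z (s z))) ->
  @smooth_sec _ _ _ db eps.
Proof.
move=> h; apply: smooth_fun_loc => -[p x].
have [c [t [Ac cp ht]]] := vlocal_triv E p.
have [psi p1 pA] := bump_onP Ac cp mopenT I.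
exists (pull (psi * psi)); first by rewrite /= p1 mulr1 oner_neq0.
pose f a := pull (MkCinf (h (cut_frame Ac ht pA a))).
have := CinfP (\sum_a lin_Cinf (cut_coord ht pA a) * f a).
congr smooth_fun; apply/funext => -[z y].
rewrite Csum_eval /lin_fun /= -dual_linZ.
rewrite (_ : (psi z * psi z) *: y = psi z ^+ 2 *: y) // (cut_frameE Ac ht pA).
by rewrite dual_lin_sum; apply: eq_bigr => a _; rewrite [RHS]dual_linZ.
Qed.

(* The functions pulled back from M and the fibrewise linear ones; their
   differentials span the cotangent spaces of E. *)
Definition basic_fun (f : Cinf tot) : Prop :=
  (exists g, f = pull g) \/ (exists eps, f = lin_Cinf eps).

Section TotalChart.
Context (c : chart R n M) (t : forall m, E m -> 'rV[R]_k).
Context (Ac : charts c) (ht : trivial c t) (psi : Cinf M) (hpsi : bump_on c setT psi).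

Lemma smooth_base_coord j : smooth_fun (fun z => psi z * c z 0 j).
Proof.
by apply: (bump_mul (h := fun w => w 0 j) Ac mopenT hpsi); exact: smooth_on_coord.
Qed.

Definition total_coord (i : 'I_(n + k)) : Cinf tot :=
  match fintype.split i with
  | inl j => pull (MkCinf (smooth_base_coord j))
  | inr a => lin_Cinf (cut_coord ht hpsi a)
  end.

Lemma total_coordE (d : chart R (n + k) tot) i e :
  chart_dom d = [set e | chart_dom c (projT1 e)] ->
  (forall e, chart_dom d e ->
     d e = row_mx (c (projT1 e)) (t (projT2 e))) ->
  chart_dom d e -> total_coord i e = pull psi e * d e 0 i.
Proof.
move=> dd dE de; rewrite dE // /total_coord; case: split_ordP => j ->.
  by rewrite row_mxEl.
by rewrite row_mxEr.
Qed.

Lemma total_coord_basic i : basic_fun (total_coord i).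
Proof.
rewrite /total_coord; case: fintype.split => j; [left|right]; last by eexists.
by eexists.
Qed.

End TotalChart.

Lemma total_frame (e : tot) :
  exists (I : finType) (chi : Cinf tot) (F : I -> Cinf tot)
    (X : I -> section (tangent_bundle tot)),
  [/\ chi e != 0, forall i, basic_fun (F i) & forall x (v : tangent x) f,
      chi x * v f = \sum_i v (F i) * X i x f].
Proof.
case: e => p x.
have [c [t [Ac cp ht]]] := vlocal_triv E p.
have [psi p1 pA] := bump_onP Ac cp mopenT I.
have [d [Ad dd dE]] := ht.2.
apply: (@tangent_frame_sum _ _ tot d (pt x) (pull psi)
  (total_coord Ac ht pA) basic_fun) => //.
- by rewrite dd.
- by rewrite /= p1 oner_neq0.
- by move=> i z dz; apply: total_coordE.
- by left; eexists.
- exact: total_coord_basic.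
Qed.

Lemma total_tangent_ext (e : tot) (v w : tangent e) :
  (forall f, v (pull f) = w (pull f)) ->
  (forall eps, v (lin_Cinf eps) = w (lin_Cinf eps)) -> v = w.
Proof.
move=> h1 h2; apply: tangent_ext => f.
have [I [chi [F [X [c0 bF EF]]]]] := total_frame e.
apply: (mulfI c0); rewrite !EF; apply: eq_bigr => i _; congr (_ * _).
by case: (bF i) => [[g ->]|[eps ->]].
Qed.

Lemma total_tangent_smooth (Z : forall e : tot, tangent e) :
  (forall f, smooth_fun (fun e => Z e (pull f))) ->
  (forall eps, smooth_fun (fun e => Z e (lin_Cinf eps))) ->
  @smooth_sec _ _ _ (tangent_bundle tot) Z.
Proof.
move=> h1 h2 f; apply: smooth_fun_loc => e.
have [I [chi [F [X [c0 bF EF]]]]] := total_frame e.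
exists chi => //.
have sF i : smooth_fun (fun e => Z e (F i)).
  by case: (bF i) => [[g ->]|[eps ->]].
have := CinfP (\sum_i MkCinf (sF i) * vact (X i) f).
by congr smooth_fun; apply/funext => x; rewrite Csum_eval EF.
Qed.

Section Curves.
Context (c : chart R n M) (t : forall m, E m -> 'rV[R]_k).
Context (Ac : charts c) (ht : trivial c t) (psi : Cinf M) (hpsi : bump_on c setT psi).
Context (m : M) (cm : chart_dom c m) (psi1 : psi m = 1).
Context (eta : R -> R) (eta0 : eta 0 = 0).
Context (seta : smooth_on (setT : set R^o) eta).
Context (deta : is_derive (0 : R) (1 : R) eta 1).

Definition base_velocity (x : E m) (v : tangent (pt x : tot)) : 'rV[R]_n :=
  \row_j (v (pull (MkCinf (smooth_base_coord Ac hpsi j))) -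
          c m 0 j * v (pull psi)).

Definition fibre_velocity (x : E m) (v : tangent (pt x : tot)) : 'rV[R]_k :=
  \row_a (v (lin_Cinf (cut_coord ht hpsi a)) - t x 0 a * v (pull psi)).

Lemma chart_velocity (x : E m) (v : tangent (pt x : tot)) X V :
  X = base_velocity v -> V = fibre_velocity v ->
  (forall s, (c @` chart_dom c) (c m + eta s *: X)) ->
  velocity (fun s => pt (tinv t (chart_inv c (c m + eta s *: X))
                              (t x + eta s *: V)) : tot) v.
Proof.
move=> eX eV cX.
have [d [Ad dd dE]] := ht.2.
pose g s := chart_inv c (c m + eta s *: X).
have cg s : chart_dom c (g s) by have [z cz ez] := cX s; rewrite /g -ez (chartK cz).
have cgE s : c (g s) = c m + eta s *: X by have [z cz ez] := cX s; rewrite /g -ez (chartK cz).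
pose gam s : tot := pt (tinv t (g s) (t x + eta s *: V)).
have dgam s : chart_dom d (gam s) by rewrite dd; exact: cg.
pose W := row_mx X V; pose P := row_mx (c m) (t x).
have dx : chart_dom d (pt x) by rewrite dd.
have EP : d (pt x) = P by rewrite dE.
have EG s : d (gam s) = P + eta s *: W.
  by rewrite dE // /gam /= (tinvK ht) // cgE scale_row_mx add_row_mx.
have fE f s : f (gam s) = (f \o chart_inv d) (P + eta s *: W).
  by rewrite /= -EG chartK.
split.
- move=> f; apply: (@smooth_on_eq _ _ _ ((f \o chart_inv d) \o (fun s : R^o => P + eta s *: W))).
  + exact: openT.
  + by move=> s _; rewrite -[LHS]fE.
  apply: (smooth_comp openT _ _ (CinfP f Ad)).
  + by move=> s _; exists (gam s).
  + move=> i; apply: (@smooth_on_eq _ _ _ (fun s => P 0 i + eta s * W 0 i)).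
    * exact: openT.
    * by move=> s _; rewrite !mxE.
    apply: smooth_onD; [exact: openT|exact: smooth_on_cst|].
    by apply: smooth_onM; [exact: openT|exact: seta|exact: smooth_on_cst].
- rewrite -[LHS]/(gam 0) -(chartK (dgam 0)) EG eta0 scale0r addr0 -EP.
  by rewrite chartK.
- move=> f; pose F := f \o chart_inv d.
  have dF : differentiable F P.
    by rewrite -EP; apply: dchart_differentiable.
  have dl : is_derive (eta 0) (1 : R) (fun r : R => F (P + r *: W)) ('d F P W).
    have := @is_derive_line _ _ F P W (eta 0).
    by rewrite eta0 scale0r addr0; apply.
  have := is_derive1_comp dl deta.
  rewrite (_ : _ \o _ = fun s => f (gam s)); last by apply/funext => s; rewrite fE.
  rewrite mulr1 (_ : 'd F P W = v f) //.
  rewrite (diff_coord W dF).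
  have yE i z : chart_dom d z ->
      total_coord Ac ht hpsi i z = pull psi z * d z 0 i.
    by move=> dz; apply: total_coordE.
  have := tangent_chart v f Ad dx yE.
  rewrite /= psi1 mul1r => ->.
  apply: eq_bigr => i _; rewrite /dchart EP; congr (_ * _).
  rewrite /W /P eX eV /total_coord; case: split_ordP => j ->.
    by rewrite !row_mxEl !mxE.
  by rewrite !row_mxEr !mxE.
Qed.

End Curves.

Lemma velocity_unique (g : R -> tot) e (v : tangent e) (f : Cinf tot) (a : R) :
  velocity g v -> is_derive (0 : R) (1 : R) (fun s => f (g s)) a -> v f = a.
Proof. by move=> [_ _ /(_ f) [_ <-]] [_ <-]. Qed.

Lemma curve_in_chart (c : chart R n M) m (X : 'rV[R]_n) : charts c -> chart_dom c m ->
  exists eta : R -> R,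
  [/\ eta 0 = 0, smooth_on (setT : set R^o) eta, is_derive (0 : R) (1 : R) eta 1 &
      forall s, (c @` chart_dom c) (c m + eta s *: X)].
Proof.
move=> Ac cm.
have oW : open (c @` chart_dom c) by exact: chart_open.
have Wm : (c @` chart_dom c) (c m) by exists m.
have [r /= r0 rW] := (nbhs_ballP _ _).1 (open_nbhs_nbhs (conj oW Wm)).
have q0 : 0 < r / (`|X| + 1) by rewrite divr_gt0 // ltr_wpDl.
have [eta [e0 es se de]] := small_curve q0.
exists eta; split => // s; apply: rW; rewrite -ball_normE /=.
rewrite opprD addrA subrr add0r normrN normrZ.
have X1 : 0 < `|X| + 1 by rewrite ltr_wpDl.
apply: (@le_lt_trans _ _ (`|eta s| * (`|X| + 1))).
  by rewrite ler_wpM2l // lerDl.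
by rewrite -ltr_pdivlMr.
Qed.

Lemma tangent_sumP m (x x' : E m) (v : tangent (pt x : tot))
    (v' : tangent (pt x' : tot)) (u : tangent (pt (x + x') : tot)) :
  tangent_sum v v' u <->
  [/\ forall f, v (pull f) = v' (pull f),
      forall f, u (pull f) = v (pull f) &
      forall eps, u (lin_Cinf eps) = v (lin_Cinf eps) + v' (lin_Cinf eps)].
Proof.
split=> [[g [a [b [va vb' vu]]]]|[h1 h2 h3]].
  split.
  - by move=> f; apply: velocity_unique va _; have [_ _ /(_ (pull f)) h] := vb'; exact: h.
  - by move=> f; apply: velocity_unique vu _; have [_ _ /(_ (pull f)) h] := va; exact: h.
  - move=> eps; apply: velocity_unique vu _.
    have [_ _ /(_ (lin_Cinf eps)) da] := va.
    have [_ _ /(_ (lin_Cinf eps)) db'] := vb'.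
    have := is_deriveD da db'; congr is_derive.
    by apply/funext => s; rewrite !fctE /= /lin_fun /= dual_linD.
have [c [t [Ac cm ht]]] := vlocal_triv E m.
have [psi p1 pA] := bump_onP Ac cm mopenT I.
pose X := base_velocity Ac pA v.
have [eta [e0 se de cX]] := curve_in_chart X Ac cm.
pose g s := chart_inv c (c m + eta s *: X).
have cg s : chart_dom c (g s) by have [z cz ez] := cX s; rewrite /g -ez (chartK cz).
pose a s := tinv t (g s) (t m x + eta s *: fibre_velocity ht pA v).
pose b s := tinv t (g s) (t m x' + eta s *: fibre_velocity ht pA v').
exists g, a, b; split.
- exact: (@chart_velocity c t Ac ht psi pA m cm p1 eta e0 se de x v X _ erefl erefl cX).
- apply: (@chart_velocity c t Ac ht psi pA m cm p1 eta e0 se de x' v' X _ _ erefl cX).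
  by apply/rowP => j; rewrite !mxE !h1.
- have := @chart_velocity c t Ac ht psi pA m cm p1 eta e0 se de (x + x') u X
    (fibre_velocity ht pA v + fibre_velocity ht pA v').
  rewrite (_ : (fun s => pt (a s + b s)) = (fun s : R => pt (tinv t (chart_inv c (c m + eta s *: X))
         (t m (x + x') + eta s *: (fibre_velocity ht pA v + fibre_velocity ht pA v'))))).
    apply => //.
    + by apply/rowP => j; rewrite !mxE !h2.
    + by apply/rowP => j; rewrite !mxE (trivD ht) // !mxE h3 !h2 h1; ring.
  apply/funext => s; congr pt.
  have [_ /bij_inj] := ht.1 _ (cg s); apply.
  rewrite (trivD ht) // !(tinvK ht) // (trivD ht) // scalerDr.
  by rewrite addrACA.
Qed.

Lemma tangent_scaleP m (x : E m) r (v : tangent (pt x : tot))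
    (u : tangent (pt (r *: x) : tot)) :
  tangent_scale v u <->
  (forall f, u (pull f) = v (pull f)) /\
  (forall eps, u (lin_Cinf eps) = r * v (lin_Cinf eps)).
Proof.
split=> [[g [a [va vu]]]|[h1 h2]].
  split.
  - by move=> f; apply: velocity_unique vu _; have [_ _ /(_ (pull f)) h] := va; exact: h.
  - move=> eps; apply: velocity_unique vu _.
    have [_ _ /(_ (lin_Cinf eps)) da] := va.
    have := is_deriveZ r da; congr is_derive.
    by apply/funext => s; rewrite /= /lin_fun /= dual_linZ.
have [c [t [Ac cm ht]]] := vlocal_triv E m.
have [psi p1 pA] := bump_onP Ac cm mopenT I.
pose X := base_velocity Ac pA v.
have [eta [e0 se de cX]] := curve_in_chart X Ac cm.
pose g s := chart_inv c (c m + eta s *: X).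
have cg s : chart_dom c (g s) by have [z cz ez] := cX s; rewrite /g -ez (chartK cz).
pose a s := tinv t (g s) (t m x + eta s *: fibre_velocity ht pA v).
exists g, a; split.
  exact: (@chart_velocity c t Ac ht psi pA m cm p1 eta e0 se de x v X _ erefl erefl cX).
have := @chart_velocity c t Ac ht psi pA m cm p1 eta e0 se de (r *: x) u X
    (r *: fibre_velocity ht pA v).
rewrite (_ : (fun s => pt (r *: a s)) = (fun s : R => pt (tinv t (chart_inv c (c m + eta s *: X))
       (t m (r *: x) + eta s *: (r *: fibre_velocity ht pA v))))).
  apply => //.
  + by apply/rowP => j; rewrite !mxE !h1.
  + by apply/rowP => j; rewrite !mxE (trivZ ht) // !mxE h2 !h1; ring.
apply/funext => s; congr pt.
have [_ /bij_inj] := ht.1 _ (cg s); apply.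
rewrite (trivZ ht) // !(tinvK ht) // (trivZ ht) // scalerDr.
by rewrite !scalerA [r * _]mulrC.
Qed.

End TotalSpace.

(** * Connections *)

Section Connection.
Context {R : realType} {n k : nat} {M : manifold R n} (E : vbundle M k).
Local Notation vb := (vec_bundle E).
Local Notation TM := (tangent_bundle M).

Lemma vactD (X : section TM) f g : vact X (f + g) = vact X f + vact X g.
Proof. by apply: Cinf_ext => x /=; rewrite tangentD. Qed.

Lemma vactM (X : section TM) f g : vact X (f * g) = f * vact X g + vact X f * g.
Proof. by apply: Cinf_ext => x /=; rewrite tangent_leibniz. Qed.

Lemma vact_cst (X : section TM) a : vact X (Ccst a) = 0.
Proof. by apply: Cinf_ext => x /=; rewrite tangent_cst. Qed.

Lemma vactN (X : section TM) f : vact X (- f) = - vact X f.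
Proof. by apply: Cinf_ext => x /=; rewrite tangentN. Qed.

Lemma vactB (X : section TM) f g : vact X (f - g) = vact X f - vact X g.
Proof. by rewrite vactD vactN. Qed.

Lemma vactDl (X Y : section TM) f : vact (X + Y) f = vact X f + vact Y f.
Proof. exact: Cinf_ext. Qed.

Lemma vactZl (X : section TM) g f : vact (g *: X) f = g * vact X f.
Proof. exact: Cinf_ext. Qed.

Definition cut_connection (chi : Cinf M)
    (D : section TM -> section vb -> section vb) : Prop :=
  (forall f X Y s, D (f *: X + Y) s = f *: D X s + D Y s) /\
  (forall f X s t, D X (f *: s + t) = f *: D X s + (chi * vact X f) *: s + D X t).

Lemma cut_connection_exists (p : M) :
  exists chiD : Cinf M * (section TM -> section vb -> section vb),
  [/\ chiD.1 p != 0, forall x, 0 <= chiD.1 x & cut_connection chiD.1 chiD.2].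
Proof.
have [c [t [Ac cp ht]]] := vlocal_triv E p.
have [psi p1 pA] := bump_onP Ac cp mopenT I.
pose ell a s := pull_sec s (lin_Cinf (cut_coord ht pA a)).
have ellZ a f s s' : ell a (f *: s + s') = f * ell a s + ell a s'.
  by apply: Cinf_ext => x; apply: dual_linear.
exists (psi * psi, fun X s => \sum_a vact X (ell a s) *: cut_frame Ac ht pA a).
split => /=; first by rewrite p1 mulr1 oner_neq0.
  by move=> x; rewrite mulr_ge0 // pA.1.
split=> [f X Y s|f X s s'] /=.
  rewrite scaler_sumr -big_split; apply: eq_bigr => a _ /=.
  by rewrite vactDl vactZl scalerDl scalerA.
have -> : (psi * psi * vact X f) *: s =
    \sum_a (vact X f * ell a s) *: cut_frame Ac ht pA a.
  apply: section_ext => x; rewrite sec_sumE /=.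
  rewrite mulrC -scalerA -expr2 (cut_frameE Ac ht pA) scaler_sumr.
  by apply: eq_bigr => a _; rewrite -scalerA scalerA.
rewrite scaler_sumr -!big_split; apply: eq_bigr => a _ /=.
by rewrite ellZ vactD vactM scalerA !scalerDl.
Qed.

Lemma sum_trunc (V : zmodType) (F : nat -> V) N N' :
  (forall i, (N <= i)%N -> F i = 0) -> (forall i, (N' <= i)%N -> F i = 0) ->
  \sum_(i < N) F i = \sum_(i < N') F i.
Proof.
move=> h h'; wlog NN : N N' h h' / (N <= N')%N.
  move=> H; case/orP: (leq_total N N') => l; first exact: (H N N' h h' l).
  by symmetry; exact: (H N' N h' h l).
rewrite -!(big_mkord xpredT F) [RHS](big_cat_nat _ (n := N)) //=.
rewrite [X in _ = _ + X]big_nat_cond [X in _ = _ + X]big1 ?addr0 //.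
by move=> i /andP[/andP[l _] _]; exact: h.
Qed.

Definition is_connection (D : section TM -> section vb -> section vb) : Prop :=
  (forall f X Y s, D (f *: X + Y) s = f *: D X s + D Y s) /\
  (forall f X s t, D X (f *: s + t) = f *: D X s + vact X f *: s + D X t).

Lemma connection_exists : exists D, is_connection D.
Proof.
have [[p0 _]|Mempty] := pselect (exists p : M, True); last first.
  exists (fun _ _ => 0); split => *; apply: section_ext => x;
    by case: Mempty; exists x.
have [DD DDP] := choice cut_connection_exists.
pose chi p := (DD p).1; pose D p := (DD p).2.
have [q [phi [phi0 cov lf]]] := @locally_finite_cover _ _ _ chi p0
  (fun p => let: And3 _ h _ := DDP p in h) (fun p => let: And3 h _ _ := DDP p in h).
have /choice[K KP] : forall x, exists K, forall i, (K <= i)%N -> phi i x = 0.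
  move=> x; have [g gx [K h]] := lf x; exists K => i Ki.
  by have /eqP := h i x Ki; rewrite mulf_eq0 (negbTE gx) => /eqP.
pose S x := \sum_(i < K x) phi i x * chi (q i) x.
have chi0 p x : 0 <= chi p x by have [_ + _] := DDP p; apply.
have S0 x : S x != 0.
  have [i hi] := cov x.
  have Ki : (i < K x)%N.
    by rewrite ltnNge; apply: contra_neqN hi => /KP ->; rewrite mul0r.
  rewrite /S psumr_neq0; last by move=> j _; rewrite mulr_ge0.
  apply/hasP; exists (Ordinal Ki); first by rewrite mem_index_enum.
  by rewrite /= lt_def hi mulr_ge0.
pose nab X s x := (S x)^-1 *: \sum_(i < K x) phi i x *: D (q i) X s x.
have loc x0 : exists (psi : Cinf M) (N : nat) (w : nat -> Cinf M), psi x0 != 0 /\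
    forall X s x, psi x *: nab X s x = \sum_(i < N) w i x *: D (q i) X s x.
  have [g gx [N gN]] := lf x0.
  exists (\sum_(i < N) (g * phi i) * chi (q i)), N, (fun i => g * phi i).
  have E1 x : (\sum_(i < N) (g * phi i) * chi (q i)) x = g x * S x.
    rewrite Csum_eval mulr_sumr.
    rewrite -(@sum_trunc _ (fun i => g x * (phi i x * chi (q i) x)) N).
    - by apply: eq_bigr => i _; rewrite /= mulrA.
    - by move=> i Ni; rewrite mulrA gN // mul0r.
    - by move=> i Ni; rewrite KP // mul0r mulr0.
  split; first by rewrite E1 mulf_neq0.
  move=> X s x; rewrite E1 /nab scalerA mulfK // scaler_sumr.
  rewrite -(@sum_trunc _ (fun i => g x *: (phi i x *: D (q i) X s x)) N).
  - by apply: eq_bigr => i _; rewrite scalerA.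
  - by move=> i Ni; rewrite scalerA gN // scale0r.
  - by move=> i Ni; rewrite KP // scale0r scaler0.
have snab X s : @smooth_sec _ _ _ vb (nab X s).
  apply: vec_smoothP => eps; apply: smooth_fun_loc => x0.
  have [psi [N [w [px E1]]]] := loc x0; exists psi => //.
  have := CinfP (\sum_(i < N) w i * pull_sec (D (q i) X s) (lin_Cinf eps)).
  congr smooth_fun; apply/funext => x.
  rewrite Csum_eval -dual_linZ E1 dual_lin_sum.
  by apply: eq_bigr => i _; rewrite dual_linZ.
have DP p : cut_connection (chi p) (D p) by have [] := DDP p.
exists (fun X s => MkSection (snab X s)); split.
- move=> f X Y s; apply: section_ext => x; rewrite /= /nab.
  rewrite scalerA [f x * _]mulrC -scalerA -scalerDr; congr (_ *: _).
  rewrite scaler_sumr -big_split; apply: eq_bigr => i _ /=.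
  by rewrite (DP _).1 /= scalerDr !scalerA mulrC.
- move=> f X s t; apply: section_ext => x; rewrite /= /nab.
  rewrite scalerA [f x * _]mulrC -scalerA.
  have -> : X x f *: s x = (S x)^-1 *: \sum_(i < K x) phi i x *: ((chi (q i) x * X x f) *: s x).
    rewrite -[LHS]scale1r -(mulVf (S0 x)) -scalerA; congr (_ *: _).
    rewrite /S scaler_suml; apply: eq_bigr => i _.
    by rewrite !scalerA mulrA.
  rewrite -!scalerDr; congr (_ *: _).
  rewrite scaler_sumr -!big_split; apply: eq_bigr => i _ /=.
  by rewrite (DP _).2 /= !scalerDr !scalerA [f x * _]mulrC.
Qed.

End Connection.

Section SumSections.
Context {R : realType} {n : nat} {M : manifold R n} {V W : bundle M}.
Implicit Types (nu mu : section (bsum V W)).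

Lemma sfstD nu mu : sfst (nu + mu) = sfst nu + sfst mu.
Proof. exact: section_ext. Qed.

Lemma ssndD nu mu : ssnd (nu + mu) = ssnd nu + ssnd mu.
Proof. exact: section_ext. Qed.

Lemma sfstZ f nu : sfst (f *: nu) = f *: sfst nu.
Proof. exact: section_ext. Qed.

Lemma ssndZ f nu : ssnd (f *: nu) = f *: ssnd nu.
Proof. exact: section_ext. Qed.

Lemma sfst0 : sfst (0 : section (bsum V W)) = 0.
Proof. exact: section_ext. Qed.

Lemma ssnd0 : ssnd (0 : section (bsum V W)) = 0.
Proof. exact: section_ext. Qed.

Lemma sfstB nu mu : sfst (nu - mu) = sfst nu - sfst mu.
Proof. by apply: section_ext => z; rewrite -[LHS]/((nu - mu) z).1 !secBE. Qed.

Lemma ssndB nu mu : ssnd (nu - mu) = ssnd nu - ssnd mu.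
Proof. by apply: section_ext => z; rewrite -[LHS]/((nu - mu) z).2 !secBE. Qed.

Lemma sfstN nu : sfst (- nu) = - sfst nu.
Proof. by rewrite -sub0r sfstB sfst0 sub0r. Qed.

Lemma ssndN nu : ssnd (- nu) = - ssnd nu.
Proof. by rewrite -sub0r ssndB ssnd0 sub0r. Qed.

Lemma sfst_pair (s : section V) (t : section W) : sfst (spair s t) = s.
Proof. exact: section_ext. Qed.

Lemma ssnd_pair (s : section V) (t : section W) : ssnd (spair s t) = t.
Proof. exact: section_ext. Qed.

Lemma spair_ext nu mu : sfst nu = sfst mu -> ssnd nu = ssnd mu -> nu = mu.
Proof.
move=> h1 h2; apply: section_ext => z.
have e1 := congr1 (fun s : section V => s z) h1.
have e2 := congr1 (fun s : section W => s z) h2.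
by rewrite [nu z]surjective_pairing [mu z]surjective_pairing; congr pair.
Qed.

End SumSections.

Section VectorFields.
Context {R : realType} {n : nat} {M : manifold R n}.
Local Notation TM := (tangent_bundle M).
Implicit Types (X Y : section TM) (f : Cinf M).

Lemma vactNl X f : vact (- X) f = - vact X f.
Proof. by apply: Cinf_ext => z; rewrite -[LHS]/((- X) z f) secNE tanNE. Qed.

Lemma vactBl X Y f : vact (X - Y) f = vact X f - vact Y f.
Proof. by apply: Cinf_ext => z; rewrite -[LHS]/((X - Y) z f) secBE tanBE. Qed.

Lemma vact_lie X Y f : vact (lie X Y) f = vact X (vact Y f) - vact Y (vact X f).
Proof. exact: Cinf_ext. Qed.

Lemma vfield_ext X Y : (forall f, vact X f = vact Y f) -> X = Y.
Proof.
move=> h; apply: section_ext => z; apply: tangent_ext => f.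
by have := congr1 (fun F : Cinf M => F z) (h f).
Qed.

End VectorFields.

Section Evaluation.
Context {R : realType} {n k : nat} {M : manifold R n} {E : vbundle M k}.
Local Notation vb := (vec_bundle E).
Local Notation db := (dual_bundle E).
Implicit Types (f : Cinf M) (eps : section db) (s : section vb).

Definition ev eps s : Cinf M := pull_sec s (lin_Cinf eps).

Lemma evDl eps eps' s : ev (eps + eps') s = ev eps s + ev eps' s.
Proof. exact: Cinf_ext. Qed.

Lemma evZl f eps s : ev (f *: eps) s = f * ev eps s.
Proof. exact: Cinf_ext. Qed.

Lemma evBl eps eps' s : ev (eps - eps') s = ev eps s - ev eps' s.
Proof.
by apply: Cinf_ext => z; rewrite -[LHS]/((eps - eps') z (s z)) secBE dualBE.
Qed.

Lemma evDr eps s s' : ev eps (s + s') = ev eps s + ev eps s'.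
Proof. by apply: Cinf_ext => z; apply: dual_linD. Qed.

Lemma evZr f eps s : ev eps (f *: s) = f * ev eps s.
Proof. by apply: Cinf_ext => z; apply: dual_linZ. Qed.

Lemma dual_sec_ext eps eps' : (forall s, ev eps s = ev eps' s) -> eps = eps'.
Proof.
move=> h; apply: section_ext => z; apply: dual_ext => y.
have [s <-] := framed_ext (framed_vec E) y.
by have := congr1 (fun F : Cinf M => F z) (h s).
Qed.

End Evaluation.

(** * Dorfman connections and dull brackets *)

Section DorfmanCalculus.
Context {R : realType} {n k : nat} {M : manifold R n} (E : vbundle M k).
Local Notation TM := (tangent_bundle M).
Local Notation TsM := (cotangent_bundle M).
Local Notation vb := (vec_bundle E).
Local Notation db := (dual_bundle E).
Local Notation S := (section (side E)).
Local Notation T := (section (core E)).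
Implicit Types (f g : Cinf M) (nu mu : S) (tau : T).

Lemma framed_side : framed (side E).
Proof. apply: framed_bsum; [exact: framed_tangent|exact: framed_dual]. Qed.

Lemma framed_core : framed (core E).
Proof. apply: framed_bsum; [exact: framed_vec|exact: framed_cotangent]. Qed.

Definition ppair (m : M) (x : side E m) (y : core E m) : R := x.2 y.1 + y.2 x.1.

Lemma pairingE nu tau m : pairing nu tau m = ppair (nu m) (tau m).
Proof. by []. Qed.

Lemma ppair_linl m (y : core E m) a x x' :
  ppair (a *: x + x') y = a * ppair x y + ppair x' y.
Proof.
rewrite /ppair dual_linear -[(a *: x + x').2]/(a *: x.2 + x'.2) dualDE dualZE.
by rewrite mulrDr addrACA.
Qed.

Lemma ppair_linr m (x : side E m) a y y' :
  ppair x (a *: y + y') = a * ppair x y + ppair x y'.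
Proof.
rewrite /ppair dual_linear -[(a *: y + y').2]/(a *: y.2 + y'.2) dualDE dualZE.
by rewrite mulrDr addrACA.
Qed.

Lemma pairing_linl f nu nu' tau :
  pairing (f *: nu + nu') tau = f * pairing nu tau + pairing nu' tau.
Proof. by apply: Cinf_ext => m; rewrite pairingE ppair_linl. Qed.

Lemma pairing_linr f nu tau tau' :
  pairing nu (f *: tau + tau') = f * pairing nu tau + pairing nu tau'.
Proof. by apply: Cinf_ext => m; rewrite pairingE ppair_linr. Qed.

Lemma ppair0l m (y : core E m) : ppair 0 y = 0.
Proof. by rewrite /ppair dual_lin0 addr0. Qed.

Lemma ppair0r m (x : side E m) : ppair x 0 = 0.
Proof. by rewrite /ppair dual_lin0 add0r. Qed.

Lemma ppairZl m a (x : side E m) y : ppair (a *: x) y = a * ppair x y.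
Proof. by have := ppair_linl y a x 0; rewrite addr0 ppair0l addr0. Qed.

Lemma ppairZr m a (x : side E m) y : ppair x (a *: y) = a * ppair x y.
Proof. by have := ppair_linr x a y 0; rewrite addr0 ppair0r addr0. Qed.

Lemma ppairNl m (x : side E m) y : ppair (- x) y = - ppair x y.
Proof. by rewrite -scaleN1r ppairZl mulN1r. Qed.

Lemma ppairNr m (x : side E m) y : ppair x (- y) = - ppair x y.
Proof. by rewrite -scaleN1r ppairZr mulN1r. Qed.

Lemma pairingDl nu nu' tau : pairing (nu + nu') tau = pairing nu tau + pairing nu' tau.
Proof. by have := pairing_linl 1 nu nu' tau; rewrite scale1r mul1r. Qed.

Lemma pairingDr nu tau tau' : pairing nu (tau + tau') = pairing nu tau + pairing nu tau'.
Proof. by have := pairing_linr 1 nu tau tau'; rewrite scale1r mul1r. Qed.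

Lemma pairing0l tau : pairing 0 tau = 0.
Proof. by apply: Cinf_ext => m; rewrite pairingE ppair0l. Qed.

Lemma pairing0r nu : pairing nu 0 = 0.
Proof. by apply: Cinf_ext => m; rewrite pairingE ppair0r. Qed.

Lemma pairingZl f nu tau : pairing (f *: nu) tau = f * pairing nu tau.
Proof. by have := pairing_linl f nu 0 tau; rewrite addr0 pairing0l addr0. Qed.

Lemma pairingZr f nu tau : pairing nu (f *: tau) = f * pairing nu tau.
Proof. by have := pairing_linr f nu tau 0; rewrite addr0 pairing0r addr0. Qed.

Lemma pairingNl nu tau : pairing (- nu) tau = - pairing nu tau.
Proof. by rewrite -scaleN1r pairingZl mulN1r. Qed.

Lemma pairingNr nu tau : pairing nu (- tau) = - pairing nu tau.
Proof. by rewrite -scaleN1r pairingZr mulN1r. Qed.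

Lemma pairing_exact nu f : pairing nu (core_d E f) = pr_act nu f.
Proof.
apply: Cinf_ext => m; rewrite pairingE /ppair /= dual_lin0.
by rewrite add0r.
Qed.

Lemma side_ext m (x x' : side E m) : (forall y, ppair x y = ppair x' y) -> x = x'.
Proof.
case: x x' => [X eps] [X' eps'] h; congr pair.
  apply: tangent_ext => f.
  by have := h (0, covec f m); rewrite /ppair /= !dual_lin0 !add0r.
apply: dual_ext => e.
by have := h (e, 0); rewrite /ppair /= !addr0.
Qed.

Lemma vec_ext m (y y' : E m) : (forall eps : dual (E m), eps y = eps y') -> y = y'.
Proof.
move=> h; have [I [chi [a [s [c1 _ EE]]]]] := framed_vec E m.
rewrite -[y]scale1r -[y']scale1r -c1 (EE m y) (EE m y').
by apply: eq_bigr => i _; rewrite h.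
Qed.

Lemma core_ext m (y y' : core E m) : (forall x, ppair x y = ppair x y') -> y = y'.
Proof.
case: y y' => [e th] [e' th'] h; congr pair.
  apply: vec_ext => eps.
  by have := h (0, eps); rewrite /ppair /= !dual_lin0 !addr0.
apply: dual_ext => X.
by have := h (X, 0); rewrite /ppair /= !add0r.
Qed.

Lemma sec_side_ext nu nu' : (forall tau, pairing nu tau = pairing nu' tau) -> nu = nu'.
Proof.
move=> h; apply: section_ext => m; apply: side_ext => y.
have [tau <-] := framed_ext framed_core y.
by rewrite -!pairingE h.
Qed.

Lemma sec_core_ext tau tau' : (forall nu, pairing nu tau = pairing nu tau') -> tau = tau'.
Proof.
move=> h; apply: section_ext => m; apply: core_ext => x.
have [nu <-] := framed_ext framed_side x.
by rewrite -!pairingE h.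
Qed.

Lemma side_rep (F : T -> Cinf M) :
  (forall f s t, F (f *: s + t) = f * F s + F t) ->
  exists nu, forall tau, F tau = pairing nu tau.
Proof.
move=> Flin; have [eps FE] := framed_rep framed_core Flin.
have XL_lin z a (x y : dual (tangent z)) :
    eps z (0, a *: x + y) = a * eps z (0, x) + eps z (0, y).
  by rewrite -dual_linear; congr (eps z _); congr pair; rewrite /= scaler0 addr0.
pose XL z : dual (dual (tangent z)) := Dual (XL_lin z).
pose X z := projT1 (cid (framed_bidual (V := TM) (p := z) (XL z) (@framed_tangent _ _ M))).
have XE z th : eps z (0, th) = th (X z).
  by rewrite /X; case: cid => x /= <-.
have et_lin z a (x y : E z) :
    eps z (a *: x + y, 0) = a * eps z (x, 0) + eps z (y, 0).
  by rewrite -dual_linear; congr (eps z _); congr pair; rewrite /= scaler0 addr0.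
pose et z : dual (E z) := Dual (et_lin z).
have sX : @smooth_sec _ _ _ TM X.
  move=> f; have := CinfP (F (spair 0 (dform f))).
  by congr smooth_fun; apply/funext => z; rewrite FE /= XE.
have smet : @smooth_sec _ _ _ db et.
  apply: dual_smoothP => s; have := CinfP (F (spair s 0)).
  by congr smooth_fun; apply/funext => z; rewrite FE.
exists (spair (MkSection sX) (MkSection smet)) => tau; apply: Cinf_ext => z.
rewrite FE pairingE /ppair /= -XE -dual_linD; congr (eps z _).
by case: (tau z) => y th; congr pair; rewrite ?addr0 ?add0r.
Qed.

Lemma core_rep (F : S -> Cinf M) :
  (forall f s t, F (f *: s + t) = f * F s + F t) ->
  exists tau, forall nu, F nu = pairing nu tau.
Proof.
move=> Flin; have [eps FE] := framed_rep framed_side Flin.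
have yL_lin z a (x y : dual (E z)) :
    eps z (0, a *: x + y) = a * eps z (0, x) + eps z (0, y).
  by rewrite -dual_linear; congr (eps z _); congr pair; rewrite /= scaler0 addr0.
pose yL z : dual (dual (E z)) := Dual (yL_lin z).
pose y z : E z := projT1 (cid (framed_bidual (V := vb) (p := z) (yL z) (framed_vec E))).
have yE z th : eps z (0, th) = th (y z).
  by rewrite /y; case: cid => x /= <-.
have th_lin z a (X X' : tangent z) :
    eps z (a *: X + X', 0) = a * eps z (X, 0) + eps z (X', 0).
  by rewrite -dual_linear; congr (eps z _); congr pair; rewrite /= scaler0 addr0.
pose th z : dual (tangent z) := Dual (th_lin z).
have sy : @smooth_sec _ _ _ vb y.
  apply: vec_smoothP => et; have := CinfP (F (spair 0 et)).
  by congr smooth_fun; apply/funext => z; rewrite FE /= yE.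
have sth : @smooth_sec _ _ _ TsM th.
  move=> X; have := CinfP (F (spair X 0)).
  by congr smooth_fun; apply/funext => z; rewrite FE.
exists (spair (MkSection sy) (MkSection sth)) => nu; apply: Cinf_ext => z.
rewrite FE pairingE /ppair /= -yE -dual_linD; congr (eps z _).
by case: (nu z) => X et; congr pair; rewrite ?addr0 ?add0r.
Qed.

Lemma pr_actD nu f g : pr_act nu (f + g) = pr_act nu f + pr_act nu g.
Proof. exact: vactD. Qed.

Lemma pr_actM nu f g : pr_act nu (f * g) = f * pr_act nu g + pr_act nu f * g.
Proof. exact: vactM. Qed.

Lemma pr_actDl nu nu' f : pr_act (nu + nu') f = pr_act nu f + pr_act nu' f.
Proof. exact: Cinf_ext. Qed.

Lemma pr_actZl g nu f : pr_act (g *: nu) f = g * pr_act nu f.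
Proof. exact: Cinf_ext. Qed.

Lemma pr_act_cst nu a : pr_act nu (Ccst a) = 0.
Proof. exact: vact_cst. Qed.

Record dull_bracket (B : S -> S -> S) : Prop := {
  bracket_linl : forall a nu nu' mu, B (Ccst a *: nu + nu') mu = Ccst a *: B nu mu + B nu' mu;
  bracket_leibr : forall f nu mu mu',
    B nu (f *: mu + mu') = f *: B nu mu + pr_act nu f *: mu + B nu mu';
  bracket_leibl : forall f nu mu, B (f *: nu) mu = f *: B nu mu - pr_act mu f *: nu;
  bracket_anchor : forall nu mu f,
    pr_act (B nu mu) f = pr_act nu (pr_act mu f) - pr_act mu (pr_act nu f) }.

Section DullOfDorfman.
Context (D : dorfman E).

Lemma dorfD nu tau tau' : D nu (tau + tau') = D nu tau + D nu tau'.
Proof. by have := dorf_linr D 1 nu tau tau'; rewrite !scale1r. Qed.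

Lemma dullP nu mu tau :
  pr_act nu (pairing mu tau) = pairing (dull D nu mu) tau + pairing mu (D nu tau).
Proof.
rewrite /dull; case: xgetP => [y _ /= ->//|h].
have [f s t|kap kapP] := @side_rep (fun tau =>
  pr_act nu (pairing mu tau) - pairing mu (D nu tau)).
  by rewrite pairing_linr pr_actD pr_actM dorfD dorf_leibniz !pairingDr !pairingZr; ring.
by case: (h kap) => tau'; rewrite -kapP subrK.
Qed.

Lemma pairing_dull nu mu tau :
  pairing (dull D nu mu) tau = pr_act nu (pairing mu tau) - pairing mu (D nu tau).
Proof. by rewrite dullP addrK. Qed.

Lemma pairing_dorf nu mu tau :
  pairing mu (D nu tau) = pr_act nu (pairing mu tau) - pairing (dull D nu mu) tau.
Proof. by rewrite dullP [X in X - _]addrC addrK. Qed.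

Lemma dull_bracketP : dull_bracket (dull D).
Proof.
split.
- move=> a nu nu' mu; apply: sec_side_ext => tau.
  by rewrite pairing_linl !pairing_dull dorf_linl pairingDr pairingZr pr_actDl pr_actZl; ring.
- move=> f nu mu mu'; apply: sec_side_ext => tau.
  by rewrite !pairingDl !pairingZl !pairing_dull !pairing_linl pr_actD pr_actM; ring.
- move=> f nu mu; apply: sec_side_ext => tau.
  rewrite pairingDl pairingNl !pairingZl !pairing_dull pr_actZl dorf_scale.
  by rewrite pairingDr !pairingZr pairing_exact; ring.
- move=> nu mu f; rewrite -[LHS]pairing_exact pairing_dull pairing_exact dorf_exact.
  by rewrite pairing_exact.
Qed.

End DullOfDorfman.

Lemma dorfman_of_bracket (B : S -> S -> S) : dull_bracket B ->
  exists D : dorfman E, dull D = B.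
Proof.
move=> dB.
have H nu tau : exists kap, forall mu,
    pr_act nu (pairing mu tau) - pairing (B nu mu) tau = pairing mu kap.
  apply: core_rep => f s t.
  by rewrite (bracket_leibr dB) pairing_linl pr_actD pr_actM !pairingDl !pairingZl; ring.
pose D nu tau := projT1 (cid (H nu tau)).
have DP nu tau mu : pairing mu (D nu tau) =
    pr_act nu (pairing mu tau) - pairing (B nu mu) tau.
  by rewrite /D; case: cid => kap /= ->.
have D1 a nu nu' tau : D (Ccst a *: nu + nu') tau = Ccst a *: D nu tau + D nu' tau.
  apply: sec_core_ext => mu.
  by rewrite pairing_linr !DP (bracket_linl dB) pairing_linl pr_actDl pr_actZl; ring.
have D2 a nu tau tau' : D nu (Ccst a *: tau + tau') = Ccst a *: D nu tau + D nu tau'.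
  apply: sec_core_ext => mu.
  by rewrite pairing_linr !DP !pairing_linr pr_actD pr_actM pr_act_cst; ring.
have D3 f nu tau : D nu (f *: tau) = f *: D nu tau + pr_act nu f *: tau.
  apply: sec_core_ext => mu.
  by rewrite pairing_linr !DP !pairingZr pr_actM; ring.
have D4 f nu tau : D (f *: nu) tau = f *: D nu tau + pairing nu tau *: core_d E f.
  apply: sec_core_ext => mu.
  rewrite pairing_linr !DP (bracket_leibl dB) pairingDl pairingNl !pairingZl pairingZr.
  by rewrite pairing_exact pr_actZl; ring.
have D5 f nu : D nu (core_d E f) = core_d E (pr_act nu f).
  apply: sec_core_ext => mu.
  by rewrite DP !pairing_exact (bracket_anchor dB); ring.
exists (Dorfman D1 D2 D3 D4 D5).
apply/funext => nu; apply/funext => mu; apply: sec_side_ext => tau.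
by rewrite pairing_dull /= DP subKr.
Qed.

Lemma skew_dorfman_exists : exists D : dorfman E, dorf_skew D.
Proof.
have [nab [nabL nabR]] := connection_exists E.
have nabX0 s : nab 0 s = 0.
  have := nabL (-1) 0 0 s; rewrite scaler0 addr0 scaleN1r addNr.
  by [].
have nabZ f X s : nab (f *: X) s = f *: nab X s.
  by have := nabL f X 0 s; rewrite addr0 nabX0 addr0.
have nabD X Y s : nab (X + Y) s = nab X s + nab Y s.
  by have := nabL 1 X Y s; rewrite !scale1r.
have H X eps : exists eta : section db, forall s, ev eta s =
    vact X (ev eps s) - ev eps (nab X s).
  have [f s t|et etP] :=
      framed_rep (F := fun s => vact X (ev eps s) - ev eps (nab X s)) (framed_vec E).
    by rewrite nabR !(evDr, evZr) vactD vactM; ring.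
  have smet : @smooth_sec _ _ _ db et.
    apply: dual_smoothP => s.
    have := CinfP (vact X (ev eps s) - ev eps (nab X s)).
    by congr smooth_fun; apply/funext => z; exact: etP.
  by exists (MkSection smet) => s; apply: Cinf_ext => z; exact/esym/etP.
pose N X eps := projT1 (cid (H X eps)).
have NP X eps s : ev (N X eps) s = vact X (ev eps s) - ev eps (nab X s).
  by rewrite /N; case: cid.
pose B (nu mu : S) : S := spair (lie (sfst nu) (sfst mu))
  (N (sfst nu) (ssnd mu) - N (sfst mu) (ssnd nu)).
have dB : dull_bracket B.
  split.
  - move=> a nu nu' mu; apply: spair_ext; rewrite /B !(sfstD, sfstZ, ssndD, ssndZ, sfst_pair, ssnd_pair).
      apply: vfield_ext => f.
      by rewrite !(vact_lie, vactDl, vactZl, vactD, vactM, vact_cst); ring.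
    apply: dual_sec_ext => s.
    by rewrite !(evBl, evDl, evZl, NP, vactDl, vactZl, nabD, nabZ, vactD, vactM, vact_cst, evDr, evZr); ring.
  - move=> f nu mu mu'; apply: spair_ext; rewrite /B !(sfstD, sfstZ, ssndD, ssndZ, sfst_pair, ssnd_pair).
      apply: vfield_ext => g.
      by rewrite /pr_act !(vact_lie, vactDl, vactZl, vactD, vactM); ring.
    apply: dual_sec_ext => s.
    by rewrite /pr_act !(evBl, evDl, evZl, NP, vactDl, vactZl, nabD, nabZ, vactD, vactM, evDr, evZr); ring.
  - move=> f nu mu; apply: spair_ext; rewrite /B !(sfstB, sfstD, sfstZ, ssndB, ssndD, ssndZ, sfst_pair, ssnd_pair).
      apply: vfield_ext => g.
      by rewrite /pr_act !(vact_lie, vactBl, vactDl, vactZl, vactD, vactM); ring.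
    apply: dual_sec_ext => s.
    by rewrite /pr_act !(evBl, evDl, evZl, NP, vactDl, vactZl, nabD, nabZ, vactD, vactM, evDr, evZr); ring.
  - by move=> nu mu f; exact: Cinf_ext.
have [D DB] := dorfman_of_bracket dB.
exists D => nu mu; rewrite DB.
rewrite -[RHS]add0r; apply: spair_ext; rewrite /B !(sfstB, ssndB, sfst_pair, ssnd_pair) ?sub0r.
  by rewrite sfst0 add0r; apply: vfield_ext => f; rewrite vactNl !vact_lie opprB.
by rewrite ssnd0 add0r opprB.
Qed.

End DorfmanCalculus.

(** * Horizontal lifts and core sections *)

Section HorizontalLift.
Context {R : realType} {n k : nat} {M : manifold R n} (E : vbundle M k).
Local Notation TM := (tangent_bundle M).
Local Notation vb := (vec_bundle E).
Local Notation db := (dual_bundle E).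
Local Notation S := (section (side E)).
Local Notation T := (section (core E)).
Local Notation tot := (Defs.total E).
Local Notation pull := (pull_proj E).
Implicit Types (f g : Cinf M) (nu mu : S) (tau : T).

Definition over_total (V : bundle tot) (F : forall m (x : E m), V (pt x)) :
    forall e : tot, V e :=
  fun e => match e with existT m x => F m x end.

Lemma vlift_pull m (x y : E m) f : vlift x y (pull f) = 0.
Proof. by rewrite /vlift /= derive1_cst. Qed.

Lemma vlift_lin m (x y : E m) (eps : section db) : vlift x y (lin_Cinf eps) = eps m y.
Proof.
rewrite -[LHS]/(derive1 (fun s : R => eps m (x + s *: y)) 0) derive1E.
have -> : (fun s : R => eps m (x + s *: y)) = (fun s : R => eps m x + s * eps m y).
  by apply/funext => s; rewrite dual_linD dual_linZ.
have [d1 d2] := @is_diff_id _ R^o (eps m x + 0 *: (eps m y : R^o)).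
have h := @is_derive_line _ R^o id (eps m x) (eps m y) 0 d1.
by rewrite (@derive_val _ _ _ _ _ _ _ h) d2.
Qed.

Lemma pullD f g : pull (f + g) = pull f + pull g. Proof. exact: Cinf_ext. Qed.

Lemma lin_CinfD (eps eps' : section db) : lin_Cinf (eps + eps') = lin_Cinf eps + lin_Cinf eps'.
Proof. exact: Cinf_ext. Qed.

Lemma lin_CinfZ f (eps : section db) : lin_Cinf (f *: eps) = pull f * lin_Cinf eps.
Proof. exact: Cinf_ext. Qed.

Lemma lin_CinfN (eps : section db) : lin_Cinf (- eps) = - lin_Cinf eps.
Proof.
apply: Cinf_ext => -[m x].
by rewrite -[LHS]/((- eps) m x) secNE dualNE.
Qed.

Lemma lin_CinfB (eps eps' : section db) :
  lin_Cinf (eps - eps') = lin_Cinf eps - lin_Cinf eps'.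
Proof. by rewrite lin_CinfD lin_CinfN. Qed.

Lemma lin_Cinf_sum (I : Type) (r : seq I) (F : I -> section db) :
  lin_Cinf (\sum_(i <- r) F i) = \sum_(i <- r) lin_Cinf (F i).
Proof. by apply: (big_morph _ lin_CinfD); exact: Cinf_ext. Qed.

Lemma lin_Cinf_inj (eps eps' : section db) : lin_Cinf eps = lin_Cinf eps' -> eps = eps'.
Proof.
move=> h; apply: section_ext => m; apply: dual_ext => x.
by have := congr1 (fun F : Cinf tot => F (pt x)) h.
Qed.

Lemma pull_sec_pull (s : section vb) f : pull_sec s (pull f) = f.
Proof. exact: Cinf_ext. Qed.

Lemma vertical_vlift m (x : E m) (v : tangent (pt x : tot)) :
  (forall f, v (pull f) = 0) -> exists y, v = vlift x y.
Proof.
move=> v0; have [I [chi [a [s [c1 sa EE]]]]] := framed_dual E m.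
have Llin r (x0 y : dual (E m)) : \sum_i a i m (r *: x0 + y) * v (lin_Cinf (s i)) =
    r * (\sum_i a i m x0 * v (lin_Cinf (s i))) + \sum_i a i m y * v (lin_Cinf (s i)).
  rewrite mulr_sumr -big_split; apply: eq_bigr => i _ /=.
  by rewrite dual_linear mulrDl mulrA.
have [y yP] := framed_bidual (V := vb) (p := m) (Dual Llin) (framed_vec E).
exists y; apply: total_tangent_ext => [f|eps].
  by rewrite v0 vlift_pull.
rewrite vlift_lin -yP /=.
pose fi i := MkCinf (sa i eps).
have Ee : chi *: eps = \sum_i fi i *: s i.
  by apply: section_ext => z; rewrite sec_sumE secZE EE.
have := congr1 (fun e => v (lin_Cinf e)) Ee.
rewrite lin_CinfZ tangent_leibniz v0 mul0r addr0 /= c1 mul1r => ->.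
rewrite lin_Cinf_sum tangent_sumE; apply: eq_bigr => i _.
by rewrite lin_CinfZ tangent_leibniz v0 mul0r addr0.
Qed.

Lemma dproj_vlift m (x y : E m) : dproj (vlift x y) = 0.
Proof. by apply: tangent_ext => f; rewrite -[LHS]/(vlift x y (pull f)) vlift_pull. Qed.

Lemma dsec_linear (s : section vb) m a (X Y : tangent m) :
  dsec s (a *: X + Y) = a *: dsec s X + dsec s Y.
Proof. exact: tangent_ext. Qed.

Lemma dual_basic m (x : E m) (th : dual (tangent (pt x : tot))) :
  (forall y, th (vlift x y) = 0) -> exists th', th = dproj_t x th'.
Proof.
move=> h; have [s e] := framed_ext (framed_vec E) x; subst x.
have lin a (X Y : tangent m) : th (dsec s (a *: X + Y)) =
    a * th (dsec s X) + th (dsec s Y).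
  by rewrite dsec_linear dual_linear.
exists (Dual lin); apply: dual_ext => v /=.
apply/eqP; rewrite -subr_eq0 -dual_linB; apply/eqP.
have [f|y ->] := @vertical_vlift m (s m) (v - dsec s (dproj v)); last exact: h.
rewrite tanBE -[dsec s (dproj v) (pull f)]/(dproj v (pull_sec s (pull f))).
by rewrite pull_sec_pull subrr.
Qed.

Lemma ker_side_proj m (x : E m) (xi : TTs E (pt x)) :
  side_proj xi = 0 -> exists tau : core E m, xi = core_lift x tau.
Proof.
move=> h.
have h1 : dproj xi.1 = 0 :> tangent m by have := congr1 fst h.
have h2 : dual_proj xi.2 = 0 by have := congr1 snd h.
have [f|y yP] := @vertical_vlift m x xi.1.
  by have := congr1 (fun v : tangent m => v f) h1.
have [y'|th thP] := @dual_basic m x xi.2.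
  by have := congr1 (fun v : dual (E m) => v y') h2.
by exists (y, th); rewrite [xi]surjective_pairing yP thP.
Qed.

Section HorizontalLiftSpec.
Context (D : dorfman E).

Definition hor_spec nu m (x : E m) (xi : TTs E (pt x)) : Prop :=
  [/\ forall f, xi.1 (pull f) = (nu m).1 f,
      forall eps, xi.1 (lin_Cinf eps) = (dull D nu (spair 0 eps) m).2 x &
      forall (v : tangent (pt x : tot)) (Y : section TM), Y m = dproj v ->
        xi.2 v = v (lin_Cinf (ssnd nu)) + (dull D nu (spair Y 0) m).2 x].

Lemma pairing_vec nu (e : section vb) : pairing nu (spair e 0) = ev (ssnd nu) e.
Proof.
apply: Cinf_ext => m; rewrite pairingE /ppair /=.
by rewrite addr0.
Qed.

Lemma hlift_spec nu (e : section vb) m : hor_spec nu (hlift D nu e m).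
Proof.
have DE mu : pairing mu (D nu (spair e 0)) =
  pr_act nu (ev (ssnd mu) e) - ev (ssnd (dull D nu mu)) e.
  by rewrite pairing_dorf !pairing_vec.
have hE : hlift D nu e m =
    (dsec e (nu m).1 - vlift (e m) (D nu (spair e 0) m).1,
     covec (lin_Cinf (ssnd nu)) (pt (e m)) - dproj_t (e m) (D nu (spair e 0) m).2).
  by [].
rewrite hE; split.
- move=> f; rewrite tanBE vlift_pull subr0.
  by rewrite -[LHS]/((nu m).1 (pull_sec e (pull f))) pull_sec_pull.
- move=> eps; rewrite tanBE vlift_lin.
  have := congr1 (fun F : Cinf M => F m) (DE (spair 0 eps)).
  rewrite pairingE /ppair [LHS]/= dual_lin0 addr0 => ->.
  rewrite -[_ (lin_Cinf eps)]/((nu m).1 (ev eps e)).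
  rewrite (_ : _ m = (nu m).1 (ev eps e) - (dull D nu (spair 0 eps) m).2 (e m)).
    by rewrite subKr.
  by rewrite ssnd_pair.
- move=> v Y Ym; rewrite dualBE; congr (_ + _).
  have := congr1 (fun F : Cinf M => F m) (DE (spair Y 0)).
  rewrite pairingE /ppair [LHS]/= add0r Ym.
  rewrite -[(D _ _ m).2 _]/(dproj_t (e m) (D nu (spair e 0) m).2 v) => ->.
  rewrite ssnd_pair (_ : _ m = - (dull D nu (spair Y 0) m).2 (e m)) ?opprK //.
  rewrite (_ : ev 0 e = 0); last exact: Cinf_ext.
  rewrite -[LHS]/((nu m).1 0 + (- ev (ssnd (dull D nu (spair Y 0))) e) m) tangent0.
  by rewrite add0r.
Qed.

End HorizontalLiftSpec.

End HorizontalLift.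

Section LiftedSections.
Context {R : realType} {n k : nat} {M : manifold R n} (E : vbundle M k).
Local Notation TM := (tangent_bundle M).
Local Notation TsM := (cotangent_bundle M).
Local Notation vb := (vec_bundle E).
Local Notation S := (section (side E)).
Local Notation T := (section (core E)).
Local Notation tot := (Defs.total E).
Local Notation pull := (pull_proj E).

Lemma side_proj_core m (x : E m) (tau : core E m) : side_proj (core_lift x tau) = 0.
Proof.
congr pair; first exact: dproj_vlift.
by apply: dual_ext => y; rewrite /= dproj_vlift dual_lin0.
Qed.

Lemma side_proj_linear m (x : E m) a (xi eta : TTs E (pt x)) :
  side_proj (a *: xi + eta) = a *: side_proj xi + side_proj eta.
Proof. by congr pair; [exact: tangent_ext|exact: dual_ext]. Qed.

Lemma side_projD m (x : E m) (xi eta : TTs E (pt x)) :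
  side_proj (xi + eta) = side_proj xi + side_proj eta.
Proof. by have := side_proj_linear 1 xi eta; rewrite !scale1r. Qed.

Lemma side_projB m (x : E m) (xi eta : TTs E (pt x)) :
  side_proj (xi - eta) = side_proj xi - side_proj eta.
Proof. by have := side_proj_linear (-1) eta xi; rewrite !scaleN1r addrC => ->; rewrite addrC. Qed.

Lemma core_lift_linear m (x : E m) a (y z : core E m) :
  core_lift x (a *: y + z) = a *: core_lift x y + core_lift x z.
Proof.
congr pair; first exact: vlift_linear.
exact: dual_ext.
Qed.

Lemma core_lift0 m (x : E m) : core_lift x 0 = 0.
Proof.
have := core_lift_linear x (-1) 0 0.
by rewrite scaler0 addr0 scaleN1r addNr.
Qed.

Lemma core_liftD m (x : E m) (y z : core E m) :
  core_lift x (y + z) = core_lift x y + core_lift x z.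
Proof. by have := core_lift_linear x 1 y z; rewrite !scale1r. Qed.

Lemma core_liftZ m (x : E m) a (y : core E m) :
  core_lift x (a *: y) = a *: core_lift x y.
Proof. by have := core_lift_linear x a y 0; rewrite core_lift0 !addr0. Qed.

Lemma core_liftN m (x : E m) (y : core E m) : core_lift x (- y) = - core_lift x y.
Proof. by rewrite -scaleN1r core_liftZ scaleN1r. Qed.

Lemma std_pairing_core m (x : E m) (tau : core E m) (xi : TTs E (pt x)) :
  std_pairing xi (core_lift x tau) = ppair (side_proj xi) tau.
Proof. by []. Qed.

Lemma smooth_vlift (s : section vb) :
  @smooth_sec _ _ _ (tangent_bundle tot)
    (@over_total _ _ _ _ E (tangent_bundle tot) (fun m x => vlift x (s m))).
Proof.
apply: total_tangent_smooth => f.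
  have := CinfP (0 : Cinf tot); congr smooth_fun; apply/funext => -[m x] /=.
  by rewrite -[RHS]/(vlift x (s m) (pull f)) vlift_pull.
have := CinfP (pull (ev f s)); congr smooth_fun; apply/funext => -[m x].
by rewrite -[RHS]/(vlift x (s m) (lin_Cinf f)) vlift_lin.
Qed.

Definition vliftS (s : section vb) : section (tangent_bundle tot) :=
  MkSection (smooth_vlift s).

Lemma smooth_dproj_t (th : section TsM) :
  @smooth_sec _ _ _ (cotangent_bundle tot)
    (@over_total _ _ _ _ E (cotangent_bundle tot) (fun m x => dproj_t x (th m))).
Proof.
move=> Z; apply: smooth_fun_loc => -[p x0].
have [I [chi [F [X [c1 EF]]]]] := tangent_frame1 p.
exists (pull chi); first by rewrite /= c1 oner_neq0.
have := CinfP (\sum_i vact Z (pull (F i)) * pull (feval th (X i))).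
congr smooth_fun; apply/funext => -[m x]; rewrite Csum_eval.
rewrite -[RHS]/(chi m * th m (dproj (Z (pt x)))) -dual_linZ EF dual_lin_sum.
by apply: eq_bigr => i _; rewrite dual_linZ.
Qed.

Definition coreS (tau : T) : section (TTs E) :=
  spair (vliftS (sfst tau)) (MkSection (smooth_dproj_t (ssnd tau))).

Lemma coreSE (tau : T) m (x : E m) : coreS tau (pt x) = core_lift x (tau m).
Proof. by []. Qed.

Section HorizontalSections.
Context (D : dorfman E).
Local Notation dl := (dull D).

Lemma pr_act1 (nu : S) : pr_act nu 1 = 0.
Proof. exact: (pr_act_cst nu 1). Qed.

Lemma dullDr nu mu mu' : dl nu (mu + mu') = dl nu mu + dl nu mu'.
Proof.
have := bracket_leibr (dull_bracketP D) 1 nu mu mu'.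
by rewrite !scale1r pr_act1 scale0r addr0.
Qed.

Lemma dull0r nu : dl nu 0 = 0.
Proof. by apply: (addrI (dl nu 0)); rewrite -dullDr !addr0. Qed.

Lemma dullZr f nu mu : dl nu (f *: mu) = f *: dl nu mu + pr_act nu f *: mu.
Proof.
have := bracket_leibr (dull_bracketP D) f nu mu 0.
by rewrite dull0r !addr0.
Qed.

Lemma dullDl nu nu' mu : dl (nu + nu') mu = dl nu mu + dl nu' mu.
Proof.
have := bracket_linl (dull_bracketP D) 1 nu nu' mu.
by rewrite -[Ccst 1]/(1 : Cinf M) !scale1r.
Qed.

Lemma dullZl f nu mu : dl (f *: nu) mu = f *: dl nu mu - pr_act mu f *: nu.
Proof. exact: (bracket_leibl (dull_bracketP D)). Qed.

Lemma dull_split nu (mu : S) :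
  dl nu mu = dl nu (spair (sfst mu) 0) + dl nu (spair 0 (ssnd mu)).
Proof.
rewrite -dullDr; congr (dl nu _); apply: spair_ext.
  by rewrite sfstD !sfst_pair addr0.
by rewrite ssndD !ssnd_pair add0r.
Qed.

Lemma hor_uniq nu m (x : E m) (xi eta : TTs E (pt x)) :
  hor_spec D nu xi -> hor_spec D nu eta -> xi = eta.
Proof.
move=> [a1 a2 a3] [b1 b2 b3].
rewrite [xi]surjective_pairing [eta]surjective_pairing; congr pair.
  by apply: total_tangent_ext => f; rewrite ?a1 ?b1 ?a2 ?b2.
apply: dual_ext => v.
have [Y Yv] := framed_ext (@framed_tangent _ _ M) (dproj v : tangent m).
by rewrite (a3 v Y Yv) (b3 v Y Yv).
Qed.

Definition hor (nu : S) m (x : E m) : TTs E (pt x) := xget 0 [set xi | hor_spec D nu xi].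

Lemma horP nu m (x : E m) : hor_spec D nu (hor nu x).
Proof.
rewrite /hor; case: xgetP => [y _ //|h].
have [s e] := framed_ext (framed_vec E) x; subst x.
by case: (h (hlift D nu s m)); exact: hlift_spec.
Qed.

Lemma hlift_hor nu (s : section vb) m : hlift D nu s m = hor nu (s m).
Proof. exact: hor_uniq (hlift_spec _ _ _ _) (horP _ _). Qed.

Lemma hor_linear f (nu nu' : S) m (x : E m) :
  hor (f *: nu + nu') x = f m *: hor nu x + hor nu' x.
Proof.
apply: hor_uniq (horP _ _) _.
have [a1 a2 a3] := horP nu x; have [b1 b2 b3] := horP nu' x.
split.
- by move=> g; rewrite -[LHS]/(f m * (hor nu x).1 (pull g) + (hor nu' x).1 (pull g)) a1 b1.
- move=> eps; rewrite -[LHS]/(f m * (hor nu x).1 (lin_Cinf eps) + (hor nu' x).1 (lin_Cinf eps)).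
  rewrite a2 b2 dullDl dullZl.
  have -> : pr_act (spair 0 eps : S) f = 0 by exact: Cinf_ext.
  by rewrite scale0r subr0.
- move=> v Y Yv; rewrite -[LHS]/(f m * (hor nu x).2 v + (hor nu' x).2 v).
  rewrite (a3 _ _ Yv) (b3 _ _ Yv).
  rewrite ssndD ssndZ lin_CinfD lin_CinfZ tangentD tangent_leibniz.
  have vf : v (pull f) = Y m f by rewrite Yv.
  have -> : (dl (f *: nu + nu') (spair Y 0) m).2 x =
      f m * (dl nu (spair Y 0) m).2 x - Y m f * (nu m).2 x + (dl nu' (spair Y 0) m).2 x.
    rewrite dullDl dullZl !secDE secNE.
    rewrite -[LHS]/(f m * (dl nu (spair Y 0) m).2 x + (- (Y m f *: (nu m).2)) x +
      (dl nu' (spair Y 0) m).2 x).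
    by rewrite dualNE.
  rewrite vf -[pull f (pt x)]/(f m) -[lin_Cinf (ssnd nu) (pt x)]/((nu m).2 x).
  move: (f m) (v (lin_Cinf (ssnd nu))) (v (lin_Cinf (ssnd nu'))) (Y m f) ((nu m).2 x)
    ((dl nu (spair Y 0) m).2 x) ((dl nu' (spair Y 0) m).2 x) => a b c d e g h.
  by ring.
Qed.

Lemma hor0 m (x : E m) : hor 0 x = 0.
Proof.
have := hor_linear (-1) 0 0 x; rewrite scaler0 addr0.
by rewrite -[(-1 : Cinf M) m]/(-1 : R) scaleN1r addNr.
Qed.

Lemma horD nu nu' m (x : E m) : hor (nu + nu') x = hor nu x + hor nu' x.
Proof. by have := hor_linear 1 nu nu' x; rewrite !scale1r. Qed.

Lemma horZ f nu m (x : E m) : hor (f *: nu) x = f m *: hor nu x.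
Proof. by have := hor_linear f nu 0 x; rewrite hor0 !addr0. Qed.

Lemma hor_sum (I : Type) (r : seq I) (F : I -> S) m (x : E m) :
  hor (\sum_(i <- r) F i) x = \sum_(i <- r) hor (F i) x.
Proof.
apply: (big_morph (fun nu => hor nu x)); last exact: hor0.
by move=> nu nu'; exact: horD.
Qed.

Lemma side_proj_hor (nu : S) m (x : E m) : side_proj (hor nu x) = nu m.
Proof.
have [a1 a2 a3] := horP nu x.
rewrite [nu m]surjective_pairing; congr pair.
  by apply: tangent_ext => f; exact: a1.
apply: dual_ext => y; rewrite [LHS]/= (a3 _ 0); last by rewrite dproj_vlift.
rewrite vlift_lin (_ : spair 0 0 = 0 :> S) ?dull0r ?addr0 //.
exact: section_ext.
Qed.

Lemma hor_pt (nu nu' : S) m (x : E m) : nu m = nu' m -> hor nu x = hor nu' x.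
Proof.
move=> h; apply/eqP; rewrite -subr_eq0; apply/eqP.
have -> : hor nu x - hor nu' x = hor (nu - nu') x.
  by rewrite -[nu - nu']addrC -scaleN1r hor_linear -[(-1 : Cinf M) m]/(-1 : R)
     scaleN1r addrC.
have [I [chi [a [s [c1 sa EE]]]]] := framed_side E m.
rewrite -[LHS]scale1r -c1 -horZ.
have -> : chi *: (nu - nu') = \sum_i MkCinf (sa i (nu - nu')) *: s i.
  by apply: section_ext => z; rewrite sec_sumE secZE EE.
rewrite hor_sum big1 // => i _.
rewrite horZ -[MkCinf _ m]/(a i m ((nu - nu') m)) secBE h subrr dual_lin0.
by rewrite scale0r.
Qed.

Lemma hor_core_decomp m (x : E m) (xi : TTs E (pt x)) :
  exists (nu : S) (tau : core E m), xi = hor nu x + core_lift x tau.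
Proof.
have [nu nuP] := framed_ext (framed_side E) (side_proj xi).
have [|tau tauP] := @ker_side_proj _ _ _ _ E m x (xi - hor nu x).
  by rewrite side_projB side_proj_hor nuP subrr.
by exists nu, tau; rewrite -tauP addrC subrK.
Qed.

Lemma smooth_hor1 nu : @smooth_sec _ _ _ (tangent_bundle tot)
    (@over_total _ _ _ _ E (tangent_bundle tot) (fun m x => (hor nu x).1)).
Proof.
apply: total_tangent_smooth => f.
  have := CinfP (pull (pr_act nu f)); congr smooth_fun; apply/funext => -[m x].
  by have [a1 _ _] := horP nu x; rewrite -[RHS]/((hor nu x).1 (pull f)) a1.
have := CinfP (lin_Cinf (ssnd (dl nu (spair 0 f)))).
congr smooth_fun; apply/funext => -[m x].
by have [_ a2 _] := horP nu x; rewrite -[RHS]/((hor nu x).1 (lin_Cinf f)) a2.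
Qed.

Lemma dull_vfZ nu f (Y : section TM) m (x : E m) :
  (dl nu (spair (f *: Y) 0) m).2 x = f m * (dl nu (spair Y 0) m).2 x.
Proof.
have -> : spair (f *: Y) 0 = f *: (spair Y 0 : S).
  by apply: spair_ext; rewrite ?sfstZ ?ssndZ ?sfst_pair ?ssnd_pair ?scaler0.
rewrite dullZr secDE !secZE.
rewrite -[LHS]/(f m * (dl nu (spair Y 0) m).2 x + pr_act nu f m * (0 : dual (E m)) x).
by rewrite -[(0 : dual (E m)) x]/(0 : R) mulr0 addr0.
Qed.

Lemma dull_vf_sum nu (I : Type) (r : seq I) (F : I -> section TM) m (x : E m) :
  (dl nu (spair (\sum_(i <- r) F i) 0) m).2 x =
  \sum_(i <- r) (dl nu (spair (F i) 0) m).2 x.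
Proof.
pose phi (Y : section TM) := (dl nu (spair Y 0) m).2 x.
apply: (big_morph phi) => [Y Y'|].
  rewrite /phi (_ : spair (Y + Y') 0 = spair Y 0 + (spair Y' 0 : S)) ?dullDr //.
  by apply: spair_ext; rewrite ?sfstD ?ssndD ?sfst_pair ?ssnd_pair ?addr0.
by rewrite /phi (_ : spair 0 0 = 0 :> S) ?dull0r //; exact: section_ext.
Qed.

Lemma smooth_hor2 nu : @smooth_sec _ _ _ (cotangent_bundle tot)
    (@over_total _ _ _ _ E (cotangent_bundle tot) (fun m x => (hor nu x).2)).
Proof.
move=> Z; apply: smooth_fun_loc => -[p x0].
have [I [chi [F [X [c1 EF]]]]] := tangent_frame1 p.
exists (pull chi); first by rewrite /= c1 oner_neq0.
have := CinfP (pull chi * vact Z (lin_Cinf (ssnd nu)) +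
  \sum_i vact Z (pull (F i)) * lin_Cinf (ssnd (dl nu (spair (X i) 0)))).
congr smooth_fun; apply/funext => -[m x].
rewrite -[RHS]/(chi m * (hor nu x).2 (Z (pt x))).
have [_ _ a3] := horP nu x.
pose Y := \sum_i Ccst (Z (pt x) (pull (F i))) *: X i.
rewrite -dual_linZ (a3 _ Y); last first.
  transitivity (chi m *: (dproj (Z (pt x)) : tangent m)); last exact: tangent_ext.
  by rewrite /Y sec_sumE EF; apply: eq_bigr => i _.
rewrite -[LHS]/(chi m * Z (pt x) (lin_Cinf (ssnd nu)) +
  (\sum_i vact Z (pull (F i)) * lin_Cinf (ssnd (dl nu (spair (X i) 0)))) (pt x)).
rewrite Csum_eval /Y dull_vf_sum tanZE; congr (_ + _).
by apply: eq_bigr => i _; rewrite dull_vfZ.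
Qed.

Definition horS (nu : S) : section (TTs E) :=
  spair (MkSection (smooth_hor1 nu)) (MkSection (smooth_hor2 nu)).

Lemma horSE nu m (x : E m) : horS nu (pt x) = hor nu x.
Proof. by rewrite [RHS]surjective_pairing. Qed.

Lemma horS_pull nu f : vact (sfst (horS nu)) (pull f) = pull (pr_act nu f).
Proof. by apply: Cinf_ext => -[m x] /=; have [a1 _ _] := horP nu x; rewrite a1. Qed.

Lemma horS_lin nu eps :
  vact (sfst (horS nu)) (lin_Cinf eps) = lin_Cinf (ssnd (dl nu (spair 0 eps))).
Proof. by apply: Cinf_ext => -[m x] /=; have [_ a2 _] := horP nu x; rewrite a2. Qed.

End HorizontalSections.

Lemma hor_pairing (D D' : dorfman E) (nu mu : S) m (x : E m) :
  std_pairing (hor D' nu x) (hor D mu x) = ((dull D' nu mu + dull D mu nu) m).2 x.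
Proof.
have [a1 a2 a3] := horP D' nu x; have [b1 b2 b3] := horP D mu x.
have dm : sfst mu m = dproj (hor D mu x).1.
  by have := congr1 fst (side_proj_hor D mu x).
have dn : sfst nu m = dproj (hor D' nu x).1.
  by have := congr1 fst (side_proj_hor D' nu x).
rewrite /std_pairing (a3 _ _ dm) (b3 _ _ dn) a2 b2.
rewrite (dull_split D' nu mu) (dull_split D mu nu) !secDE.
set A := (dull D mu (spair 0 _) m).2 x; set B := (dull D' nu (spair _ 0) m).2 x.
set C := (dull D' nu (spair 0 _) m).2 x; set F := (dull D mu (spair _ 0) m).2 x.
by rewrite -[RHS]/(B + C + (F + A)); ring.
Qed.

Lemma hor_isotropic (D : dorfman E) (nu mu : S) m (x : E m) : dorf_skew D ->
  std_pairing (hor D nu x) (hor D mu x) = 0.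
Proof. by move=> sk; rewrite hor_pairing (sk nu mu) addNr. Qed.

End LiftedSections.

(** * The Courant and Nijenhuis tensors *)

Section Courant.
Context {R : realType} {n : nat} {M : manifold R n}.
Local Notation TM := (tangent_bundle M).
Local Notation TsM := (cotangent_bundle M).
Local Notation S := (section (bsum TM TsM)).
Implicit Types (f : Cinf M) (X Y Z : section TM) (w : section TsM) (s t r : S).

Lemma fevalDr w X Y : feval w (X + Y) = feval w X + feval w Y.
Proof. by apply: Cinf_ext => m; apply: dual_linD. Qed.

Lemma fevalZr w f X : feval w (f *: X) = f * feval w X.
Proof. by apply: Cinf_ext => m; apply: dual_linZ. Qed.

Lemma fevalNr w X : feval w (- X) = - feval w X.
Proof. by rewrite -scaleN1r fevalZr mulN1r. Qed.

Lemma fevalDl w w' X : feval (w + w') X = feval w X + feval w' X.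
Proof. exact: Cinf_ext. Qed.

Lemma fevalZl f w X : feval (f *: w) X = f * feval w X.
Proof. exact: Cinf_ext. Qed.

Lemma fevalBl w w' X : feval (w - w') X = feval w X - feval w' X.
Proof. by apply: Cinf_ext => m; rewrite -[LHS]/((w - w') m (X m)) secBE dualBE. Qed.

Lemma lie_anti X Y : lie Y X = - lie X Y.
Proof. by apply: vfield_ext => f; rewrite vactNl !vact_lie opprB. Qed.

Lemma lie_linr X f Y Z : lie X (f *: Y + Z) = f *: lie X Y + vact X f *: Y + lie X Z.
Proof.
apply: vfield_ext => g.
by rewrite !(vact_lie, vactDl, vactZl, vactD, vactM); ring.
Qed.

Lemma lieDr X Y Z : lie X (Y + Z) = lie X Y + lie X Z.
Proof. by apply: vfield_ext => f; rewrite !(vact_lie, vactDl, vactD); ring. Qed.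

Lemma lie0r X : lie X 0 = 0.
Proof. by apply: (addrI (lie X 0)); rewrite -lieDr !addr0. Qed.

Lemma feval0r w : feval w 0 = 0.
Proof. by apply: Cinf_ext => m; apply: dual_lin0. Qed.

Lemma form_rep (F : section TM -> Cinf M) :
  (forall f X Y, F (f *: X + Y) = f * F X + F Y) ->
  exists w, forall X, feval w X = F X.
Proof.
move=> Flin; have [eps FE] := framed_rep (@framed_tangent _ _ M) Flin.
have se : @smooth_sec _ _ _ TsM eps.
  move=> X; have := CinfP (F X); congr smooth_fun.
  by apply/funext => z; rewrite FE.
by exists (MkSection se) => X; apply: Cinf_ext => z; rewrite FE.
Qed.

Lemma lie_derivativeE X w Z :
  feval (lie_derivative X w) Z = vact X (feval w Z) - feval w (lie X Z).
Proof.
rewrite /lie_derivative; case: xgetP => [y _ /= ->//|h].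
have [f Y Y'|et etP] := @form_rep (fun Z => vact X (feval w Z) - feval w (lie X Z)).
  by rewrite lie_linr !(fevalDr, fevalZr, vactD, vactM); ring.
by case: (h et).
Qed.

Lemma contract_dE Y w Z : feval (contract_d Y w) Z =
  vact Y (feval w Z) - vact Z (feval w Y) - feval w (lie Y Z).
Proof.
rewrite /contract_d; case: xgetP => [y _ /= ->//|h].
have [f X X'|et etP] := @form_rep (fun Z =>
    vact Y (feval w Z) - vact Z (feval w Y) - feval w (lie Y Z)).
  by rewrite lie_linr !(fevalDr, fevalZr, vactD, vactM, vactDl, vactZl); ring.
by case: (h et).
Qed.

Definition sp s t : Cinf M := feval (ssnd s) (sfst t) + feval (ssnd t) (sfst s).

Lemma spE s t m : sp s t m = std_pairing (s m) (t m).
Proof. by []. Qed.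

Lemma spC s t : sp s t = sp t s.
Proof. by rewrite /sp addrC. Qed.

Lemma spDl s s' t : sp (s + s') t = sp s t + sp s' t.
Proof. by rewrite /sp sfstD ssndD fevalDl fevalDr; ring. Qed.

Lemma spZl f s t : sp (f *: s) t = f * sp s t.
Proof. by rewrite /sp sfstZ ssndZ fevalZl fevalZr; ring. Qed.

Lemma spNl s t : sp (- s) t = - sp s t.
Proof. by rewrite -scaleN1r spZl mulN1r. Qed.

Lemma spBl s s' t : sp (s - s') t = sp s t - sp s' t.
Proof. by rewrite spDl spNl. Qed.

Lemma spDr s t t' : sp s (t + t') = sp s t + sp s t'.
Proof. by rewrite spC spDl !(spC s). Qed.

Lemma spZr f s t : sp s (f *: t) = f * sp s t.
Proof. by rewrite spC spZl (spC s). Qed.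

Lemma std_pairingDr m (x y z : bsum TM TsM m) :
  std_pairing x (y + z) = std_pairing x y + std_pairing x z.
Proof.
case: y z => y1 y2 [z1 z2].
rewrite -[LHS]/(x.2 (y1 + z1) + (y2 x.1 + z2 x.1)) dual_linD.
exact: addrACA.
Qed.

Lemma std_pairing_nondeg m (x : bsum TM TsM m) :
  (forall y, std_pairing x y = 0) -> x = 0.
Proof.
case: x => v th h; congr pair.
  apply: tangent_ext => f.
  by have := h (0, covec f m); rewrite /std_pairing /= dual_lin0 add0r.
apply: dual_ext => w.
by have := h (w, 0); rewrite /std_pairing /= addr0.
Qed.

Lemma framed_courant : framed (bsum TM TsM).
Proof. by apply: framed_bsum; [exact: framed_tangent|exact: framed_cotangent]. Qed.

Lemma sp_nondeg s : (forall t, sp s t = 0) -> s = 0.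
Proof.
move=> h; apply: section_ext => m; apply: std_pairing_nondeg => y.
have [t <-] := framed_ext framed_courant y.
by rewrite -spE h.
Qed.

Definition courant3 s t r : Cinf M := sp (courant s t) r.

Lemma courant3E s t r : courant3 s t r =
  vact (sfst s) (feval (ssnd t) (sfst r)) - feval (ssnd t) (lie (sfst s) (sfst r))
  - vact (sfst t) (feval (ssnd s) (sfst r)) + vact (sfst r) (feval (ssnd s) (sfst t))
  + feval (ssnd s) (lie (sfst t) (sfst r)) + feval (ssnd r) (lie (sfst s) (sfst t)).
Proof.
by rewrite /courant3 /sp /courant sfst_pair ssnd_pair fevalBl lie_derivativeE contract_dE; ring.
Qed.

Lemma courant3_sym12 s t r :
  courant3 s t r + courant3 t s r = vact (sfst r) (sp s t).
Proof.
by rewrite !courant3E /sp vactD (lie_anti (sfst s) (sfst t)) fevalNr; ring.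
Qed.

Lemma courant3_sym23 s t r :
  courant3 s t r + courant3 s r t = vact (sfst s) (sp t r).
Proof.
by rewrite !courant3E /sp vactD (lie_anti (sfst t) (sfst r)) !fevalNr; ring.
Qed.

Lemma courant3_linr s t f r r' :
  courant3 s t (f *: r + r') = f * courant3 s t r + courant3 s t r'.
Proof. by rewrite /courant3 spDr spZr. Qed.

Definition spanning (G : S -> Prop) : Prop := forall p : M, exists (chi : Cinf M),
  chi p != 0 /\ forall s, exists (I : finType) (f : I -> Cinf M) (g : I -> S),
    (forall i, G (g i)) /\ chi *: s = \sum_i f i *: g i.

Lemma spanning_zero (G : S -> Prop) (F : S -> Cinf M) : spanning G ->
  (forall f s t, F (f *: s + t) = f * F s + F t) ->
  (forall s, G s -> F s = 0) -> forall s, F s = 0.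
Proof.
move=> sG Flin F0 s; apply: Cinf_ext => p.
have [chi [cp H]] := sG p; have [I [f [g [Gg E]]]] := H s.
have F00 : F 0 = 0.
  have h : F 0 + F 0 = F 0.
    by rewrite -[X in X + _]mul1r -Flin; congr F; rewrite scaler0 addr0.
  by apply: (addrI (F 0)); rewrite h addr0.
have FD x y : F (x + y) = F x + F y by have := Flin 1 x y; rewrite scale1r mul1r.
have FZ h x : F (h *: x) = h * F x by have := Flin h x 0; rewrite addr0 F00 addr0.
have : chi * F s = 0.
  rewrite -FZ E (big_morph F FD F00) big1 // => i _.
  by rewrite FZ F0 ?mulr0.
move=> /(congr1 (fun h : Cinf M => h p)) /= /eqP.
by rewrite mulf_eq0 (negbTE cp) => /eqP.
Qed.

Section Nijenhuis.
Context (J : vbmor (bsum TM TsM) (bsum TM TsM)).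
Context (J2 : forall m x, J m (J m x) = - x).
Context (Jorth : forall m x y, std_pairing (J m x) (J m y) = std_pairing x y).
Local Notation j := (vbsec J).

Lemma sp_orth s t : sp (j s) (j t) = sp s t.
Proof. by apply: Cinf_ext => m; rewrite !spE Jorth. Qed.

Lemma sp_skew s t : sp (j s) t = - sp s (j t).
Proof. by rewrite -sp_orth (vbsecK _ J2) spNl. Qed.

Definition nijenhuis3 s t r : Cinf M :=
  courant3 s t r - courant3 (j s) (j t) r - courant3 (j s) t (j r) - courant3 s (j t) (j r).

Lemma nijenhuis3E s t r : nijenhuis3 s t r =
  sp (courant s t - courant (j s) (j t) + j (courant (j s) t + courant s (j t))) r.
Proof. by rewrite spDl spBl sp_skew spDl /nijenhuis3 /courant3; ring. Qed.

Lemma nijenhuis3_integrable :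
  (forall s t, courant s t - courant (j s) (j t)
    + j (courant (j s) t + courant s (j t)) = 0) <->
  (forall s t r, nijenhuis3 s t r = 0).
Proof.
split=> [h s t r|h s t].
  by rewrite nijenhuis3E h; apply: Cinf_ext => m; rewrite spE /std_pairing /= dual_lin0 addr0.
by apply: sp_nondeg => r; rewrite -nijenhuis3E h.
Qed.

Lemma nijenhuis3_skew12 s t r : nijenhuis3 s t r = - nijenhuis3 t s r.
Proof.
apply/eqP; rewrite -subr_eq0 opprK; apply/eqP; rewrite /nijenhuis3.
transitivity ((courant3 s t r + courant3 t s r)
  - (courant3 (j s) (j t) r + courant3 (j t) (j s) r)
  - (courant3 (j s) t (j r) + courant3 t (j s) (j r))
  - (courant3 s (j t) (j r) + courant3 (j t) s (j r))); first by ring.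
by rewrite !courant3_sym12 sp_orth sp_skew vactN; ring.
Qed.

Lemma nijenhuis3_skew23 s t r : nijenhuis3 s t r = - nijenhuis3 s r t.
Proof.
apply/eqP; rewrite -subr_eq0 opprK; apply/eqP; rewrite /nijenhuis3.
transitivity ((courant3 s t r + courant3 s r t)
  - (courant3 (j s) (j t) r + courant3 (j s) r (j t))
  - (courant3 (j s) t (j r) + courant3 (j s) (j r) t)
  - (courant3 s (j t) (j r) + courant3 s (j r) (j t))); first by ring.
by rewrite !courant3_sym23 sp_orth sp_skew vactN; ring.
Qed.

Lemma nijenhuis3_linr s t f r r' :
  nijenhuis3 s t (f *: r + r') = f * nijenhuis3 s t r + nijenhuis3 s t r'.
Proof. by rewrite /nijenhuis3 vbsec_lin !courant3_linr; ring. Qed.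

Lemma nijenhuis3_zero (G : S -> Prop) : spanning G ->
  (forall s t r, G s -> G t -> G r -> nijenhuis3 s t r = 0) ->
  forall s t r, nijenhuis3 s t r = 0.
Proof.
move=> sG h.
have step s t : (forall r, G r -> nijenhuis3 s t r = 0) -> forall r, nijenhuis3 s t r = 0.
  by move=> h' r; apply: (spanning_zero sG (nijenhuis3_linr s t) h').
have h1 s t r : G s -> G t -> nijenhuis3 s t r = 0.
  by move=> Gs Gt; apply: step => r' Gr; apply: h.
have h2 s t r : G s -> nijenhuis3 s t r = 0.
  move=> Gs; apply: step => r' Gr.
  by rewrite nijenhuis3_skew23 h1 // oppr0.
move=> s t r; apply: step => r' Gr.
by rewrite nijenhuis3_skew23 nijenhuis3_skew12 h2 // !oppr0.
Qed.

End Nijenhuis.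

End Courant.

Section LinearCourant.
Context {R : realType} {n k : nat} {M : manifold R n} (E : vbundle M k).
Local Notation TM := (tangent_bundle M).
Local Notation vb := (vec_bundle E).
Local Notation db := (dual_bundle E).
Local Notation S := (section (side E)).
Local Notation T := (section (core E)).
Local Notation tot := (Defs.total E).
Local Notation pull := (pull_proj E).
Implicit Types (nu mu : S) (tau : T).

Definition projectable (V : section (tangent_bundle tot)) (Y : section TM) : Prop :=
  forall f, vact V (pull f) = pull (vact Y f).

Lemma projectable_dproj V Y m (x : E m) : projectable V Y -> Y m = dproj (V (pt x)).
Proof.
move=> h; apply: tangent_ext => f.
by have := congr1 (fun F : Cinf tot => F (pt x)) (h f).
Qed.

Lemma projectable_lie V V' Y Y' : projectable V Y -> projectable V' Y' ->
  projectable (lie V V') (lie Y Y').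
Proof.
move=> h h' f; rewrite !vact_lie h h' h h'.
by apply: Cinf_ext => -[].
Qed.

Lemma projectable_vlift e : projectable (vliftS e) 0.
Proof.
move=> f; apply: Cinf_ext => -[m x].
by rewrite -[LHS]/(vlift x (e m) (pull f)) vlift_pull.
Qed.

Lemma vliftS_lin e eps : vact (vliftS e) (lin_Cinf eps) = pull (ev eps e).
Proof.
apply: Cinf_ext => -[m x].
by rewrite -[LHS]/(vlift x (e m) (lin_Cinf eps)) vlift_lin.
Qed.

Lemma vliftS_pull e f : vact (vliftS e) (pull f) = 0.
Proof.
by rewrite projectable_vlift; apply: Cinf_ext => -[].
Qed.

Lemma sfst_coreS tau : sfst (coreS tau) = vliftS (sfst tau).
Proof. exact: sfst_pair. Qed.

Lemma coreS_eval tau V Y : projectable V Y ->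
  feval (ssnd (coreS tau)) V = pull (feval (ssnd tau) Y).
Proof.
move=> h; apply: Cinf_ext => -[m x].
rewrite -[LHS]/((tau m).2 (dproj (V (pt x)))).
by rewrite -(projectable_dproj x h).
Qed.

Section Generators.
Context (D : dorfman E).
Local Notation dl := (dull D).

Lemma horS_projectable nu : projectable (sfst (horS D nu)) (sfst nu).
Proof. exact: horS_pull. Qed.

Lemma horS_eval nu V Y : projectable V Y ->
  feval (ssnd (horS D nu)) V =
  vact V (lin_Cinf (ssnd nu)) + lin_Cinf (ssnd (dl nu (spair Y 0))).
Proof.
move=> h; apply: Cinf_ext => -[m x].
have [_ _ a3] := horP D nu x.
exact: (a3 _ _ (projectable_dproj x h)).
Qed.

Lemma dl_vf0 nu : dl nu (spair 0 0) = 0.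
Proof. by rewrite (_ : spair 0 0 = 0 :> S) ?dull0r //; exact: section_ext. Qed.

Lemma lin_Cinf0 : lin_Cinf (0 : section db) = 0.
Proof. exact: Cinf_ext. Qed.

Lemma pull0 : pull 0 = 0.
Proof. exact: Cinf_ext. Qed.

Lemma dl_fst nu mu : sfst (dl nu mu) = lie (sfst nu) (sfst mu).
Proof.
apply: vfield_ext => f.
by rewrite vact_lie; exact: (bracket_anchor (dull_bracketP D)).
Qed.

Lemma dl_ssnd_split nu mu :
  ssnd (dl nu mu) = ssnd (dl nu (spair (sfst mu) 0)) + ssnd (dl nu (spair 0 (ssnd mu))).
Proof. by rewrite {1}dull_split ssndD. Qed.

Lemma courant3_hor nu1 nu2 nu3 :
  courant3 (horS D nu1) (horS D nu2) (horS D nu3) =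
  lin_Cinf (ssnd (dl nu1 (dl nu2 nu3) - dl nu2 (dl nu1 nu3) + dl nu3 (dl nu1 nu2))).
Proof.
have P := horS_projectable.
have PL a b := projectable_lie (P a) (P b).
pose na nu (eps : section db) := ssnd (dl nu (spair 0 eps)).
pose be nu (Y : section TM) := ssnd (dl nu (spair Y 0)).
have naD nu a b : na nu (a + b) = na nu a + na nu b.
  rewrite /na -ssndD -dullDr; congr (ssnd (dl nu _)).
  by apply: spair_ext; rewrite ?sfstD ?ssndD ?sfst_pair ?ssnd_pair ?addr0.
have spl nu mu : ssnd (dl nu mu) = be nu (sfst mu) + na nu (ssnd mu).
  exact: dl_ssnd_split.
have linE nu eps : vact (sfst (horS D nu)) (lin_Cinf eps) = lin_Cinf (na nu eps).
  exact: horS_lin.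
have evE nu V Y : projectable V Y -> feval (ssnd (horS D nu)) V =
    vact V (lin_Cinf (ssnd nu)) + lin_Cinf (be nu Y).
  exact: horS_eval.
clearbody na be.
rewrite courant3E !(evE _ _ _ (P _)) !(evE _ _ _ (PL _ _)).
rewrite !vact_lie !vactD !linE.
by rewrite ssndD ssndB lin_CinfD lin_CinfB !spl !dl_fst !naD !lin_CinfD; ring.
Qed.

Lemma courant3_hor_core nu1 nu2 tau :
  courant3 (horS D nu1) (horS D nu2) (coreS tau) = pull (pairing (dl nu1 nu2) tau).
Proof.
have P := horS_projectable; have PV := projectable_vlift (sfst tau).
have PL a b := projectable_lie (P a) (P b).
have PLV a := projectable_lie (P a) PV.
have evE nu V : projectable V 0 -> feval (ssnd (horS D nu)) V = vact V (lin_Cinf (ssnd nu)).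
  by move=> h; rewrite (horS_eval _ h) dl_vf0 ssnd0 lin_Cinf0 addr0.
have PLV0 a : projectable (lie (sfst (horS D a)) (vliftS (sfst tau))) 0.
  by have := PLV a; rewrite lie0r.
rewrite courant3E sfst_coreS !(evE _ _ PV) !(evE _ _ (PLV0 _)) (horS_eval _ (P _)).
rewrite (coreS_eval _ (PL _ _)).
rewrite !vact_lie !vliftS_lin !horS_lin !vliftS_lin !vactD !vliftS_lin !horS_pull.
have -> : pairing (dl nu1 nu2) tau = ev (ssnd (dl nu1 nu2)) (sfst tau) +
    feval (ssnd tau) (lie (sfst nu1) (sfst nu2)).
  by rewrite -dl_fst.
rewrite (dl_ssnd_split nu1 nu2) evDl !pullD.
repeat match goal with |- context [pull ?x] =>
  let l := fresh "l" in generalize (pull x) => l end.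
by ring.
Qed.

Lemma lie_vlift (e e' : section vb) : lie (vliftS e) (vliftS e') = 0.
Proof.
apply: section_ext => z; apply: total_tangent_ext => f.
  have := congr1 (fun F : Cinf tot => F z)
    (vact_lie (vliftS e) (vliftS e') (pull f)).
  by rewrite !vliftS_pull [RHS]/= !tangent0 subrr.
have := congr1 (fun F : Cinf tot => F z)
    (vact_lie (vliftS e) (vliftS e') (lin_Cinf f)).
by rewrite !vliftS_lin !vliftS_pull /= subrr.
Qed.

Lemma courant3_core2 s tau tau' X : projectable (sfst s) X ->
  (forall e, exists f, feval (ssnd s) (vliftS e) = pull f) ->
  courant3 s (coreS tau) (coreS tau') = 0.
Proof.
move=> Ps hs; have PV e := projectable_vlift e.
have PLV e := projectable_lie Ps (PV e).
rewrite courant3E !sfst_coreS !(coreS_eval _ (PV _)) !(coreS_eval _ (PLV _)) lie0r !feval0r pull0.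
have [f ->] := hs (sfst tau); have [f' ->] := hs (sfst tau').
rewrite !vliftS_pull lie_vlift.
rewrite feval0r.
have -> : vact (sfst s) (0 : Cinf tot) = 0.
  by apply: Cinf_ext => z; rewrite /= tangent0.
by rewrite !subr0 !addr0.
Qed.

Lemma courant3_hor_core2 nu tau tau' :
  courant3 (horS D nu) (coreS tau) (coreS tau') = 0.
Proof.
apply: (courant3_core2 _ _ (horS_projectable nu)) => e.
exists (ev (ssnd nu) e).
by rewrite (horS_eval _ (projectable_vlift e)) dl_vf0 ssnd0 lin_Cinf0 addr0 vliftS_lin.
Qed.

Lemma courant3_core3 tau1 tau2 tau3 :
  courant3 (coreS tau1) (coreS tau2) (coreS tau3) = 0.
Proof.
have P : projectable (sfst (coreS tau1)) 0.
  by rewrite sfst_coreS; exact: projectable_vlift.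
apply: (courant3_core2 _ _ P) => e; exists 0.
rewrite (coreS_eval _ (projectable_vlift e)); congr pull.
exact: feval0r.
Qed.

Definition generator (s : section (TTs E)) : Prop :=
  (exists nu, s = horS D nu) \/ (exists tau, s = coreS tau).

Lemma sp_hor_core nu tau : sp (horS D nu) (coreS tau) = pull (pairing nu tau).
Proof.
apply: Cinf_ext => -[m x].
by rewrite spE horSE -[coreS _ _]/(core_lift x (tau m)) std_pairing_core side_proj_hor.
Qed.

Lemma sp_core tau tau' : sp (coreS tau) (coreS tau') = 0.
Proof.
apply: Cinf_ext => -[m x].
rewrite spE -[coreS tau' _]/(core_lift x (tau' m)) std_pairing_core.
by rewrite -[coreS tau _]/(core_lift x (tau m)) side_proj_core ppair0l.
Qed.

Lemma sp_hor nu mu : dorf_skew D -> sp (horS D nu) (horS D mu) = 0.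
Proof.
by move=> sk; apply: Cinf_ext => -[m x]; rewrite spE !horSE hor_isotropic.
Qed.

Lemma horS_linear f nu mu : horS D (f *: nu + mu) = pull f *: horS D nu + horS D mu.
Proof.
by apply: section_ext => -[m x]; rewrite secDE secZE !horSE hor_linear.
Qed.

Lemma horS_sum (I : finType) (f : I -> Cinf M) (F : I -> S) :
  horS D (\sum_i f i *: F i) = \sum_i pull (f i) *: horS D (F i).
Proof.
apply: section_ext => -[m x]; rewrite sec_sumE horSE hor_sum.
by apply: eq_bigr => i _; rewrite secZE horSE horZ.
Qed.

Lemma generator_nondeg (s : section (TTs E)) :
  (forall g, generator g -> sp s g = 0) -> s = 0.
Proof.
move=> h; apply: section_ext => -[m x]; apply: std_pairing_nondeg => y.
have [nu [tau0 ->]] := hor_core_decomp D y.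
have [tau tauE] := framed_ext (framed_core E) tau0.
have h1 := congr1 (fun F : Cinf tot => F (pt x)) (h _ (or_introl (ex_intro _ nu erefl))).
have h2 := congr1 (fun F : Cinf tot => F (pt x)) (h _ (or_intror (ex_intro _ tau erefl))).
move: h1 h2; rewrite !spE horSE -[coreS _ _]/(core_lift x (tau m)) tauE => h1 h2.
by rewrite std_pairingDr h1 h2 addr0.
Qed.

Lemma generator_spanning : dorf_skew D -> spanning generator.
Proof.
move=> sk [p x0]; have [I [chi [a [nu [c1 sa EE]]]]] := framed_side E p.
exists (pull chi); split; first by rewrite /= c1 oner_neq0.
have H i : exists tau : T, forall mu, MkCinf (sa i mu) = pairing mu tau.
  apply: core_rep => f s t; apply: Cinf_ext => z; apply: dual_linear.
pose tau i := projT1 (cid (H i)).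
have tauP i mu : MkCinf (sa i mu) = pairing mu (tau i).
  by rewrite /tau; case: cid.
move=> s; exists (I + I)%type,
  (fun i => match i with inl i => sp s (coreS (tau i)) | inr i => sp s (horS D (nu i)) end),
  (fun i => match i with inl i => horS D (nu i) | inr i => coreS (tau i) end).
split; first by case=> i; [left|right]; eexists.
have chiE mu : chi *: mu = \sum_i pairing mu (tau i) *: nu i.
  apply: section_ext => z; rewrite sec_sumE secZE EE.
  by apply: eq_bigr => i _; rewrite secZE -tauP.
have chiT t : chi *: t = \sum_i pairing (nu i) t *: tau i.
  apply: sec_core_ext => mu.
  rewrite pairingZr -pairingZl chiE.
  have L (F : I -> S) : pairing (\sum_i F i) t = \sum_i pairing (F i) t.
    apply: (big_morph (fun v => pairing v t)); first by move=> *; exact: pairingDl.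
    exact: pairing0l.
  have L' (F : I -> T) : pairing mu (\sum_i F i) = \sum_i pairing mu (F i).
    apply: (big_morph (pairing mu)); first by move=> *; exact: pairingDr.
    exact: pairing0r.
  rewrite (L (fun i => pairing mu (tau i) *: nu i)) (L' (fun i => pairing (nu i) t *: tau i)).
  by apply: eq_bigr => i _; rewrite pairingZl pairingZr mulrC.
apply/eqP; rewrite -subr_eq0; apply/eqP; apply: generator_nondeg => g Gg.
have sp0 t : sp 0 t = 0 by rewrite -{1}(scale0r t) spZl mul0r.
have Ls (J : finType) (F : J -> section (TTs E)) t : sp (\sum_i F i) t = \sum_i sp (F i) t.
  by apply: (big_morph (fun v => sp v t)); [move=> *; exact: spDl|exact: sp0].
have Lr (F : I -> section (TTs E)) t : sp t (\sum_i F i) = \sum_i sp t (F i).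
  by rewrite spC Ls; apply: eq_bigr => i _; rewrite spC.
rewrite spBl spZl Ls big_sumType /=.
apply/eqP; rewrite subr_eq0; apply/eqP.
case: Gg => [[mu ->]|[t ->]].
  have E1 : pull chi *: horS D mu = \sum_i pull (pairing mu (tau i)) *: horS D (nu i).
    rewrite -horS_sum -chiE; apply: section_ext => -[m x].
    by rewrite secZE !horSE horZ.
  rewrite -spZr E1 Lr [X in _ = X + _]big1 ?add0r; last first.
    by move=> i _; rewrite spZl sp_hor // mulr0.
  by apply: eq_bigr => i _; rewrite spZr spZl (spC (coreS _)) sp_hor_core mulrC.
have E1 : pull chi *: coreS t = \sum_i pull (pairing (nu i) t) *: coreS (tau i).
  apply: section_ext => -[m x]; rewrite sec_sumE secZE.
  transitivity (core_lift x ((chi *: t) m)); first by rewrite secZE core_liftZ.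
  rewrite chiT sec_sumE.
  rewrite (big_morph (core_lift x) (core_liftD x) (core_lift0 x)).
  by apply: eq_bigr => i _; rewrite secZE core_liftZ.
rewrite -spZr E1 Lr [X in _ = _ + X]big1 ?addr0; last first.
  by move=> i _; rewrite spZl sp_core mulr0.
by apply: eq_bigr => i _; rewrite spZr spZl sp_hor_core mulrC.
Qed.

End Generators.

End LinearCourant.

Section SideTranspose.
Context {R : realType} {n k : nat} {M : manifold R n} (E : vbundle M k).
Local Notation vb := (vec_bundle E).
Local Notation T := (section (core E)).
Context (j : vbmor (side E) (side E)).

Lemma ppair_rep m (L : dual (side E m)) : exists y : core E m, forall x, L x = ppair x y.
Proof.
have lin1 a (x y : dual (E m)) : L (0, a *: x + y) = a * L (0, x) + L (0, y).
  by rewrite -dual_linear; congr (L _); congr pair; rewrite /= scaler0 addr0.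
have lin2 a (x y : tangent m) : L (a *: x + y, 0) = a * L (x, 0) + L (y, 0).
  by rewrite -dual_linear; congr (L _); congr pair; rewrite /= scaler0 addr0.
have [y yP] := framed_bidual (V := vb) (p := m) (Dual lin1) (framed_vec E).
exists (y, Dual lin2) => -[X eta]; rewrite /ppair /= -yP /= -dual_linD.
by congr (L _); congr pair; rewrite /= ?addr0 ?add0r.
Qed.

Lemma transpose_exists m (y : core E m) : exists z : core E m,
  forall x, ppair (j m x) y = ppair x z.
Proof.
have lin a (x x' : side E m) : ppair (j m (a *: x + x')) y =
    a * ppair (j m x) y + ppair (j m x') y.
  by rewrite vb_linear ppair_linl.
exact: (ppair_rep (Dual lin)).
Qed.

Definition jt m (y : core E m) : core E m := projT1 (cid (transpose_exists y)).

Lemma jtP m (x : side E m) (y : core E m) : ppair x (jt y) = ppair (j m x) y.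
Proof. by rewrite /jt; case: cid. Qed.

Lemma jt_linear m a (y z : core E m) : jt (a *: y + z) = a *: jt y + jt z.
Proof. by apply: core_ext => x; rewrite jtP !ppair_linr !jtP. Qed.

Lemma jtD m (y z : core E m) : jt (y + z) = jt y + jt z.
Proof. by have := jt_linear 1 y z; rewrite !scale1r. Qed.

Lemma jtS_exists (tau : T) : exists tau' : T, forall m, tau' m = jt (tau m).
Proof.
have [f s t|tau' H] := @core_rep _ _ _ _ E (fun nu => pairing (vbsec j nu) tau).
  rewrite -pairingZl -pairingDl; congr (pairing _ tau).
  by apply: section_ext => m; apply: vb_linear.
exists tau' => m; apply: core_ext => x; rewrite jtP.
have [nu nuE] := framed_ext (framed_side E) x; subst x.
by have := congr1 (fun F : Cinf M => F m) (H nu).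
Qed.

Definition jtS (tau : T) : T := projT1 (cid (jtS_exists tau)).

Lemma jtSE tau m : jtS tau m = jt (tau m).
Proof. by rewrite /jtS; case: cid. Qed.

Lemma pairing_jtS nu tau : pairing nu (jtS tau) = pairing (vbsec j nu) tau.
Proof. by apply: Cinf_ext => m; rewrite !pairingE jtSE jtP. Qed.

End SideTranspose.

Section SideSum.
Context {R : realType} {n k : nat} {M : manifold R n} (E : vbundle M k).
Local Notation TM := (tangent_bundle M).
Local Notation S := (section (side E)).
Local Notation tot := (Defs.total E).
Local Notation pull := (pull_proj E).
Context (D : dorfman E).
Local Notation dl := (dull D).
Implicit Types (nu : S).

Lemma hor_core_pull nu m (x : E m) (tau : core E m) f :
  (hor D nu x + core_lift x tau).1 (pull f) = (nu m).1 f.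
Proof.
have [a1 _ _] := horP D nu x.
rewrite -[LHS]/((hor D nu x).1 (pull f) + vlift x tau.1 (pull f)).
by rewrite a1 vlift_pull addr0.
Qed.

Lemma hor_core_lin nu m (x : E m) (tau : core E m) eps :
  (hor D nu x + core_lift x tau).1 (lin_Cinf eps) =
  (dl nu (spair 0 eps) m).2 x + eps m tau.1.
Proof.
have [_ a2 _] := horP D nu x.
rewrite -[LHS]/((hor D nu x).1 (lin_Cinf eps) + vlift x tau.1 (lin_Cinf eps)).
by rewrite a2 vlift_lin.
Qed.

Lemma hor_core_covec nu m (x : E m) (tau : core E m) (v : tangent (pt x : tot))
    (Y : section TM) : Y m = dproj v ->
  (hor D nu x + core_lift x tau).2 v =
  v (lin_Cinf (ssnd nu)) + (dl nu (spair Y 0) m).2 x + tau.2 (Y m).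
Proof.
move=> Yv; have [_ _ a3] := horP D nu x.
rewrite -[LHS]/((hor D nu x).2 v + tau.2 (dproj v)).
by rewrite (a3 _ _ Yv) Yv.
Qed.

Lemma side_proj_hor_core nu m (x : E m) (tau : core E m) :
  side_proj (hor D nu x + core_lift x tau) = nu m.
Proof. by rewrite side_projD side_proj_hor side_proj_core addr0. Qed.

Lemma side_sum_hor nu m (x x' : E m) (tau tau' : core E m) :
  side_sum (hor D nu x + core_lift x tau) (hor D nu x' + core_lift x' tau')
    (hor D nu (x + x') + core_lift (x + x') (tau + tau')).
Proof.
split; rewrite ?side_proj_hor_core //.
  apply/tangent_sumP; split => [f|f|eps]; rewrite ?hor_core_pull //.
  rewrite !hor_core_lin !dual_linD.
  by rewrite addrACA.
move=> v v' u /tangent_sumP [h1 h2 h3].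
have [Y Yv] := framed_ext (@framed_tangent _ _ M) (dproj v : tangent m).
have Yv' : Y m = dproj v' by rewrite Yv; apply: tangent_ext => f; exact: h1.
have Yu : Y m = dproj u by rewrite Yv; apply: tangent_ext => f; exact: esym (h2 f).
rewrite (hor_core_covec _ _ Yv) (hor_core_covec _ _ Yv') (hor_core_covec _ _ Yu).
rewrite h3 dual_linD -[(tau + tau').2 _]/(tau.2 (Y m) + tau'.2 (Y m)).
by rewrite [in RHS]addrACA; congr (_ + _); rewrite [RHS]addrACA.
Qed.

Lemma side_scale_hor nu m (x : E m) r (tau : core E m) :
  side_scale (r := r) (hor D nu x + core_lift x tau)
    (hor D nu (r *: x) + core_lift (r *: x) (r *: tau)).
Proof.
split; rewrite ?side_proj_hor_core //.
  apply/tangent_scaleP; split => [f|eps]; rewrite ?hor_core_pull //.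
  by rewrite !hor_core_lin !dual_linZ mulrDr.
move=> v u /tangent_scaleP [h1 h2].
have [Y Yv] := framed_ext (@framed_tangent _ _ M) (dproj v : tangent m).
have Yu : Y m = dproj u by rewrite Yv; apply: tangent_ext => f; exact: esym (h1 f).
rewrite (hor_core_covec _ _ Yv) (hor_core_covec _ _ Yu).
by rewrite h2 dual_linZ -[(r *: tau).2 _]/(r * tau.2 (Y m)) !mulrDr.
Qed.

Lemma core_lift_inj m (x : E m) (tau tau' : core E m) :
  core_lift x tau = core_lift x tau' -> tau = tau'.
Proof.
move=> h; apply: core_ext => y.
have [nu nuE] := framed_ext (framed_side E) y; subst y.
by rewrite -(side_proj_hor D nu x) -!std_pairing_core h.
Qed.

(* The covectors of the sum are only tested against sums of tangent vectors,
   so uniqueness rests on the existence of horizontal ones over every X. *)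
Lemma side_sum_unique m (x x' : E m) xi xi' eta eta' :
  @side_sum _ _ _ _ E m x x' xi xi' eta -> side_sum xi xi' eta' -> eta = eta'.
Proof.
move=> [h1 h2 h3 h4] [g1 g2 g3 g4].
have e1 : eta.1 = eta'.1.
  move: h3 g3 => /tangent_sumP [a1 a2 a3] /tangent_sumP [b1 b2 b3].
  by apply: total_tangent_ext => f; rewrite ?a2 ?b2 ?a3 ?b3.
rewrite [eta]surjective_pairing [eta']surjective_pairing; congr pair => //.
apply: dual_ext => u.
have [nu [tau E1]] := hor_core_decomp D ((u, 0) : TTs E (pt (x + x'))).
have := side_sum_hor nu x x' tau 0; rewrite addr0 -E1 => -[_ _ ts _].
by rewrite (h4 _ _ _ ts) (g4 _ _ _ ts).
Qed.

Lemma side_scale_unique m (x : E m) r xi eta eta' :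
  @side_scale _ _ _ _ E m x r xi eta -> side_scale xi eta' -> eta = eta'.
Proof.
move=> [h1 h2 h3] [g1 g2 g3].
have e1 : eta.1 = eta'.1.
  move: h2 g2 => /tangent_scaleP [a1 a2] /tangent_scaleP [b1 b2].
  by apply: total_tangent_ext => f; rewrite ?a1 ?b1 ?a2 ?b2.
rewrite [eta]surjective_pairing [eta']surjective_pairing; congr pair => //.
apply: dual_ext => u.
have [nu [tau E1]] := hor_core_decomp D ((u, 0) : TTs E (pt (r *: x))).
have -> : u = (hor D nu (r *: x)).1 + vlift (r *: x) tau.1.
  by rewrite -[u]/(((u, 0) : TTs E (pt (r *: x))).1) E1.
have [_ ts _] := side_scale_hor nu x r 0.
rewrite scaler0 !core_lift0 !addr0 in ts.
rewrite !dual_linD (h3 _ _ ts) (g3 _ _ ts); congr (_ + _).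
have : (side_proj eta).2 = (side_proj eta').2 by rewrite h1 g1.
by move=> /(congr1 (fun L : dual (E m) => L tau.1)).
Qed.

Lemma side_sum_pairing m (x x' : E m) xi xi' eta ze ze' ka :
  @side_sum _ _ _ _ E m x x' xi xi' eta -> side_sum ze ze' ka ->
  std_pairing eta ka = std_pairing xi ze + std_pairing xi' ze'.
Proof.
move=> [_ _ t1 d1] [_ _ t2 d2]; rewrite /std_pairing (d1 _ _ _ t2) (d2 _ _ _ t1).
by rewrite addrACA.
Qed.

Lemma side_scale_pairing m (x : E m) r xi eta ze ka :
  @side_scale _ _ _ _ E m x r xi eta -> side_scale ze ka ->
  std_pairing eta ka = r * std_pairing xi ze.
Proof.
move=> [_ t1 d1] [_ t2 d2]; rewrite /std_pairing (d1 _ _ t2) (d2 _ _ t1).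
by rewrite mulrDr.
Qed.

End SideSum.

(** * The bracket on the side bundle *)

Section AlgebroidBracket.
Context {R : realType} {n k : nat} {M : manifold R n} (E : vbundle M k).
Local Notation S := (section (side E)).
Context (D : dorfman E) (j : vbmor (side E) (side E)).
Hypotheses (Dskew : dorf_skew D) (j2 : forall m x, j m (j m x) = - x).
Local Notation d := (dull D).
Local Notation i := (vbsec j).
Local Notation A := (bracketA j D).
Implicit Types (q r s : S) (f : Cinf M).

Lemma dullNr q r : d q (- r) = - d q r.
Proof. by apply/eqP; rewrite -addr_eq0 -dullDr addNr dull0r. Qed.

Lemma dullNl q r : d (- q) r = - d q r.
Proof. by rewrite Dskew dullNr -Dskew. Qed.

Lemma dullCr (a : R) q r : d q (Ccst a *: r) = Ccst a *: d q r.
Proof. by rewrite dullZr pr_act_cst scale0r addr0. Qed.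

Definition torsion q r : S := d q r - d (i q) (i r) + i (d (i q) r + d q (i r)).

Definition jacobiator q r s : S := d q (d r s) - d r (d q s) + d s (d q r).

Definition jacobiator_type q r s : S :=
  jacobiator q r s - jacobiator (i q) (i r) s
  - jacobiator (i q) r (i s) - jacobiator q (i r) (i s).

Lemma sfst_jacobiator q r s : sfst (jacobiator q r s) = 0.
Proof.
apply: vfield_ext => f; rewrite /jacobiator sfstD sfstB !dl_fst.
rewrite vactDl vactBl !vact_lie !vactB.
have -> : vact 0 f = 0 by apply: Cinf_ext.
by ring.
Qed.

Lemma sfst_jacobiator_type q r s : sfst (jacobiator_type q r s) = 0.
Proof. by rewrite /jacobiator_type !sfstB !sfst_jacobiator !subr0. Qed.

Lemma bracketAl q r : torsion q r = 0 -> A (i q) r = i (A q r).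
Proof.
move=> /(congr1 i); rewrite /torsion vbsecD vbsec0 (vbsecK _ j2) => /eqP.
rewrite subr_eq0 => /eqP h.
by rewrite /bracketA vbsecZ h (vbsecK _ j2) dullNl opprK addrC.
Qed.

Lemma bracketAZ f q r : A q (f *: r) =
  f *: A q r + Ccst 2^-1 *: (pr_act q f *: r - pr_act (i q) f *: i r).
Proof.
rewrite /bracketA vbsecZ !dullZr; apply: sec_side_ext => tau.
by rewrite !(pairingDl, pairingNl, pairingZl); ring.
Qed.

Lemma bracketA_skew q r : A q r = - A r q.
Proof. by rewrite /bracketA Dskew (Dskew (i q)) -opprD scalerN. Qed.

Lemma bracketADr q r s : A q (r + s) = A q r + A q s.
Proof. by rewrite /bracketA vbsecD !dullDr opprD addrACA scalerDr. Qed.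

Lemma bracketACr a q r : A q (Ccst a *: r) = Ccst a *: A q r.
Proof. by rewrite /bracketA vbsecZ !dullCr -scalerBr !scalerA mulrC. Qed.

Lemma bracketAir q r : torsion q r = 0 -> A q (i r) = i (A q r).
Proof.
move=> h; rewrite -bracketAl // /bracketA !(vbsecK _ j2) dullNr dullNl !opprK addrC //.
Qed.

Lemma bracketA_jacobi q r s : (forall x y, torsion x y = 0) ->
  A q (A r s) + A r (A s q) + A s (A q r) =
  Ccst 2^-1 *: (Ccst 2^-1 *: jacobiator_type q r s).
Proof.
move=> h.
have AA x y z : A x (A y z) = Ccst 2^-1 *: (Ccst 2^-1 *:
    (d x (d y z) - d x (d (i y) (i z)) - d (i x) (d (i y) z) - d (i x) (d y (i z)))).
  rewrite {1}/bracketA -bracketAl // /bracketA (vbsecK _ j2) dullNl opprK !dullCr !dullDr dullNr.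
  apply: sec_side_ext => tau.
  rewrite !(pairingDl, pairingNl, pairingZl).
  repeat match goal with |- context [pairing ?x tau] => move: (pairing x tau) => ? end.
  by move: (Ccst 2^-1) => ?; ring.
rewrite !AA /jacobiator_type /jacobiator.
rewrite (Dskew s q) (Dskew (i s) (i q)) (Dskew (i s) q) (Dskew s (i q)) !dullNr.
apply: sec_side_ext => tau.
rewrite !(pairingDl, pairingNl, pairingZl).
repeat match goal with |- context [pairing ?x tau] => move: (pairing x tau) => ? end.
by move: (Ccst 2^-1) => ?; ring.
Qed.

Lemma half2 : Ccst 2^-1 * (1 + 1) = 1 :> Cinf M.
Proof.
apply: Cinf_ext => x; rewrite -[LHS]/(2^-1 * (1 + 1)) -[RHS]/1.
by rewrite -[1 + 1]/(2%:R) mulVf ?pnatr_eq0.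
Qed.

Lemma half_inj q : Ccst 2^-1 *: q = 0 -> q = 0.
Proof.
move=> /(congr1 (fun x => (1 + 1 : Cinf M) *: x)).
by rewrite scalerA mulrC half2 scale1r scaler0.
Qed.

Lemma bracketA_complex_lie_algebroid :
  (forall q r, torsion q r = 0) -> (forall q r s, ssnd (jacobiator_type q r s) = 0) ->
  complex_lie_algebroid j A (rho j).
Proof.
move=> t0 J0.
have Alr a q r s : A q (Ccst a *: r + s) = Ccst a *: A q r + A q s.
  by rewrite bracketADr bracketACr.
split=> //.
- move=> a q r s; rewrite bracketA_skew Alr opprD -scalerN.
  by congr (_ *: _ + _); rewrite -bracketA_skew.
- by move=> q r; apply: bracketAl.
- by move=> q r; apply: bracketAir.
- exact: bracketA_skew.
- move=> q r s; rewrite bracketA_jacobi //.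
  have -> : jacobiator_type q r s = 0.
    by apply: spair_ext; rewrite ?J0 ?sfst_jacobiator_type; apply: section_ext.
  by rewrite !scaler0.
- move=> m x; rewrite /= /rho_vect /= j2 !subr0 !sub0r !scalerN opprK.
  by congr pair; rewrite opprK.
move=> q r f.
have e1 : sfst (vbsec (rho j) q) = Ccst 2^-1 *: sfst q.
  by apply: section_ext => m; rewrite /= subr0.
have e2 : ssnd (vbsec (rho j) q) = - (Ccst 2^-1 *: sfst (i q)).
  by apply: section_ext => m; rewrite secNE /= sub0r scalerN.
rewrite /cscale /cact e1 e2 bracketADr -vbsecZ bracketAir // !bracketAZ.
move: (A q r) => a.
rewrite vbsecD !vbsecZ (vbsecD _ (_ *: r)) vbsecN !vbsecZ (vbsecK _ j2) !vactNl !vactZl /=.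
rewrite /pr_act; apply: sec_side_ext => tau.
rewrite !(pairingDl, pairingNl, pairingZl).
repeat match goal with |- context [pairing ?x tau] => move: (pairing x tau) => ? end.
repeat match goal with |- context [vact ?x ?f] => move: (vact x f) => ? end.
by move: (Ccst 2^-1) => ? /=; ring.
Qed.

Lemma complex_lie_algebroid_tensors : complex_lie_algebroid j A (rho j) ->
  (forall q r, torsion q r = 0) /\ (forall q r s, ssnd (jacobiator_type q r s) = 0).
Proof.
case=> _ _ _ il ir _ jac _ _.
have t0 q r : torsion q r = 0.
  apply: half_inj; have := il q r; rewrite /bracketA (vbsecK _ j2) dullNl opprK.
  move=> /(congr1 i); rewrite (vbsecK _ j2) => /eqP; rewrite -subr_eq0 opprK => /eqP <-.
  by rewrite /torsion vbsecZ addrC scalerDr.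
split=> // q r s; have := jac q r s; rewrite bracketA_jacobi //.
by move=> /half_inj/half_inj ->; apply: section_ext.
Qed.

End AlgebroidBracket.

Section Integrability.
Context {R : realType} {n k : nat} {M : manifold R n} (E : vbundle M k).
Local Notation pull := (pull_proj E).
Context (J : vbmor (TTs E) (TTs E)) (j : vbmor (side E) (side E)) (D : dorfman E).
Hypotheses (J2 : forall e x, J e (J e x) = - x)
  (Jorth : forall e x y, std_pairing (J e x) (J e y) = std_pairing x y)
  (Dskew : dorf_skew D)
  (Jhor : forall nu, vbsec J (horS D nu) = horS D (vbsec j nu))
  (Jcore : forall tau, vbsec J (coreS tau) = coreS (- jtS j tau)).
Local Notation nij := (nijenhuis3 J).

Lemma nijenhuis3_hor nu1 nu2 nu3 :
  nij (horS D nu1) (horS D nu2) (horS D nu3) =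
  lin_Cinf (ssnd (jacobiator_type D j nu1 nu2 nu3)).
Proof.
by rewrite /nijenhuis3 !Jhor !courant3_hor /jacobiator_type !ssndB !lin_CinfB.
Qed.

Lemma nijenhuis3_hor_core nu1 nu2 tau :
  nij (horS D nu1) (horS D nu2) (coreS tau) = pull (pairing (torsion D j nu1 nu2) tau).
Proof.
rewrite /nijenhuis3 !Jhor !Jcore !courant3_hor_core.
rewrite /torsion !(pairingDl, pairingNl) -pairing_jtS pairingDl !pairingNr.
do 4 move: (pairing _ _) => ?.
apply: Cinf_ext => e.
rewrite -[LHS]/(_ - _ - (- _) - (- _)) !opprK addrA //.
Qed.

Lemma nijenhuis3_hor_core2 nu tau tau' : nij (horS D nu) (coreS tau) (coreS tau') = 0.
Proof. by rewrite /nijenhuis3 !Jhor !Jcore !courant3_hor_core2 !subr0. Qed.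

Lemma nijenhuis3_core3 tau tau' tau'' : nij (coreS tau) (coreS tau') (coreS tau'') = 0.
Proof. by rewrite /nijenhuis3 !Jcore !courant3_core3 !subr0. Qed.

Lemma pull_inj f : pull f = 0 -> f = 0.
Proof.
by move=> h; apply: Cinf_ext => m; have := congr1 (fun g : Cinf _ => g (pt (0 : E m))) h.
Qed.

Lemma integrable_tensors :
  (forall s t, courant s t - courant (vbsec J s) (vbsec J t)
    + vbsec J (courant (vbsec J s) t + courant s (vbsec J t)) = 0) <->
  (forall nu mu, torsion D j nu mu = 0) /\
  (forall nu1 nu2 nu3, ssnd (jacobiator_type D j nu1 nu2 nu3) = 0).
Proof.
rewrite (nijenhuis3_integrable J2 Jorth); split=> [N0|[t0 J0]].
  split=> [nu mu|nu1 nu2 nu3].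
    apply: sec_side_ext => tau; rewrite pairing0l; apply: pull_inj.
    by rewrite -nijenhuis3_hor_core.
  by apply: lin_Cinf_inj; rewrite -nijenhuis3_hor N0 lin_Cinf0.
have hhc nu mu tau : nij (horS D nu) (horS D mu) (coreS tau) = 0.
  by rewrite nijenhuis3_hor_core t0 pairing0l pull0.
have s12 := nijenhuis3_skew12 J2 Jorth; have s23 := nijenhuis3_skew23 J2 Jorth.
apply: (nijenhuis3_zero J2 Jorth (generator_spanning Dskew)).
move=> s t r [[nu1 ->]|[t1 ->]] [[nu2 ->]|[t2 ->]] [[nu3 ->]|[t3 ->]] //.
- by rewrite nijenhuis3_hor J0 lin_Cinf0.
- by rewrite s23 hhc oppr0.
- exact: nijenhuis3_hor_core2.
- by rewrite s12 s23 hhc !oppr0.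
- by rewrite s12 nijenhuis3_hor_core2 oppr0.
- by rewrite s23 s12 nijenhuis3_hor_core2 !oppr0.
- exact: nijenhuis3_core3.
Qed.

End Integrability.

(** * Linear generalised complex structures *)

Section StdPairing.
Context {R : realType} {n : nat} {M : manifold R n}.
Local Notation F := (bsum (tangent_bundle M) (cotangent_bundle M)).

Lemma std_pairingC m (x y : F m) : std_pairing x y = std_pairing y x.
Proof. by rewrite /std_pairing addrC. Qed.

Lemma std_pairing0r m (x : F m) : std_pairing x 0 = 0.
Proof. by apply: (addrI (std_pairing x 0)); rewrite -std_pairingDr !addr0. Qed.

Lemma std_pairingNr m (x y : F m) : std_pairing x (- y) = - std_pairing x y.
Proof. by apply/eqP; rewrite -addr_eq0 -std_pairingDr addNr std_pairing0r. Qed.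

End StdPairing.

Section LinearMorphism.
Context {R : realType} {n k : nat} {M : manifold R n} (E : vbundle M k).
Local Notation S := (section (side E)).
Local Notation vb := (vec_bundle E).

Lemma side_proj_onto m (x : E m) (y : side E m) : exists xi : TTs E (pt x), side_proj xi = y.
Proof.
have [D _] := skew_dorfman_exists E.
have [nu <-] := framed_ext (framed_side E) y.
by exists (hor D nu x); rewrite side_proj_hor.
Qed.

Lemma side_proj_smooth (s : section (TTs E)) :
  @smooth_sec _ _ _ (side E) (fun m => side_proj (s (pt (0 : E m)))).
Proof.
split.
  move=> f; exact: CinfP (pull_sec (0 : section vb) (vact (sfst s) (pull_proj E f))).
apply: dual_smoothP => e.
exact: CinfP (pull_sec (0 : section vb) (feval (ssnd s) (vliftS e))).
Qed.

Section SideMorphism.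
Context (J : vbmor (TTs E) (TTs E)).

Lemma linear_over_uniq j j' : linear_over J j -> linear_over J j' ->
  forall m y, j m y = j' m y.
Proof.
move=> [h _ _] [h' _ _] m y; have [xi <-] := side_proj_onto (0 : E m) y.
by rewrite -h -h'.
Qed.

Lemma linear_over_vbmor j : linear_over J j ->
  exists j' : vbmor (side E) (side E), linear_over J j'.
Proof.
move=> Jj; have [h _ _] := Jj; have [D _] := skew_dorfman_exists E.
have lin m a (x y : side E m) : j m (a *: x + y) = a *: j m x + j m y.
  have [xi <-] := side_proj_onto (0 : E m) x; have [eta <-] := side_proj_onto (0 : E m) y.
  by rewrite -side_proj_linear -!h vb_linear side_proj_linear.
have sm (s : S) : smooth_sec (fun m => j m (s m)).
  have := side_proj_smooth (vbsec J (horS D s)); congr smooth_sec.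
  apply: functional_extensionality_dep => m.
  by rewrite -[vbsec _ _ _]/(J _ (horS D s (pt 0))) h horSE side_proj_hor.
by exists (VBMor lin sm).
Qed.

Lemma side_morphismP : (exists j, linear_over J j) -> linear_over J (side_morphism J).
Proof.
move=> [j /linear_over_vbmor h].
rewrite /side_morphism; case: xgetP => [? -> //|h']; by case: h => j' /h'.
Qed.

Lemma side_morphism_eq (j : vbmor (side E) (side E)) : linear_over J j -> side_morphism J = j.
Proof.
move=> h; apply: vbmor_ext => m x.
exact: (linear_over_uniq (side_morphismP (ex_intro _ _ h)) h).
Qed.

End SideMorphism.
End LinearMorphism.

Section Adapted.
Context {R : realType} {n k : nat} {M : manifold R n} (E : vbundle M k).
Local Notation S := (section (side E)).
Context (J : vbmor (TTs E) (TTs E)) (j : vbmor (side E) (side E)).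
Hypotheses (J2 : forall e x, J e (J e x) = - x)
  (Jorth : forall e x y, std_pairing (J e x) (J e y) = std_pairing x y)
  (Jj : linear_over J j).

Lemma J_skew e (x y : TTs E e) : std_pairing x (J e y) = - std_pairing (J e x) y.
Proof. by rewrite -Jorth J2 std_pairingNr. Qed.

Lemma J_core m (x : E m) (tau : core E m) :
  J (pt x) (core_lift x tau) = - core_lift x (jt j tau).
Proof.
have [h _ _] := Jj; have [D _] := skew_dorfman_exists E.
have /ker_side_proj [tau' e] : side_proj (J (pt x) (core_lift x tau)) = 0.
  by rewrite h side_proj_core vbmor0.
rewrite e -core_liftN; congr core_lift; apply: core_ext => y.
have [xi xiE] := side_proj_onto x y; subst y.
by rewrite -std_pairing_core -e J_skew std_pairing_core h ppairNr jtP.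
Qed.

Lemma side_square m (y : side E m) : j m (j m y) = - y.
Proof.
have [h _ _] := Jj; have [xi <-] := side_proj_onto (0 : E m) y.
rewrite -!h J2; have := side_projB 0 xi.
have -> : side_proj (0 : TTs E (pt (0 : E m))) = 0.
  by rewrite -(core_lift0 (0 : E m)) side_proj_core.
by rewrite !sub0r.
Qed.

Context (D D' : dorfman E) (Psi : S -> S -> section (dual_bundle E)).
Hypotheses (Dskew : dorf_skew D) (DD' : change_of_splitting D D' Psi).

Lemma adaptedP (D0 : dorfman E) : adapted J j D0 <->
  forall nu m (x : E m), J (pt x) (hor D0 nu x) = hor D0 (vbsec j nu) x.
Proof.
split=> h nu m => [x|e]; last by rewrite !hlift_hor.
have [e <-] := framed_ext (framed_vec E) x.
by rewrite -!hlift_hor h.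
Qed.

Lemma hor_change nu mu m (x : E m) :
  std_pairing (hor D' nu x) (hor D mu x) = Psi nu mu m x.
Proof.
rewrite hor_pairing DD' (Dskew mu nu) addrAC subrr add0r //.
Qed.

Lemma hor_change_core nu m (x : E m) : exists2 tau,
  hor D' nu x = hor D nu x + core_lift x tau &
  forall mu : S, ppair (mu m) tau = Psi nu mu m x.
Proof.
have [tau e] : exists tau, hor D' nu x - hor D nu x = core_lift x tau.
  by apply: ker_side_proj; rewrite side_projB !side_proj_hor subrr.
have e' : hor D' nu x = hor D nu x + core_lift x tau by rewrite -e addrC subrK.
exists tau => // mu; rewrite -hor_change e' std_pairingC std_pairingDr.
by rewrite hor_isotropic // add0r std_pairing_core side_proj_hor.
Qed.

Lemma adapted_change : adapted J j D' <-> forall nu mu m (x : E m),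
  std_pairing (J (pt x) (hor D nu x)) (hor D mu x) =
  Psi nu (vbsec j mu) m x + Psi (vbsec j nu) mu m x.
Proof.
have [h _ _] := Jj.
have key nu mu m (x : E m) : std_pairing (J (pt x) (hor D' nu x)) (hor D mu x) =
    std_pairing (J (pt x) (hor D nu x)) (hor D mu x) - Psi nu (vbsec j mu) m x.
  have [tau -> tauP] := hor_change_core nu x.
  have -> : J (pt x) (hor D nu x + core_lift x tau) =
      J (pt x) (hor D nu x) - core_lift x (jt j tau).
    by rewrite -J_core vbmorD.
  rewrite std_pairingC std_pairingDr std_pairingC std_pairingNr std_pairing_core.
  by rewrite side_proj_hor jtP -tauP.
rewrite adaptedP; split=> [ad nu mu m x|H nu m x].
  by have := key nu mu m x; rewrite ad hor_change => ->; rewrite addrC subrK.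
apply/eqP; rewrite -subr_eq0; apply/eqP.
have [tau e] : exists tau, J (pt x) (hor D' nu x) - hor D' (vbsec j nu) x = core_lift x tau.
  by apply: ker_side_proj; rewrite side_projB h !side_proj_hor subrr.
rewrite e -[RHS](core_lift0 x); congr core_lift; apply: core_ext => y.
have [mu muE] := framed_ext (framed_side E) y; subst y.
rewrite ppair0r -(side_proj_hor D mu x) -std_pairing_core -e std_pairingDr std_pairingNr.
by rewrite !(std_pairingC (hor D mu x)) key H hor_change addrAC addrK subrr.
Qed.

End Adapted.

Section AdaptedClass.
Context {R : realType} {n k : nat} {M : manifold R n} (E : vbundle M k).
Local Notation S := (section (side E)).
Local Notation db := (dual_bundle E).
Context (J : vbmor (TTs E) (TTs E)) (j : vbmor (side E) (side E)).
Hypotheses (J2 : forall e x, J e (J e x) = - x)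
  (Jorth : forall e x y, std_pairing (J e x) (J e y) = std_pairing x y)
  (Jj : linear_over J j).

Lemma lin_Cinf_exists (f : Cinf (Defs.total E)) :
  (forall m (x y : E m), f (pt (x + y)) = f (pt x) + f (pt y)) ->
  (forall m r (x : E m), f (pt (r *: x)) = r * f (pt x)) ->
  exists eps : section db, lin_Cinf eps = f.
Proof.
move=> fD fZ.
have lin m a (x y : E m) : f (pt (a *: x + y)) = a * f (pt x) + f (pt y).
  by rewrite fD fZ.
have sm : @smooth_sec _ _ _ db (fun m => Dual (@lin m)).
  by have := CinfP f; congr smooth_fun; apply/funext => -[m x].
by exists (MkSection sm); apply: Cinf_ext => -[m x].
Qed.

Section Sharp.
Context (D : dorfman E) (Dskew : dorf_skew D).

Lemma sharp_exists (nu mu : S) : exists eps : section db,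
  lin_Cinf eps = sp (vbsec J (horS D nu)) (horS D mu).
Proof.
have [_ Jsum Jscale] := Jj; apply: lin_Cinf_exists => m => [x y|r x]; rewrite !spE.
  have h ka := side_sum_hor D ka x y 0 0; rewrite addr0 in h.
  apply: side_sum_pairing; [apply: Jsum|]; rewrite !horSE.
    by have := h nu; rewrite !core_lift0 !addr0.
  by have := h mu; rewrite !core_lift0 !addr0.
have h ka := side_scale_hor D ka x r 0; rewrite scaler0 in h.
apply: side_scale_pairing; [apply: Jscale|]; rewrite !horSE.
  by have := h nu; rewrite !core_lift0 !addr0.
by have := h mu; rewrite !core_lift0 !addr0.
Qed.

Definition sharp (nu mu : S) : section db := projT1 (cid (sharp_exists nu mu)).

Lemma lin_sharp nu mu : lin_Cinf (sharp nu mu) = sp (vbsec J (horS D nu)) (horS D mu).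
Proof. by rewrite /sharp; case: cid. Qed.

Lemma sharpE nu mu m (x : E m) :
  sharp nu mu m x = std_pairing (J (pt x) (hor D nu x)) (hor D mu x).
Proof.
rewrite -[LHS]/(lin_Cinf (sharp nu mu) (pt x)) lin_sharp spE.
by rewrite -[vbsec _ _ _]/(J _ (horS D nu (pt x))) !horSE.
Qed.

Lemma sharp_linl f nu nu' mu :
  sharp (f *: nu + nu') mu = f *: sharp nu mu + sharp nu' mu.
Proof.
apply: lin_Cinf_inj; rewrite lin_CinfD lin_CinfZ !lin_sharp.
by rewrite horS_linear vbsec_lin spDl spZl.
Qed.

Lemma sharp_skew nu mu : sharp mu nu = - sharp nu mu.
Proof.
by apply: lin_Cinf_inj; rewrite lin_CinfN !lin_sharp (sp_skew J2 Jorth) spC.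
Qed.

Lemma sharp_linr f nu mu mu' :
  sharp nu (f *: mu + mu') = f *: sharp nu mu + sharp nu mu'.
Proof. by rewrite sharp_skew sharp_linl opprD -scalerN -!sharp_skew. Qed.

Lemma sharp_j nu mu : sharp (vbsec j nu) mu = sharp nu (vbsec j mu).
Proof.
have [h _ _] := Jj.
apply: section_ext => m; apply: dual_ext => x; rewrite !sharpE.
have [tau e] : exists tau, J (pt x) (hor D nu x) - hor D (vbsec j nu) x = core_lift x tau.
  by apply: ker_side_proj; rewrite side_projB h !side_proj_hor subrr.
have e1 : J (pt x) (hor D nu x) = hor D (vbsec j nu) x + core_lift x tau.
  by rewrite -e addrC subrK.
have e2 : J (pt x) (hor D (vbsec j nu) x) = - hor D nu x + core_lift x (jt j tau).
  have := vbmorD J (hor D (vbsec j nu) x) (core_lift x tau).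
  by rewrite -e1 J2 (J_core J2 Jorth Jj) => ->; rewrite subrK.
rewrite e1 e2 ![std_pairing (_ + _) _]std_pairingC !std_pairingDr std_pairingNr.
rewrite !hor_isotropic // oppr0 !add0r !std_pairing_core !side_proj_hor.
by rewrite jtP.
Qed.

(* D' is adapted iff [Psi nu (j mu) + Psi (j nu) mu = sharp nu mu]; by [sharp_j]
   this is solved by [Psi nu mu = - sharp nu (j mu) / 2]. *)
Lemma adapted_exists : exists2 D' : dorfman E, dorf_skew D' & adapted J j D'.
Proof.
pose Psi nu mu : section db := Ccst (- 2^-1) *: sharp nu (vbsec j mu).
have Psil f nu nu' mu : Psi (f *: nu + nu') mu = f *: Psi nu mu + Psi nu' mu.
  by rewrite /Psi sharp_linl scalerDr !scalerA mulrC.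
have Psir f nu mu mu' : Psi nu (f *: mu + mu') = f *: Psi nu mu + Psi nu mu'.
  by rewrite /Psi vbsec_lin sharp_linr scalerDr !scalerA mulrC.
have Psi_skew nu mu : Psi mu nu = - Psi nu mu.
  by rewrite /Psi -sharp_j sharp_skew scalerN.
have [B BE] : exists B : S -> S -> S, forall nu mu, B nu mu = dull D nu mu + spair 0 (Psi nu mu).
  by eexists.
have [h1 h2 h3 h4] := dull_bracketP D.
have sfstB nu mu : sfst (B nu mu) = sfst (dull D nu mu).
  by rewrite BE sfstD sfst_pair addr0.
have ssndB nu mu : ssnd (B nu mu) = ssnd (dull D nu mu) + Psi nu mu.
  by rewrite BE ssndD ssnd_pair.
have HB : dull_bracket B.
  split.
  - move=> a nu nu' mu; apply: spair_ext.
      by rewrite sfstD sfstZ !sfstB h1 sfstD sfstZ.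
    by rewrite ssndD ssndZ !ssndB h1 ssndD ssndZ Psil scalerDr addrACA.
  - move=> f nu mu mu'; apply: spair_ext.
      by rewrite !(sfstD, sfstZ, sfstB) h2 !(sfstD, sfstZ).
    rewrite !(ssndD, ssndZ, ssndB) h2 !(ssndD, ssndZ) Psir scalerDr.
    by rewrite [LHS](AC (3*2) ((1*4)*2*(3*5)))%AC.
  - move=> f nu mu; apply: spair_ext.
      by rewrite !(sfstD, sfstZ, sfstN, sfstB) h3 !(sfstD, sfstZ, sfstN).
    rewrite !(ssndD, ssndZ, ssndN, ssndB) h3 !(ssndD, ssndZ, ssndN).
    have := Psil f nu 0 mu; have := Psil 1 0 0 mu.
    rewrite !scale1r !addr0 => /eqP; rewrite -subr_eq0 opprD addrA subrr add0r oppr_eq0 => /eqP ->.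
    by rewrite addr0 => ->; rewrite scalerDr addrAC.
  - by move=> nu mu f; rewrite /pr_act sfstB; exact: h4.
have [D' D'B] := dorfman_of_bracket HB; exists D'.
  move=> nu mu; rewrite D'B !BE Dskew Psi_skew opprD; congr (_ + _).
  by apply: spair_ext; rewrite ?(sfstN, ssndN) ?sfst_pair ?ssnd_pair ?oppr0.
have DD' : change_of_splitting D D' Psi by move=> nu mu; rewrite D'B BE.
apply/(adapted_change J2 Jorth Jj Dskew DD') => nu mu m x; rewrite -sharpE.
rewrite -[RHS]/((Psi nu (vbsec j mu) + Psi (vbsec j nu) mu) m x).
congr (fun eps : section db => eps m x).
rewrite /Psi sharp_j (vbsecK _ (side_square J2 Jj)).
have -> : sharp nu (- mu) = - sharp nu mu.
  have := sharp_linr (-1) nu mu 0; rewrite !scaleN1r addr0 => ->.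
  have : sharp nu 0 = 0.
    by have := sharp_linr 1 nu 0 0; rewrite !scale1r addr0 -[LHS]addr0 => /addrI.
  by move=> ->; rewrite addr0.
rewrite scalerN -scaleNr -scalerDl -[LHS]scale1r; congr (_ *: _).
have <- : Ccst 2^-1 = - Ccst (- 2^-1) :> Cinf M by apply: Cinf_ext => z; rewrite /= opprK.
by rewrite -[in RHS](mulr1 (Ccst _)) -mulrDr half2.
Qed.

End Sharp.

Lemma change_exists (D D' : dorfman E) : exists Psi, change_of_splitting D D' Psi.
Proof.
exists (fun nu mu => ssnd (dull D' nu mu - dull D nu mu)) => nu mu.
apply: spair_ext; first by rewrite sfstD sfst_pair addr0 !dl_fst.
by rewrite ssndD ssnd_pair ssndB addrC subrK.
Qed.

Lemma adapted_equivalent (D D' : dorfman E) : dorf_skew D -> adapted J j D ->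
  adapted J j D' <-> j_equivalent j D D'.
Proof.
move=> Dskew ad; have [h _ _] := Jj.
have [Psi DD'] := change_exists D D'.
have jj mu : vbsec j (vbsec j mu) = - mu := vbsecK mu (side_square J2 Jj).
have PsiE nu mu : spair 0 (Psi nu mu) = dull D' nu mu - dull D nu mu.
  by rewrite DD' addrC addKr.
have PsiNr nu mu : Psi nu (- mu) = - Psi nu mu.
  have := congr1 (fun s : S => ssnd s) (PsiE nu (- mu)); rewrite ssnd_pair => ->.
  by rewrite !dullNr -opprD -PsiE ssndN ssnd_pair.
have key : adapted J j D' <-> forall nu mu, Psi nu (vbsec j mu) + Psi (vbsec j nu) mu = 0.
  rewrite (adapted_change J2 Jorth Jj Dskew DD').
  have e nu mu m (x : E m) : std_pairing (J (pt x) (hor D nu x)) (hor D mu x) = 0.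
    by move/adaptedP: ad => ->; rewrite hor_isotropic.
  split=> H nu mu => [|m x].
    by apply: section_ext => m; apply: dual_ext => x; rewrite -[LHS]H e.
  by rewrite e -[RHS]/((Psi nu (vbsec j mu) + Psi (vbsec j nu) mu) m x) H.
rewrite key; split=> [H|[Psi' DD'' H]].
  exists Psi => // nu mu; have := H nu (vbsec j mu); rewrite jj PsiNr.
  by move/eqP; rewrite addrC subr_eq0 => /eqP.
have e : Psi = Psi'.
  apply/funext => a; apply/funext => b.
  by have := congr1 (fun s : S => ssnd s) (PsiE a b); rewrite DD'' addrC addKr !ssnd_pair.
by move=> nu mu; rewrite -e in H *; rewrite H jj PsiNr addNr.
Qed.


End AdaptedClass.

Section LocalSmoothness.
Context {R : realType} {n : nat} {M : manifold R n}.
Local Notation F := (bsum (tangent_bundle M) (cotangent_bundle M)).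

Lemma std_smooth_loc (s : forall m, F m) :
  (forall p : M, exists (chi : Cinf M) (t : section F),
     chi p != 0 /\ forall m, chi m *: s m = t m) -> smooth_sec s.
Proof.
move=> h; split.
  move=> f; apply: smooth_fun_loc => p; have [chi [t [c0 E]]] := h p.
  exists chi => //; have := CinfP (vact (sfst t) f); congr smooth_fun.
  by apply/funext => m; rewrite /= -E.
move=> X; apply: smooth_fun_loc => p; have [chi [t [c0 E]]] := h p.
exists chi => //; have := CinfP (feval (ssnd t) X); congr smooth_fun.
by apply/funext => m; rewrite /= -E.
Qed.

End LocalSmoothness.

Section Construction.
Context {R : realType} {n k : nat} {M : manifold R n} (E : vbundle M k).
Local Notation S := (section (side E)).
Local Notation tot := (Defs.total E).
Context (D : dorfman E) (j : vbmor (side E) (side E)).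
Hypotheses (Dskew : dorf_skew D) (j2 : forall m x, j m (j m x) = - x).

Definition split_lift m (x : E m) (xi : TTs E (pt x)) : S * core E m :=
  let w := cid (hor_core_decomp D xi) in (projT1 w, projT1 (cid (projT2 w))).

Lemma split_liftE m (x : E m) (xi : TTs E (pt x)) :
  xi = hor D (split_lift xi).1 x + core_lift x (split_lift xi).2.
Proof. by rewrite /split_lift /=; case: cid => nu p /=; case: cid. Qed.

Definition gcs_fib m (x : E m) (xi : TTs E (pt x)) : TTs E (pt x) :=
  hor D (vbsec j (split_lift xi).1) x + core_lift x (- jt j (split_lift xi).2).

Lemma gcs_fibE m (x : E m) nu (tau : core E m) :
  gcs_fib (hor D nu x + core_lift x tau) =
  hor D (vbsec j nu) x + core_lift x (- jt j tau).
Proof.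
rewrite /gcs_fib; set xi := hor D nu x + _; have e := split_liftE xi.
move: (split_lift xi) e => [mu sig] /= e.
have mn : mu m = nu m.
  by have := side_proj_hor_core D nu x tau; rewrite -/xi e side_proj_hor_core.
rewrite (@hor_pt _ _ _ _ _ D (vbsec j mu) (vbsec j nu)); last by rewrite /= mn.
move: e; rewrite /xi (@hor_pt _ _ _ _ _ D mu nu) // => /addrI /core_lift_inj -> //.
Qed.

Lemma gcs_fib_linear m (x : E m) a (xi eta : TTs E (pt x)) :
  gcs_fib (a *: xi + eta) = a *: gcs_fib xi + gcs_fib eta.
Proof.
have [nu [tau ->]] := hor_core_decomp D xi; have [mu [sig ->]] := hor_core_decomp D eta.
have C (f : Cinf M) (nu' mu' : S) (tau' sig' : core E m) : f m *: (hor D nu' x + core_lift x tau') +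
    (hor D mu' x + core_lift x sig') =
    hor D (f *: nu' + mu') x + core_lift x (f m *: tau' + sig').
  by rewrite hor_linear core_lift_linear scalerDr addrACA.
by rewrite !gcs_fibE -[a]/(Ccst a m) !C gcs_fibE vbsec_lin jt_linear opprD -scalerN.
Qed.

Definition gcs_fun (e : tot) : TTs E e -> TTs E e :=
  match e with existT m x => @gcs_fib m x end.

Lemma gcs_fun_linear e a (xi eta : TTs E e) :
  gcs_fun (a *: xi + eta) = a *: gcs_fun xi + gcs_fun eta.
Proof. by case: e xi eta => m x xi eta; apply: gcs_fib_linear. Qed.

Lemma gcs_fun_horS nu e : gcs_fun (horS D nu e) = horS D (vbsec j nu) e.
Proof.
case: e => m x; rewrite -[existT _ _ _]/(pt x) !horSE.
rewrite -[hor D nu x]addr0 -(core_lift0 x) -[LHS]/(gcs_fib _) gcs_fibE.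
have -> : jt j (0 : core E m) = 0.
  by apply: core_ext => y; rewrite jtP !ppair0r.
by rewrite oppr0 core_lift0 addr0.
Qed.

Lemma gcs_fun_coreS tau e : gcs_fun (coreS tau e) = coreS (- jtS j tau) e.
Proof.
case: e => m x; rewrite -[existT _ _ _]/(pt x) !coreSE.
rewrite -[core_lift x _]add0r -(hor0 D x) -[LHS]/(gcs_fib _) gcs_fibE.
by rewrite vbsec0 hor0 add0r secNE jtSE.
Qed.

Lemma gcs_fun_smooth (s : section (TTs E)) : smooth_sec (fun e => gcs_fun (s e)).
Proof.
apply: std_smooth_loc => p; have [chi [c0 H]] := generator_spanning Dskew p.
have [I [f [g [Gg EE]]]] := H s.
have /choice [G HG] : forall i, exists G : section (TTs E), forall e, gcs_fun (g i e) = G e.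
  move=> i; case: (Gg i) => [[nu ->]|[tau ->]].
    by exists (horS D (vbsec j nu)) => e; exact: gcs_fun_horS.
  by exists (coreS (- jtS j tau)) => e; exact: gcs_fun_coreS.
exists chi, (\sum_i f i *: G i); split=> // e.
have F0 : gcs_fun (0 : TTs E e) = 0.
  by have := gcs_fun_linear (-1) (0 : TTs E e) 0; rewrite scaler0 addr0 scaleN1r addNr.
have FD (x y : TTs E e) : gcs_fun (x + y) = gcs_fun x + gcs_fun y.
  by have := gcs_fun_linear 1 x y; rewrite !scale1r.
have FZ a (x : TTs E e) : gcs_fun (a *: x) = a *: gcs_fun x.
  by have := gcs_fun_linear a x 0; rewrite F0 !addr0.
rewrite sec_sumE -FZ -secZE EE sec_sumE (big_morph _ FD F0).
by apply: eq_bigr => i _; rewrite !secZE FZ HG.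
Qed.

Definition gcs_of : vbmor (TTs E) (TTs E) := VBMor gcs_fun_linear gcs_fun_smooth.

Lemma gcs_ofE m (x : E m) nu (tau : core E m) :
  gcs_of (pt x) (hor D nu x + core_lift x tau) =
  hor D (vbsec j nu) x + core_lift x (- jt j tau).
Proof. exact: gcs_fibE. Qed.

Lemma hor_core_pairing m (x : E m) (nu mu : S) (tau sig : core E m) :
  std_pairing (hor D nu x + core_lift x tau) (hor D mu x + core_lift x sig) =
  ppair (nu m) sig + ppair (mu m) tau.
Proof.
rewrite std_pairingDr std_pairing_core side_proj_hor_core std_pairingC std_pairingDr.
by rewrite hor_isotropic // add0r std_pairing_core side_proj_hor addrC.
Qed.

Lemma gcs_of_square e (xi : TTs E e) : gcs_of e (gcs_of e xi) = - xi.
Proof.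
case: e xi => m x xi; have [nu [tau ->]] := hor_core_decomp D xi.
rewrite -[existT _ _ _]/(pt x) !gcs_ofE (vbsecK _ j2).
have -> : hor D (- nu) x = - hor D nu x.
  by apply/eqP; rewrite -addr_eq0 -horD addNr hor0.
rewrite opprD; congr (_ + _); rewrite -core_liftN; congr core_lift.
by apply: core_ext => y; rewrite !ppairNr !jtP ppairNr jtP j2 ppairNl !opprK.
Qed.

Lemma gcs_of_orthogonal e (xi eta : TTs E e) :
  std_pairing (gcs_of e xi) (gcs_of e eta) = std_pairing xi eta.
Proof.
case: e xi eta => m x xi eta.
have [nu [tau ->]] := hor_core_decomp D xi; have [mu [sig ->]] := hor_core_decomp D eta.
rewrite -[existT _ _ _]/(pt x) !gcs_ofE !hor_core_pairing !ppairNr !jtP.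
by rewrite -[vbsec j nu m]/(j m (nu m)) -[vbsec j mu m]/(j m (mu m)) !j2 !ppairNl !opprK.
Qed.

Lemma gcs_of_linear_over : linear_over gcs_of j.
Proof.
split.
- move=> m x xi; have [nu [tau ->]] := hor_core_decomp D xi.
  by rewrite gcs_ofE !side_proj_hor_core.
- move=> m x x' xi xi' eta h; have [e _ _ _] := h.
  have [nu [tau xiE]] := hor_core_decomp D xi.
  have [nu' [tau' xiE']] := hor_core_decomp D xi'.
  move: e; rewrite {1}xiE {1}xiE' !side_proj_hor_core => e.
  rewrite (@hor_pt _ _ _ _ _ D nu' nu) // in xiE'; subst xi xi'.
  rewrite (side_sum_unique D h (side_sum_hor D nu x x' tau tau')) !gcs_ofE.
  rewrite jtD opprD; exact: side_sum_hor.
- move=> m x r xi eta h; have [nu [tau xiE]] := hor_core_decomp D xi; subst xi.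
  rewrite (side_scale_unique D h (side_scale_hor D nu x r tau)) !gcs_ofE.
  have -> : jt j (r *: tau) = r *: jt j tau.
    by apply: core_ext => y; rewrite jtP !ppairZr jtP.
  rewrite -scalerN; exact: side_scale_hor.
Qed.

Lemma gcs_of_adapted : adapted gcs_of j D.
Proof.
apply/adaptedP => nu m x; have := gcs_fun_horS nu (pt x).
by rewrite !horSE.
Qed.

Lemma gcs_of_gcs : complex_lie_algebroid j (bracketA j D) (rho j) -> gcs gcs_of.
Proof.
move=> cla; split; [exact: gcs_of_square|exact: gcs_of_orthogonal|].
apply/(integrable_tensors gcs_of_square gcs_of_orthogonal Dskew).
- by move=> nu; apply: section_ext => e; exact: gcs_fun_horS.
- by move=> tau; apply: section_ext => e; exact: gcs_fun_coreS.
exact: (complex_lie_algebroid_tensors Dskew j2 cla).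
Qed.

End Construction.

Section Correspondence.
Context {R : realType} {n k : nat} {M : manifold R n} (E : vbundle M k).

Lemma adapted_classP (J : vbmor (TTs E) (TTs E)) D : linear_gcs J -> adapted_class J D ->
  adapted_class J = [set D' | dorf_skew D' /\ j_equivalent (side_morphism J) D D'].
Proof.
move=> [[J2 Jorth _] /side_morphismP Jj] [Dskew ad].
by apply/seteqP; split=> D' [sk h]; split=> //;
  exact/(adapted_equivalent J2 Jorth Jj D' Dskew ad).
Qed.

Lemma linear_gcs_data (J : vbmor (TTs E) (TTs E)) : linear_gcs J ->
  gcs_data (side_morphism J) (adapted_class J).
Proof.
move=> HJ; have [[J2 Jorth Jint] /side_morphismP Jj] := HJ.
have j2 := side_square J2 Jj.
split=> // [|D [Dskew ad]].
  have [D1 D1skew] := skew_dorfman_exists E.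
  have [D Dskew ad] := adapted_exists J2 Jorth Jj D1skew.
  by exists D => //; apply: adapted_classP.
have Jhor nu : vbsec J (horS D nu) = horS D (vbsec (side_morphism J) nu).
  apply: section_ext => -[m x]; rewrite -[existT _ _ _]/(pt x) horSE.
  by rewrite -[LHS]/(J (pt x) (horS D nu (pt x))) horSE; exact: ((adaptedP J _ D).1 ad).
have Jcore tau : vbsec J (coreS tau) = coreS (- jtS (side_morphism J) tau).
  apply: section_ext => -[m x]; rewrite -[LHS]/(J (pt x) (core_lift x (tau m))).
  by rewrite (J_core J2 Jorth Jj) -core_liftN -[RHS]/(core_lift x _) secNE jtSE.
have [t0 J0] := (integrable_tensors J2 Jorth Dskew Jhor Jcore).1 Jint.
exact: bracketA_complex_lie_algebroid.
Qed.

Lemma linear_gcs_ext (J J' : vbmor (TTs E) (TTs E)) : linear_gcs J -> linear_gcs J' ->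
  side_morphism J = side_morphism J' -> adapted_class J = adapted_class J' -> J = J'.
Proof.
move=> HJ HJ' ej eC; have [D0 D0skew] := skew_dorfman_exists E.
have [D DJ] : exists D, adapted_class J D.
  have [[J2 Jorth _] /side_morphismP Jj] := HJ.
  by have [D Dskew ad] := adapted_exists J2 Jorth Jj D0skew; exists D.
have [Dskew /adaptedP ad] := DJ.
move: (DJ); rewrite eC => -[_ /adaptedP ad'].
have [[J2 Jorth _] /side_morphismP Jj] := HJ.
have [[J2' Jorth' _] /side_morphismP Jj'] := HJ'.
apply: vbmor_ext => -[m x] xi; rewrite -[existT _ _ _]/(pt x).
have [nu [tau ->]] := hor_core_decomp D xi.
by rewrite !vbmorD ad ad' (J_core J2 Jorth Jj) (J_core J2' Jorth' Jj') ej.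
Qed.

Lemma gcs_data_linear_gcs (j : vbmor (side E) (side E)) (C : set (dorfman E)) : gcs_data j C ->
  exists J, [/\ linear_gcs J, side_morphism J = j & adapted_class J = C].
Proof.
move=> [j2 [D Dskew eC] cla].
have CD : C D.
  rewrite eC; split=> //; exists (fun _ _ => 0) => // nu mu.
  rewrite -[LHS]addr0; congr (_ + _).
  by apply: spair_ext; rewrite ?sfst_pair ?ssnd_pair ?sfst0 ?ssnd0.
have Jj := gcs_of_linear_over j Dskew.
have HJ : linear_gcs (gcs_of j Dskew).
  by split; [exact: (gcs_of_gcs Dskew j2 (cla _ CD))|exists j].
exists (gcs_of j Dskew); rewrite (side_morphism_eq Jj); split=> //.
rewrite (adapted_classP HJ (D := D)) ?(side_morphism_eq Jj) ?eC //.
by split=> //; rewrite (side_morphism_eq Jj); exact: gcs_of_adapted.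
Qed.

End Correspondence.

Theorem theorem4p10 (R : realType) (n k : nat) (M : manifold R n)
    (E : vbundle M k) :
  set_bij [set J : vbmor (TTs E) (TTs E) | linear_gcs J]
          [set d : vbmor (side E) (side E) * set (dorfman E) |
             gcs_data d.1 d.2]
          (fun J => (side_morphism J, adapted_class J)).
Proof.
split.
- by move=> J /linear_gcs_data.
- by move=> J J' /set_mem HJ /set_mem HJ' [ej eC]; exact: linear_gcs_ext.
move=> [j C] /gcs_data_linear_gcs [J [HJ ej eC]].
by exists J => //; rewrite ej eC.
Qed.
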